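(* Let $0<\varepsilon\le1$ be a constant and $s=s(n)$ an integer with $|s|\le(1-\varepsilon)n$. Let $X_n$ be a random $n\times n$ matrix whose rows are independent random vectors, each uniform on the set $\mathcal S$ of vectors in $\{-1,1\}^n$ with coordinate sum $s-1$ or $s+1$. Let $\gamma$ be a constant and let $F=(f_{ij})$ be a deterministic complex $n\times n$ matrix with $|f_{ij}|\le n^\gamma$ for all $i,j$. Then for any $B>0$ there exists $A>0$ depending on $B$ and $\gamma$ such that $$\mathbb P\big(\sigma_n(X_n+F)<n^{-A}\big)\le O(n^{-B}).$$
   Context: $\sigma_n(M)$ denotes the least singular value of an $n\times n$ matrix $M$. *)

(* Defs.v *)
From HB Require Import structures.
From mathcomp Require Import all_boot all_order all_algebra.
From mathcomp Require Import all_classical all_reals all_analysis.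
From mathcomp.real_closed Require Import complex.
Set Implicit Arguments. Unset Strict Implicit. Unset Printing Implicit Defensive.
Import Order.TTheory GRing.Theory Num.Theory.
Local Open Scope ring_scope.
Local Open Scope classical_set_scope.

Definition pm1 (b : bool) : int := if b then 1 else -1.

Definition rowsum (n : nat) (v : 'rV[bool]_n) : int := \sum_(j < n) pm1 (v 0 j).

Definition Sset (n : nat) (s : int) : {set 'rV[bool]_n} :=
  [set v | (rowsum v == s - 1) || (rowsum v == s + 1)].

Definition rowprob (R : realType) (n : nat) (s : int) (v : 'rV[bool]_n) : R :=
  if v \in Sset n s then (#|Sset n s|%:R)^-1 else 0.

Definition probX (R : realType) (n : nat) (s : int) (E : pred 'M[bool]_n) : R :=
  \sum_(X : 'M[bool]_n | E X) \prod_(i < n) rowprob R s (row i X).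

Definition signmx (R : realType) (n : nat) (X : 'M[bool]_n) : 'M[R[i]]_n :=
  map_mx (fun b : bool => if b then 1 else -1) X.

Definition cvnorm (R : realType) (n : nat) (x : 'cV[R[i]]_n) : R :=
  Num.sqrt (\sum_(i < n) (Normc.normc (x i 0)) ^+ 2).

Definition sigma_min (R : realType) (n : nat) (M : 'M[R[i]]_n) : R :=
  inf [set cvnorm (M *m x) | x in [set x : 'cV[R[i]]_n | cvnorm x = 1]].

(* Main.v *)
(** Cramer's rule: if the least singular value is at most [t], then for some
    row [l] every vector [v] orthogonal to the other rows, normalised by its
    largest entry, satisfies [|row_l . v| <= n^2 t]; since [v] can be chosen
    independently of row [l], it remains to bound the concentration function of
    [row_l . v], that is of the sum of the coordinates of [v] over a random
    subset of size [a] or [a + 1].  A subset sum contains the sum of an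
    independent sample of coordinates, whose law is obtained from smaller ones by
    repeated threefold convolution; each convolution improves the concentration
    by a constant factor when the scale is halved.

    - A normal vector close to a constant outside few coordinates is excluded by
      a net: changing one coordinate of a row moves [row . v] away from [0]
      with probability bounded below.
    - For all other [v] the concentration improves along a geometric sequence of
      scales down to a negative power of [n], unless it stagnates at one of
      them.  Stagnation forces many near coincidences between [k]-fold
      sums of coordinates within every large coordinate set.  Rounded to a
      grid, such vectors are few: solving one coordinate at a time from a
      coincidence in which it is involved leaves a bounded choice at
      almost all coordinates.  This beats the probability that the [n - 1] rows
      are nearly orthogonal to a given one of them. *)
Require Import Defs.
From HB Require Import structures.
From mathcomp Require Import all_boot all_order all_algebra.
From mathcomp Require Import all_classical all_reals all_analysis.
From mathcomp.real_closed Require Import complex.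
From mathcomp Require Import ring lra zify.
From mathcomp Require Import fintype finset.
Set Implicit Arguments. Unset Strict Implicit. Unset Printing Implicit Defensive.
Import Order.TTheory GRing.Theory Num.Theory.
Local Open Scope ring_scope.

(** * Concentration of sums of finite lists of plane vectors *)

Section Laws.
Variable R : realFieldType.
Implicit Types (L K : seq (R * R)) (l q e : R).

(** A twofold convolution need not improve anything: for the uniform law on [N] well separated
    points symmetric about a centre, the sum of two samples hits twice the centre with the same
    probability [1 / N]. A third summand removes this obstruction, at the price of the restriction
    [q <= 3 / 4]; laws closer to a point mass are spread out beforehand.

    The obstacle in both nets is that the mesh is a negative power of [n], so a freely chosen
    coordinate costs a power of [n]. Against almost constant vectors a row gains only a constant
    factor, so the exceptional coordinates must number far fewer than [n / log n]. Against
    structured vectors a solved coordinate has about [1 / q] values, and a row gains the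
    concentration at the larger scale. To win this comparison, stagnation is declared against a
    factor [loss] weaker than the proved [gain], with [gain <= loss ^+ 3].

    Everything is measured by one integer [m] with [243 ^ m <= n <= 243 ^ (2 * m)]: scales, net
    sizes and concentration bounds are compared through [m]-th powers of constants, and the number
    [J] of scales turns [loss ^+ m] into any prescribed power of [n]. *)

Definition close l (x y : R * R) := (`|x.1 - y.1| <= l) && (`|x.2 - y.2| <= l).

(** The Levy concentration function at radius [l], in the sup norm, is at most [q]. A law is a
    finite list counted with multiplicity, so independent sums are list convolutions and
    probabilities are ratios of counts. *)
Definition conc l q L := forall z, (count (close l z) L)%:R <= q * (size L)%:R.

Definition conv L K := [seq x + y | x <- L, y <- K].

Definition triple L := conv L (conv L L).

Lemma close_sym l x y : close l x y = close l y x.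
Proof. by rewrite /close distrC (distrC x.2). Qed.

Lemma close_trans l k x y z : close l x y -> close k y z -> close (l + k) x z.
Proof.
move=> /andP[h1 h2] /andP[h3 h4]; apply/andP; split.
  by rewrite (le_trans (ler_distD y.1 _ _))// lerD.
by rewrite (le_trans (ler_distD y.2 _ _))// lerD.
Qed.

Lemma closeW l k x y : l <= k -> close l x y -> close k x y.
Proof. by move=> lk /andP[h1 h2]; rewrite /close !(le_trans _ lk). Qed.

Lemma close_addl l x y z : close l (x + y) (x + z) = close l y z.
Proof.
have h (a b c : R) : a + b - (a + c) = b - c by ring.
by rewrite /close /= !h.
Qed.

Lemma close_subl l x y z : close l (z - x) y = close l z (x + y).
Proof.
have h (a b c : R) : a - b - c = a - (b + c) by ring.
by rewrite /close /= !h.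
Qed.

Lemma closeN l x y : close l (- x) (- y) = close l x y.
Proof.
have h (a b : R) : - a - - b = - (a - b) by ring.
by rewrite /close /= !h !normrN.
Qed.

Lemma closexx l x : 0 <= l -> close l x x.
Proof. by rewrite /close !subrr !normr0 => ->. Qed.

Lemma size_conv L K : size (conv L K) = (size L * size K)%N.
Proof. exact: size_allpairs. Qed.

Lemma sumr_count (T : Type) (P : pred T) (s : seq T) :
  (count P s)%:R = \sum_(x <- s) (P x)%:R :> R.
Proof. by elim: s => [|x s IH]; rewrite ?big_nil//= big_cons natrD IH. Qed.

Lemma sub_in_count (T : eqType) (P Q : pred T) (s : seq T) :
  {in s, subpred P Q} -> (count P s <= count Q s)%N.
Proof.
elim: s => //= x s IH h; apply: leq_add.
  by case: (P x) (h x (mem_head _ _)) => // ->.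
by apply: IH => y ys; apply: h; rewrite inE ys orbT.
Qed.

Lemma count_conv (P : pred (R * R)) L K :
  (count P (conv L K))%:R = \sum_(x <- L) (count (fun y => P (x + y)) K)%:R :> R.
Proof.
rewrite sumr_count big_allpairs_dep; apply: eq_bigr => x _.
by rewrite sumr_count.
Qed.

(** Markov's inequality for the deficit [M - g x], which is nonnegative and on average less than
    [d * M]. *)
Lemma count_lower_markov (T : Type) (s : seq T) (g : T -> R) (M e d : R) :
  0 < M -> (forall x, g x <= M) ->
  (1 - d) * M * (size s)%:R < \sum_(x <- s) g x ->
  e * (count (fun x => g x <= (1 - e) * M) s)%:R < d * (size s)%:R.
Proof.
move=> M0 gM; set b := count _ s.
suff : \sum_(x <- s) g x <= (size s)%:R * M - e * b%:R * M.
  move=> h1 h2; have := lt_le_trans h2 h1.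
  rewrite -(ltr_pM2r M0) => ?; nra.
rewrite /b; elim: s {b} => [|x s IH]; first by rewrite big_nil/= !(mul0r,mulr0) subr0.
rewrite big_cons /= natrD -natr1; have gx := gM x.
by case: (boolP (g x <= _)) => [h|_] /=; lra.
Qed.

(** Greedy choice: a point is kept only when none of the points already kept is close to it. *)
Lemma exists_separated_net l (A : seq (R * R)) : exists X : seq (R * R),
  [/\ {subset X <= A}, pairwise (fun x y => ~~ close l x y) X &
      forall a, a \in A -> 0 <= l -> has (close l a) X].
Proof.
elim: A => [|a A [X [sX pX hX]]]; first by exists [::]; split.
case: (boolP (has (close l a) X)) => h.
  exists X; split=> // [x /sX|b]; first by rewrite inE orbC => ->.
  by rewrite inE => /orP[/eqP ->//|/hX].
exists (a :: X); split.
- move=> x; rewrite !inE => /orP[->//|/sX ->]; by rewrite orbT.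
- rewrite pairwise_cons pX andbT; apply/allP => x xX; apply/negP => cx.
  by move/hasPn: h => /(_ _ xX); rewrite cx.
- move=> b; rewrite inE /= => /orP[/eqP -> l0|bA l0]; first by rewrite closexx.
  by rewrite hX// orbT.
Qed.

Lemma count_has_le (T U : Type) (P : U -> pred T) (X : seq U) (s : seq T) (M : R) :
  (forall x, (count (P x) s)%:R <= M) ->
  (count (fun y => has (fun x => P x y) X) s)%:R <= (size X)%:R * M.
Proof.
move=> hM; elim: X => [|x X IH]; first by rewrite count_pred0 mul0r.
have h : (count (fun y => has (P^~ y) (x :: X)) s <=
    count (P x) s + count (fun y => has (P^~ y) X) s)%N.
  by rewrite -count_predUI leq_addr.
apply: (@le_trans _ _ ((count (P x) s + count (fun y => has (P^~ y) X) s)%N%:R)).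
  by rewrite ler_nat.
by rewrite natrD -natr1 mulrDl mul1r addrC lerD.
Qed.

Lemma count_disjoint_ge (T : eqType) (U : eqType) (P : U -> pred T) (Q : pred T)
    (X : seq U) (s : seq T) (M : R) :
  pairwise (fun x y => all (fun t => ~~ (P x t && P y t)) s) X ->
  {in X, forall x, M <= (count (P x) s)%:R} ->
  {in X, forall x, subpred (P x) Q} ->
  (size X)%:R * M <= (count Q s)%:R.
Proof.
move=> dX hM sQ.
apply: (@le_trans _ _ ((count (fun y => has (fun x => P x y) X) s)%:R)); last first.
  by rewrite ler_nat; apply: sub_count => t /hasP[x /sQ]; apply.
elim: X dX hM {sQ} => [|x X IH]; first by rewrite mul0r.
rewrite pairwise_cons => /andP[/allP dx dX] hM.
have -> : count (fun y => has (P^~ y) (x :: X)) s =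
    (count (P x) s + count (fun y => has (P^~ y) X) s)%N.
  rewrite -count_predUI [X in (_ + X)%N](_ : _ = 0%N) ?addn0//.
  apply/eqP; rewrite -leqn0 leqNgt -has_count; apply/hasPn => t ts /=.
  apply/negP => /andP[Pt /hasP[u uX Put]].
  by have /allP /(_ _ ts) := dx _ uX; rewrite Pt Put.
rewrite natrD -natr1 mulrDl mul1r addrC lerD ?hM ?mem_head// IH//.
by move=> u uX; rewrite hM// inE uX orbT.
Qed.

Section Functional.
Variable phi : R * R -> R.
Hypothesis phiB : forall x y, phi (x - y) = phi x - phi y.
Hypothesis phiC : forall l x y, close l x y -> phi x <= phi y + l.

(** Covering against packing. The good points of the upper tail are covered by the [2 * l]-balls
    about a [2 * l]-separated net, each of mass at most [q]. The [l]-balls about the reflected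
    points [z - x], for [x] in the net, are disjoint, lie in the lower tail, and each has mass at
    least [(1 - e) * q]. *)
Lemma reflect_tail l q e L z t : 0 <= l -> 0 <= e -> e <= 1 -> 0 <= q -> conc (2 * l) q L ->
  (count (fun x => (count (close l (z - x)) L)%:R <= (1 - e) * (q * (size L)%:R)) L)%:R
     <= e * (size L)%:R ->
  (count (fun x => phi z - t <= phi x) L)%:R <=
    (count (fun y => phi y <= t + l) L)%:R + 2 * e * (size L)%:R.
Proof.
move=> l0 e0 e1 q0 cL hbad; set N := (size L)%:R : R in hbad *.
set bad := (fun x => _ <= _ ) in hbad.
pose A := [seq x <- L | ~~ bad x & phi z - t <= phi x].
have [X [sXA pX hX]] := exists_separated_net (2 * l) A.
have l20 : 0 <= 2 * l by rewrite mulr_ge0.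
have hA : (size A)%:R <= (size X)%:R * (q * N).
  apply: (@le_trans _ _ ((count (fun y => has (fun x => close (2 * l) x y) X) L)%:R)).
    rewrite ler_nat size_filter.
    have -> : count (fun y => has (fun x => close (2 * l) x y) X) L =
       count (fun y => has (close (2 * l) y) X) L.
      by apply: eq_count => y; apply: eq_has => x; rewrite close_sym.
    apply: (@leq_trans (count (fun y => y \in A) L)).
      by apply: sub_in_count => x xL /= hx; rewrite mem_filter /= hx.
    by apply: sub_count => y yA; exact: hX.
  exact: count_has_le.
have hD : (size X)%:R * ((1 - e) * (q * N)) <= (count (fun y => phi y <= t + l) L)%:R.
  apply: (@count_disjoint_ge _ _ (fun x => close l (z - x))).
  - apply: sub_pairwise pX => x y nxy; apply/allP => u _; apply/negP => /andP[h1 h2].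
    move/negP: nxy; apply.
    rewrite close_sym in h1; have := close_trans h2 h1.
    by rewrite close_addl closeN close_sym [2 * l]mulr_natl mulr2n.
  - move=> x /sXA; rewrite mem_filter => /andP[/andP[/negP nb _] _].
    by apply: ltW; rewrite ltNge; apply/negP.
  - move=> x /sXA; rewrite mem_filter => /andP[/andP[_ ht] _] y hy.
    rewrite close_sym in hy; have := phiC hy; rewrite phiB; lra.
have hAe : (count (fun x => (phi z - t <= phi x)) L)%:R <= (size A)%:R + e * N.
  apply: (@le_trans _ _ ((size A + count bad L)%N%:R)).
    rewrite ler_nat size_filter -count_predUI.
    apply: leq_trans (leq_addr _ _); apply: sub_count => x /= ->.
    by rewrite andbT orNb.
  by rewrite natrD lerD.
have AN : (size A)%:R <= N by rewrite ler_nat size_filter count_size.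
have h : (1 - e) * (size A)%:R <= (1 - e) * ((size X)%:R * (q * N)).
  by rewrite ler_wpM2l// subr_ge0.
have h' : e * (size A)%:R <= e * N by rewrite ler_wpM2l.
lra.
Qed.

End Functional.

Lemma exists_lower_quantile (phi : R * R -> R) L (k : nat) : (1 < k)%N -> (0 < size L)%N ->
  exists x, [/\ x \in L, ((size L)%:R <= k%:R * (count (fun y => phi y <= phi x) L)%:R :> R) &
   ((k%:R - 1) * (size L)%:R <= k%:R * (count (fun y => phi x <= phi y) L)%:R :> R)].
Proof.
move=> k1 L0; pose r := fun x y => phi x <= phi y.
have rtot : total r by move=> x y; exact: le_total.
have rtr : transitive r by move=> y x z; exact: le_trans.
pose s := sort r L; pose i := (size L %/ k)%N.
have ss : size s = size L by rewrite size_sort.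
have iL : (i < size L)%N by rewrite ltn_Pdiv.
have cs P : count P L = count P s.
  by apply/permP; rewrite perm_sym; apply/permPl/perm_sort.
have ps : sorted r s by exact: sort_sorted.
have cnt : forall (P : pred (R*R)) (u : seq (R*R)), all P u -> count P u = size u.
  by move=> P u; rewrite all_count => /eqP.
pose x0 : R * R := 0.
exists (nth x0 s i); split.
- by rewrite -(mem_sort r) mem_nth// ss.
- have h : (i.+1 <= count (fun y => r y (nth x0 s i)) s)%N.
    rewrite -{2}(cat_take_drop i.+1 s) count_cat cnt ?size_takel ?ss ?leq_addr//.
    apply/(all_nthP x0) => j; rewrite size_takel ?ss// => ji.
    rewrite nth_take//; apply: (sorted_leq_nth rtr (fun x => lexx _) x0 ps) => //;
      rewrite ?inE ss//; exact: leq_trans ji _.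
  rewrite cs -natrM ler_nat (leq_trans _ (leq_mul (leqnn k) h))//.
  by rewrite mulnC ltnW// ltn_ceil// ltnW.
- have h : (size L - i <= count (fun y => r (nth x0 s i) y) s)%N.
    rewrite -{2}(cat_take_drop i s) count_cat addnC cnt ?size_drop ?ss ?leq_addr//.
    apply/(all_nthP x0) => j; rewrite size_drop ss => ji.
    rewrite nth_drop; apply: (sorted_leq_nth rtr (fun x => lexx _) x0 ps) => //;
      rewrite ?inE ?ss ?leq_addr//; lia.
  rewrite cs; have := leq_divM (size L) k; rewrite -/i => hi.
  move: h; rewrite -(ler_nat R) natrB 1?ltnW// => h.
  move: hi; rewrite -(ler_nat R) natrM => hi.
  have k0 : 0 < k%:R :> R by rewrite ltr0n ltnW.
  rewrite -(ler_pM2l k0) in h; nra.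
Qed.

Lemma count_lt_exists (T : eqType) (P Q : pred T) (s : seq T) :
  (count Q s < count P s)%N -> exists2 x, x \in s & P x && ~~ Q x.
Proof.
move=> h; case: (boolP (has (fun x => P x && ~~ Q x) s)) => [/hasP//|/hasPn n].
exfalso; move: h; rewrite ltnNge => /negP; apply; apply: sub_in_count => x xs Px.
by have := n _ xs; rewrite Px /= negbK.
Qed.

Lemma sumr_if_le (T : Type) (s : seq T) (P : pred T) (g : T -> R) (M m : R) :
  (forall x, P x -> g x <= M) -> (forall x, ~~ P x -> g x <= m) ->
  \sum_(x <- s) g x <= (count P s)%:R * M + ((size s)%:R - (count P s)%:R) * m.
Proof.
move=> hM hm; elim: s => [|x s IH]; first by rewrite big_nil !mul0r subr0 mul0r addr0.
rewrite big_cons /= natrD -natr1.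
by case: (boolP (P x)) => [/hM|/hm] h /=; lra.
Qed.

Lemma conc_ge0 l q L : (0 < size L)%N -> conc l q L -> 0 <= q.
Proof.
move=> L0 /(_ 0) h; have N0 : 0 < (size L)%:R :> R by rewrite ltr0n.
by rewrite -(pmulr_lge0 _ N0) (le_trans _ h).
Qed.

Lemma concW l k q q' L : l <= k -> q <= q' -> conc k q L -> conc l q' L.
Proof.
move=> lk qq h z; apply: (@le_trans _ _ (q * (size L)%:R)).
  apply: le_trans (h z); rewrite ler_nat; apply: sub_count => x; exact: closeW.
by rewrite ler_wpM2r.
Qed.

Lemma conc_conv_r l q L K : conc l q K -> conc l q (conv L K).
Proof.
move=> h z; rewrite count_conv size_conv natrM mulrCA.
have -> : (size L)%:R * (q * (size K)%:R) = \sum_(x <- L) q * (size K)%:R.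
  elim: L => [|x L IH]; rewrite ?big_nil ?mul0r// big_cons /= -natr1 mulrDl mul1r -IH.
  by rewrite addrC.
apply: ler_sum => x _; apply: le_trans (h (z - x)).
by rewrite ler_nat; apply: sub_count => y; rewrite close_subl.
Qed.

(** Here [zeta w] stands for [phi (z0 - w)]. Tail comparison through two centres composes two
    reflections into a translation by [d = phi w2 - phi w1], up to [2 * l]. With [w1] below the 5
    percent quantile and [w2] above the 95 percent quantile, translating twice overshoots unless
    these quantiles are within [4 * l]. *)
Lemma narrow (phi : R * R -> R) l L (zeta : R * R -> R) (bad : pred (R * R)) :
  (0 < size L)%N ->
  let N := (size L)%:R in
  (count bad L)%:R <= 1 / 100 * N ->
  (forall v w, zeta v - zeta w = phi w - phi v) ->
  (forall w t, ~~ bad w -> (count (fun x => zeta w - t <= phi x) L)%:R <=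
    (count (fun y => phi y <= t + l) L)%:R + 2 * (1 / 100) * N) ->
  (forall w t, ~~ bad w -> (count (fun x => phi x <= zeta w - t) L)%:R <=
    (count (fun y => t - l <= phi y) L)%:R + 2 * (1 / 100) * N) ->
  exists c, 9 / 10 * N <= (count (fun y => `|phi y - c| <= 2 * l) L)%:R :> R.
Proof.
move=> L0 N hbad hz h1 h2.
have N0 : 0 < N by rewrite ltr0n.
have [lo [_ lo1 lo2]] := exists_lower_quantile phi (isT : (1 < 20)%N) L0.
have [hi [_ hi1 hi2]] := exists_lower_quantile (fun x => - phi x) (isT : (1 < 20)%N) L0.
rewrite -!/N in lo1 lo2 hi1 hi2.
have good (P : pred (R * R)) : N <= 20%:R * (count P L)%:R ->
    exists2 w, P w & ~~ bad w.
  move=> hP; have : (count bad L < count P L)%N by rewrite -(ltr_nat R); lra.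
  by case/count_lt_exists => x _ /andP[]; exists x.
have [w1 w1lo b1] := good _ lo1.
have [w2 w2hi b2] := good _ hi1.
have {}w2hi : phi hi <= phi w2 by rewrite -lerN2.
pose d := phi w2 - phi w1.
have hd : zeta w1 - zeta w2 = d by rewrite hz.
have shift t : (count (fun x => t <= phi x) L)%:R <=
    (count (fun x => t + (d - 2 * l) <= phi x) L)%:R + 4 * (1 / 100) * N.
  have e1 := h1 w2 (zeta w2 - t) b2.
  have e2 := h2 w1 (t + d - l) b1.
  rewrite (_ : zeta w2 - (zeta w2 - t) = t) in e1; last by ring.
  rewrite (_ : zeta w1 - (t + d - l) = zeta w2 - t + l) in e2; last by rewrite -hd; ring.
  rewrite (_ : t + d - l - l = t + (d - 2 * l)) in e2; last by ring.
  lra.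
have s1 := shift (phi lo); have s2 := shift (phi lo + (d - 2 * l)).
(* Otherwise at least 95 - 2 * 4 = 87 percent of the mass lies above [u] and 95 percent below
   [phi hi < u], which are disjoint sets. *)
have width : phi lo + (d - 2 * l) + (d - 2 * l) <= phi hi.
  rewrite leNgt; apply/negP => hlt.
  set u := phi lo + _ + _ in s2 hlt.
  have hc : (count (fun x => (u <= phi x)%R) L + count (fun y => (- phi hi <= - phi y)%R) L <= size L)%N.
    rewrite -count_predUI [X in (_ + X)%N](_ : _ = 0%N) ?addn0 ?count_size//.
    apply/eqP; rewrite -leqn0 leqNgt -has_count; apply/hasPn => x _ /=.
    by apply/negP => /andP[a b]; move: b; rewrite lerN2 => b; lra.
  move: hc; rewrite -(ler_nat R) natrD -/N => hc; lra.
have ww : phi hi - phi lo <= 4 * l by rewrite /d in width; lra.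
exists ((phi lo + phi hi) / 2).
have hc : (count (fun y => (phi lo <= phi y)%R) L + count (fun y => (- phi hi <= - phi y)%R) L <=
   size L + count (fun y => (`|phi y - (phi lo + phi hi) / 2| <= 2 * l)%R) L)%N.
  rewrite -count_predUI; apply: leq_add; first exact: count_size.
  apply: sub_count => x /= /andP[a]; rewrite lerN2 => b.
  by rewrite ler_norml; apply/andP; split; lra.
by move: hc; rewrite -(ler_nat R) !natrD -/N => hc; lra.
Qed.

(* If the bound were attained up to a factor [1 - 1e-6], the law would be
   nearly invariant under a reflection through many centres, hence under
   translations comparable with its own width; this is impossible unless
   most of the mass sits in a ball of radius [2 l]. *)
Lemma conc_triple l q L : (0 < size L)%N -> 0 <= l -> q <= 3 / 4 ->
  conc (2 * l) q L -> conc l ((1 - 10 ^- 6) * q) (triple L).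
Proof.
move=> L0 l0 q34 cL z0; rewrite leNgt; apply/negP.
have q0 := conc_ge0 L0 cL.
have N0 : 0 < (size L)%:R :> R by rewrite ltr0n.
rewrite count_conv !size_conv !natrM; set N := (size L)%:R in N0 *.
(* The loss [10 ^- 6] is [e ^+ 3]. Markov with threshold [e ^+ 2] leaves a fraction at most [e] of
   bad [w]; for every other [w], Markov with threshold [e] leaves a fraction at most [e] of bad
   [x]. *)
set e : R := 1 / 100.
have cl : conc l q L by apply: concW cL => //; lra.
have [q00|qn0] := eqVneq q 0.
  have := conc_conv_r L (conc_conv_r L cl) z0.
  by rewrite count_conv q00 mulr0 !mul0r => h1; rewrite ltNge h1.
have qp : 0 < q by rewrite lt_def qn0.
pose g w := (count (fun y => close l z0 (w + y)) (conv L L))%:R : R.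
pose bad w := g w <= (1 - e ^+ 2) * (q * (N * N)).
move=> hlt.
have hbad : (count bad L)%:R <= e * N.
  have h : e ^+ 2 * (count bad L)%:R < 10 ^- 6 * N.
    apply: (count_lower_markov (M := q * (N * N)) (g := g)).
    - by rewrite !mulr_gt0.
    - move=> w; have := conc_conv_r L cl (z0 - w).
      rewrite size_conv natrM -/N; apply: le_trans.
      by rewrite ler_nat; apply: sub_count => y; rewrite close_subl.
    - by apply: le_lt_trans hlt; rewrite le_eqVlt; apply/orP; left; apply/eqP; ring.
  by rewrite /e in h *; lra.
have inner w : ~~ bad w -> (count (fun x => (count (close l (z0 - w - x)) L)%:R <=
    (1 - e) * (q * N)) L)%:R <= e * N.
  rewrite -ltNge /g count_conv => hw.
  have h : e * (count (fun x => (count (close l (z0 - w - x)) L)%:R <=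
      (1 - e) * (q * N)) L)%:R < e ^+ 2 * N.
    apply: (count_lower_markov (M := q * N)
      (g := fun x => (count (close l (z0 - w - x)) L)%:R)).
    - exact: mulr_gt0.
    - by move=> x; exact: cl.
    - rewrite -mulrA -[q * N * _]mulrA.
      apply: lt_le_trans hw _; apply: ler_sum => x _; rewrite ler_nat.
      by apply: sub_count => y; rewrite !close_subl.
  by rewrite /e in h *; lra.
have e0 : 0 <= e by rewrite /e; lra.
have e1 : e <= 1 by rewrite /e; lra.
have coord (p : R * R -> R) : (forall x y, p (x - y) = p x - p y) ->
    (forall k x y, close k x y -> `|p x - p y| <= k) ->
    exists c, 9 / 10 * N <= (count (fun y => `|p y - c| <= 2 * l) L)%:R :> R.
  move=> pB pC; apply: (@narrow p l L (fun w => p (z0 - w)) bad) => //.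
  - by move=> v w /=; rewrite !pB; ring.
  - move=> w t /inner h.
    by apply: (@reflect_tail p _ _ l q e L (z0 - w) t) => // k x y
      /pC; rewrite ler_norml => ?; lra.
  - move=> w t /inner h.
    have := @reflect_tail (fun x => - p x) _ _ l q e L (z0 - w) (- t) l0 e0 e1 (ltW qp) cL h.
    rewrite -/N => h2; apply: le_trans (le_trans (h2 _ _) _).
    + by rewrite ler_nat; apply: sub_count => x /=; lra.
    + by move=> x y; rewrite pB; lra.
    + by move=> k x y /pC; rewrite ler_norml => ?; lra.
    + rewrite lerD2r ler_nat; apply: sub_count => x /=; lra.
have [] := coord (fun x => x.1) => [//|k x y /andP[]//|c1 hc1].
have [] := coord (fun x => x.2) => [//|k x y /andP[]//|c2 hc2].
(* Each coordinate is within [2 * l] of its centre on 9/10 of the mass, so one square of radius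
   [2 * l] carries at least 8/10, more than the allowed 3/4. *)
have := cL (c1, c2).
have : (count (fun y => (`|y.1 - c1| <= 2 * l)%R) L +
    count (fun y => (`|y.2 - c2| <= 2 * l)%R) L <=
    size L + count (close (2 * l) (c1, c2)) L)%N.
  rewrite -count_predUI; apply: leq_add; first exact: count_size.
  by apply: sub_count => x /= /andP[a b]; rewrite /close /= distrC a distrC.
rewrite -(ler_nat R) !natrD -/N => h1 h2.
have : q * N <= 3 / 4 * N by rewrite ler_wpM2r// ltW.
lra.
Qed.

(** Covers the range that [conc_triple] excludes, by enlarging the missing mass [p]. If no ball
    about a [z - x] carries half of the mass, all terms are at most 1/2. If the ball about [z - x0]
    does, any [x] farther than [2 * l] from [x0] sees a ball disjoint from it, and the worst case is
    [(1 - p) ^ 2 + p / 2 <= 1 - 5 / 4 * p]. *)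
Lemma conc_conv_spread l p L : (0 < size L)%N -> 0 <= l -> 0 <= p <= 1 / 4 ->
  conc (2 * l) (1 - p) L -> conc l (1 - 5 / 4 * p) (conv L L).
Proof.
move=> L0 l0 /andP[p0 p4] cL z; rewrite count_conv size_conv natrM.
have N0 : 0 < (size L)%:R :> R by rewrite ltr0n.
set N := (size L)%:R in N0 *.
pose h x := (count (close l (z - x)) L)%:R : R.
have hE x : (count (fun y => close l z (x + y)) L)%:R = h x.
  by congr (_%:R); apply: eq_count => y; rewrite close_subl.
rewrite (eq_bigr _ (fun x _ => hE x)).
have cl : conc l (1 - p) L by apply: concW cL => //; lra.
have NNp : 0 <= N * N by rewrite mulr_ge0// ltW.
have NN : p * N * N <= N * N / 4.
  rewrite -mulrA; have : 0 <= N * N by rewrite mulr_ge0// ltW.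
  by move: (N * N) => M M0; nra.
have [/hasP[x0 x0L hx0]|/hasPn small] := boolP (has (fun x => N / 2 <= h x) L); last first.
  apply: (@le_trans _ _ (\sum_(x <- L) N / 2)).
    by rewrite big_seq [X in _ <= X]big_seq; apply: ler_sum => x /small; rewrite -ltNge => /ltW.
  rewrite big_const_seq count_predT iter_addr addr0 -mulr_natl -/N; lra.
have := @sumr_if_le _ L (fun x => close (2 * l) x0 x) h ((1 - p) * N) (N - h x0).
set al := (count _ _)%:R => hs.
have alN : al <= (1 - p) * N by exact: cL.
have h0N : h x0 <= (1 - p) * N by exact: cl.
apply: le_trans (hs _ _) _.
- by move=> x _; exact: cl.
- move=> x nx; rewrite lerBrDr -natrD ler_nat -count_predUI.
  rewrite [X in (_ + X)%N](_ : _ = 0%N) ?addn0 ?count_size//.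
  apply/eqP; rewrite -leqn0 leqNgt -has_count; apply/hasPn => y _ /=.
  apply/negP => /andP[a b]; move/negP: nx; apply.
  rewrite close_sym in b; have := close_trans a b.
  by rewrite close_addl closeN close_sym mulr_natl mulr2n.
- rewrite -/N; have : (al - (1 - p) * N) * (h x0 - p * N) <= 0.
    by rewrite mulr_le0_ge0//; nra.
  have : 0 <= p * N * (h x0 - N / 2) by rewrite mulr_ge0 ?mulr_ge0 ?subr_ge0// ltW.
  have : p * p * (N * N) <= p * (N * N) / 4.
    have : 0 <= N * N by rewrite mulr_ge0// ltW.
    by move: (N * N) => M M0; have := mulr_ge0 p0 M0; nra.
  lra.
Qed.

End Laws.

(** * Convolution powers and iterated threefold convolution *)

Section Powers.
Variable R : realFieldType.
Implicit Types (L K : seq (R * R)) (l q p : R).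

Definition tower m L : seq (R * R) := iter m (@triple R) L.

Definition pw L r : seq (R * R) := iter r (conv L) [:: 0].

Lemma size_tower_gt0 m L : (0 < size L)%N -> (0 < size (tower m L))%N.
Proof.
by move=> L0; elim: m => //= m IH; rewrite !size_conv !muln_gt0 -/(tower m L) IH.
Qed.

Lemma conc_tower m l q L : (0 < size L)%N -> 0 <= l -> q <= 3 / 4 ->
  conc (2 ^+ m * l) q L -> conc l ((1 - 10 ^- 6) ^+ m * q) (tower m L).
Proof.
move=> L0 l0 q34; elim: m l l0 => [|m IH] l l0 h; first by rewrite expr0 !mul1r in h *.
rewrite exprS -mulrA; apply: conc_triple => //; first exact: size_tower_gt0.
  have q0 := conc_ge0 L0 h.
  by apply: le_trans q34; rewrite ler_piMl// exprn_ile1//; lra.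
apply: IH; first by rewrite mulr_ge0.
by rewrite mulrA -exprSr.
Qed.

(** Each step multiplies the missing mass by 5/4 until it reaches 1/4; the third summand of [triple]
    does no harm. The outcome 3/4 is the threshold from which [conc_tower] takes over. *)
Lemma conc_tower_spread m l p L : (0 < size L)%N -> 0 <= l -> 0 <= p ->
  1 / 4 <= (5 / 4) ^+ m * p ->
  conc (2 ^+ m * l) (1 - p) L -> conc l (3 / 4) (tower m L).
Proof.
move=> L0 l0 p0 hm h.
suff H k l' : 0 <= l' -> conc (2 ^+ k * l') (1 - p) L ->
    conc l' (1 - Num.min (1 / 4) ((5 / 4) ^+ k * p)) (tower k L).
  apply: concW (H m l l0 h) => //.
  by rewrite (min_idPl hm); lra.
elim: k l' => [|k IH] l' l0' h'.
  rewrite expr0 mul1r in h'; rewrite expr0 [1 * p]mul1r; apply: concW h' => //.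
  by rewrite lerD2l lerN2 ge_min lexx orbT.
set P := Num.min (1 / 4) ((5 / 4) ^+ k * p) in IH.
have P0 : 0 <= P.
  rewrite le_min; apply/andP; split; first by lra.
  by rewrite mulr_ge0// exprn_ge0//; lra.
have P4 : P <= 1 / 4 by rewrite ge_min lexx.
apply: (@concW _ _ l' (1 - 5 / 4 * P)) => //.
  rewrite lerD2l lerN2 exprS -mulrA /P.
  by rewrite /Num.min; do 2 case: ifP; lra.
apply: conc_conv_r; apply: conc_conv_spread => //; first exact: size_tower_gt0.
  by rewrite P0.
by apply: IH; rewrite ?mulr_ge0// mulrA -exprSr.
Qed.

Lemma sum_conv L K (g : R * R -> R) :
  \sum_(x <- conv L K) g x = \sum_(x <- L) \sum_(y <- K) g (x + y).
Proof. exact: big_allpairs_dep. Qed.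

Lemma sum_pw_add L r s (g : R * R -> R) :
  \sum_(x <- pw L (r + s)) g x = \sum_(x <- pw L r) \sum_(y <- pw L s) g (x + y).
Proof.
elim: r g => [|r IH] g.
  by rewrite /= big_seq1; apply: eq_bigr => y _; rewrite add0r.
rewrite /= !sum_conv; apply: eq_bigr => x _.
rewrite (IH (fun y => g (x + y))); apply: eq_bigr => y _; apply: eq_bigr => z _.
by rewrite addrA.
Qed.

(** Sums of test functions are all that [conc] sees, and they reduce associativity of convolution to
    nested sums. *)
Lemma sum_tower_pw L k m (g : R * R -> R) :
  \sum_(x <- tower m (pw L k)) g x = \sum_(x <- pw L (k * 3 ^ m)) g x.
Proof.
elim: m g => [|m IH] g; first by rewrite muln1.
rewrite /= !sum_conv expnS mulnCA (_ : 3 = 1 + (1 + 1))%N// !mulnDl !mul1n.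
rewrite sum_pw_add IH; apply: eq_bigr => x _.
rewrite sum_pw_add sum_conv IH; apply: eq_bigr => y _; exact: IH.
Qed.

Lemma size_pw L r : size (pw L r) = (size L ^ r)%N.
Proof. by elim: r => //= r IH; rewrite size_conv IH expnS. Qed.

Lemma eq_sum_conc l q L K :
  (forall g : R * R -> R, \sum_(x <- L) g x = \sum_(x <- K) g x) ->
  conc l q L -> conc l q K.
Proof.
move=> h cL z; move: (cL z); rewrite !sumr_count h.
have -> // : (size L)%:R = (size K)%:R :> R.
by rewrite -!count_predT !sumr_count h.
Qed.

Lemma conc_pw_tower l q L k m :
  conc l q (tower m (pw L k)) -> conc l q (pw L (k * 3 ^ m)).
Proof. by apply: eq_sum_conc => g; exact: sum_tower_pw. Qed.

End Powers.

(** * Sampling with replacement from a set of coordinates *)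

Section Draws.
Variables (R : realFieldType) (T : finType) (v : T -> R * R).
Implicit Types (I J : {set T}).

Definition vals I := [seq v i | i <- enum I].

Lemma size_vals I : size (vals I) = #|I|.
Proof. by rewrite size_map -cardE. Qed.

Lemma sum_tupleS r (P : pred T) (F : seq T -> R) :
  \sum_(t : r.+1.-tuple T | all P t) F t =
  \sum_(i | P i) \sum_(t : r.-tuple T | all P t) F (i :: t).
Proof.
rewrite pair_big /=.
rewrite (reindex (fun p : T * r.-tuple T => [tuple of p.1 :: p.2])) /=.
  by apply: eq_bigl => -[i t].
exists (fun t => (thead t, [tuple of behead t])) => [[i t] _|t _] /=.
  by congr (_, _); apply: val_inj.
by rewrite [t in RHS]tuple_eta.
Qed.

Lemma sum_pw_vals I r (g : R * R -> R) :
  \sum_(x <- pw (vals I) r) g x =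
  \sum_(t : r.-tuple T | all (mem I) t) g (\sum_(i <- t) v i).
Proof.
elim: r g => [|r IH] g.
  rewrite big_seq1 (big_pred1 [tuple]) => [|t]; first by rewrite big_nil.
  by rewrite tuple0 /=; apply/esym/eqP; apply: val_inj.
rewrite (sum_tupleS _ _ (fun t => g (\sum_(i <- t) v i))) /= sum_conv big_map big_enum_cond.
apply: eq_big => [i|i _]; first by rewrite andbT.
by rewrite (IH (fun y => g (v i + y))); apply: eq_bigr => t _; rewrite big_cons.
Qed.

Lemma conc_draws l q I r : conc l q (pw (vals I) r) <->
  forall z, (#|[set t : r.-tuple T | all (mem I) t && close l z (\sum_(i <- t) v i)]|)%:R
    <= q * #|I|%:R ^+ r :> R.
Proof.
suff H z : (count (close l z) (pw (vals I) r))%:R =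
    (#|[set t : r.-tuple T | all (mem I) t && close l z (\sum_(i <- t) v i)]|)%:R :> R.
  by split=> h z; have := h z; rewrite H size_pw size_vals natrX.
rewrite sumr_count sum_pw_vals -sum1_card natr_sum [LHS]big_mkcond [RHS]big_mkcond.
by apply: eq_bigr => t _; rewrite inE; case: (all _ _) => //=; case: (close _ _ _).
Qed.

End Draws.

(** * Concentration bounded by pairwise coincidences *)

Section Collisions.
Variable R : archiRealFieldType.

Lemma sum_keys_le (K : eqType) (s k : seq K) (F : K -> R) : uniq k -> (forall x, 0 <= F x) ->
  \sum_(c <- k) (count_mem c s)%:R * F c <= \sum_(x <- s) F x.
Proof.
move=> uk F0.
have -> : \sum_(c <- k) (count_mem c s)%:R * F c = \sum_(c <- k) \sum_(x <- s | x == c) F x.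
  apply: eq_bigr => c _; rewrite sumr_count mulr_suml [RHS]big_mkcond.
  apply: eq_bigr => x _ /=; case: (x =P c) => [->|_]; by rewrite ?mul1r ?mul0r.
rewrite (exchange_big_dep predT)//=; apply: ler_sum => x _.
rewrite -big_filter; have : uniq [seq c <- k | x == c] by rewrite filter_uniq.
have : all (pred1 x) [seq c <- k | x == c].
  by apply/allP => c; rewrite mem_filter eq_sym => /andP[].
case: [seq _ <- _ | _] => [|c [|c' r]]; rewrite ?big_nil ?big_seq1 //=.
by case/and3P => /eqP -> /eqP -> _; rewrite mem_head.
Qed.

Lemma sum_keys_ge (K : eqType) (s k : seq K) (F : K -> R) : {subset s <= k} ->
  (forall x, 0 <= F x) ->
  \sum_(x <- s) F x <= \sum_(c <- k) (count_mem c s)%:R * F c.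
Proof.
move=> sk F0.
have -> : \sum_(c <- k) (count_mem c s)%:R * F c = \sum_(c <- k) \sum_(x <- s | x == c) F x.
  apply: eq_bigr => c _; rewrite sumr_count mulr_suml [RHS]big_mkcond.
  apply: eq_bigr => x _ /=; case: (x =P c) => [->|_]; by rewrite ?mul1r ?mul0r.
rewrite (exchange_big_dep predT)//= big_seq [X in _ <= X]big_seq; apply: ler_sum => x xs.
have := sk _ xs; elim: k {sk} => //= c k IH; rewrite inE big_cons.
case: (x =P c) => [->|_] /= h; first by rewrite lerDl sumr_ge0.
exact: IH.
Qed.

(** With [n_c] the multiplicity of [c], the left side is the sum of [n_c * n_(f c)]. Bound this
    product by the mean of the two squares; injectivity of [f] makes both halves at most the sum of
    the [n_c ^ 2]. *)
Lemma count_shift_le (K : eqType) (s : seq K) (f : K -> K) : involutive f ->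
  \sum_(x <- s) (count_mem (f x) s)%:R <= \sum_(x <- s) (count_mem x s)%:R :> R.
Proof.
move=> fK; set E := (X in _ <= X); pose k := undup s.
have sk : {subset s <= k} by move=> x; rewrite mem_undup.
apply: (@le_trans _ _ (\sum_(c <- k) (count_mem c s)%:R * (count_mem (f c) s)%:R)).
  exact: sum_keys_ge.
apply: (@le_trans _ _ ((\sum_(c <- k) (count_mem c s)%:R * (count_mem c s)%:R +
    \sum_(c <- map f k) (count_mem c s)%:R * (count_mem c s)%:R) / 2)).
  rewrite big_map -big_split mulr_suml; apply: ler_sum => c _ /=.
  set a := _%:R; set b := _%:R; have := sqr_ge0 (a - b); lra.
have h1 := @sum_keys_le _ s k (fun c => (count_mem c s)%:R) (undup_uniq _).
have h2 := @sum_keys_le _ s (map f k) (fun c => (count_mem c s)%:R).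
have h3 := h1 (fun _ => ler0n _ _).
have h4 : \sum_(c <- map f k) (count_mem c s)%:R * (count_mem c s)%:R <= E.
  by apply: h2 => //; rewrite map_inj_uniq ?undup_uniq//; exact: inv_inj.
by rewrite -/E in h3; lra.
Qed.

Definition cell (l : R) (x : R * R) : int * int :=
  (Num.floor (x.1 / l), Num.floor (x.2 / l)).

Lemma floor_eq_close (l a b : R) : 0 < l ->
  Num.floor (a / l) = Num.floor (b / l) -> `|a - b| <= l.
Proof.
move=> l0 h.
have h1 := floor_le (a / l); have h2 := floorD1_gt (a / l).
have h3 := floor_le (b / l); have h4 := floorD1_gt (b / l).
rewrite -h in h3 h4; rewrite intrD in h2 h4.
have : `|a / l - b / l| <= 1 by rewrite ler_norml; lra.
by rewrite -mulrBl normrM normfV (gtr0_norm l0) ler_pdivrMr// mul1r.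
Qed.

(** The floor of [c / l] exceeds the difference of the other two floors by an integer strictly
    between -3 and 2, hence four offsets starting at -2. *)
Lemma floor_sum_close (l a b c : R) : 0 < l -> `|a - (b + c)| <= l ->
  exists s : 'I_4, Num.floor (c / l) =
    Num.floor (a / l) - 2 + (s : nat)%:Z - Num.floor (b / l).
Proof.
move=> l0 h.
have {}h : `|a / l - (b / l + c / l)| <= 1.
  by rewrite -mulrDl -mulrBl normrM normfV (gtr0_norm l0) ler_pdivrMr// mul1r.
move: (a / l) (b / l) (c / l) h => {}a {}b {}c h.
have h1 := floor_le a; have h2 := floorD1_gt a.
have h3 := floor_le b; have h4 := floorD1_gt b.
have h5 := floor_le c; have h6 := floorD1_gt c.
move: h1 h2 h3 h4 h5 h6; set A := Num.floor a; set B := Num.floor b; set C := Num.floor c.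
rewrite !intrD => h1 h2 h3 h4 h5 h6; rewrite ler_norml in h.
have k1 : (A - B - 3)%:~R < C%:~R :> R by rewrite !intrD !rmorphN /=; lra.
have k2 : C%:~R < (A - B + 2)%:~R :> R by rewrite !intrD !rmorphN /=; lra.
rewrite ltr_int in k1; rewrite ltr_int in k2.
have k3 : (`|(C - (A - B - 2))%R| < 4)%N by lia.
by exists (Ordinal k3) => /=; lia.
Qed.

(* Cauchy-Schwarz over the cells of a grid of mesh [l]: [x + y] is within [l]
   of [z] for at most [16] possible offsets between the cells of [x] and [y]. *)
Lemma count_sum_le_collisions l (L : seq (R * R)) z : 0 < l ->
  (count (close l z) (conv L L))%:R <= 16 * \sum_(x <- L) (count (close l x) L)%:R :> R.
Proof.
move=> l0; rewrite count_conv.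
pose f (s : 'I_4 * 'I_4) (c : int * int) : int * int :=
  ((cell l z).1 - 2 + (s.1 : nat)%:Z - c.1, (cell l z).2 - 2 + (s.2 : nat)%:Z - c.2).
have fK s : involutive (f s).
  by case=> c d; rewrite /f /=; congr (_, _); lia.
pose E : R := \sum_(x <- L) (count (close l x) L)%:R.
have hE s : \sum_(x <- L) (count (fun y => cell l y == f s (cell l x)) L)%:R <= E.
  have := count_shift_le (map (cell l) L) (fK s).
  rewrite !big_map => h; apply: le_trans (le_trans h _).
    by rewrite le_eqVlt; apply/orP; left; apply/eqP; apply: eq_bigr => x _; rewrite count_map.
  apply: ler_sum => x _; rewrite count_map ler_nat; apply: sub_count => y /= /eqP[e1 e2].
  by rewrite /close !floor_eq_close.
apply: (@le_trans _ _ (\sum_(s : 'I_4 * 'I_4) \sum_(x <- L)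
   (count (fun y => cell l y == f s (cell l x)) L)%:R)).
  rewrite exchange_big /=; apply: ler_sum => x _.
  under eq_bigr do rewrite sumr_count.
  rewrite exchange_big /= sumr_count; apply: ler_sum => y _.
  case: (boolP (close l z (x + y))) => [|_]; last by rewrite sumr_ge0.
  case/andP => /(floor_sum_close l0)[s1 h1] /(floor_sum_close l0)[s2 h2].
  rewrite (bigD1 (s1, s2))//= (_ : (_ == _) = true); first by rewrite lerDl sumr_ge0.
  by apply/eqP; rewrite /cell /f h1 h2.
apply: le_trans (ler_sum _ (fun s _ => hE s)) _.
by rewrite sumr_const card_prod !card_ord -[leLHS]mulr_natl lexx.
Qed.

End Collisions.

(** * Sums over random subsets of fixed size *)

Lemma ffact_le_expn n r : (n ^_ r <= n ^ r)%N.
Proof.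
by elim: r => [|r IH]; rewrite ?ffactn0// ffactnSr expnSr leq_mul// leq_subr.
Qed.

(** Birthday bound: [r] draws from [n] elements are distinct with probability at least
    [1 - r ^ 2 / n], here at least 1/2. *)
Lemma expn_le_ffact n r : (2 * r ^ 2 <= n -> n ^ r <= 2 * n ^_ r)%N.
Proof.
move=> hr; case: n hr => [|n] hr.
  by have -> : r = 0%N by nia.
have H k : (k <= r -> n.+1 ^ k * n.+1 <= n.+1 ^_ k * n.+1 + k ^ 2 * n.+1 ^ k)%N.
  elim: k => [_|k IH kr]; first by rewrite !expn0 ffactn0; lia.
  have := IH (ltnW kr); have := ffact_le_expn n.+1 k; rewrite ffactnSr (expnSr n.+1 k).
  have kn : (k <= n.+1)%N by nia.
  move: (n.+1 ^ k)%N (n.+1 ^_ k)%N => A B h1 h2.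
  rewrite [(B * _ * _)%N](_ : _ = (B * n.+1 * n.+1 - B * n.+1 * k)%N); last first.
    by rewrite mulnBr mulnBl; congr (_ - _)%N; rewrite -!mulnA; congr (_ * _)%N; rewrite mulnC.
  have h3 : (B * n.+1 * k <= B * n.+1 * n.+1)%N by rewrite leq_mul2l kn orbT.
  have h4 : (A * n.+1 * n.+1 <= (B * n.+1 + k ^ 2 * A) * n.+1)%N by rewrite leq_mul2r h2 orbT.
  have h5 : (B * n.+1 * k <= A * n.+1 * k)%N by rewrite !leq_mul.
  have e1 : (k.+1 ^ 2 * (A * n.+1) = k ^ 2 * A * n.+1 + 2 * (A * n.+1 * k) + A * n.+1)%N by ring.
  move: h4; rewrite mulnDl e1; lia.
have := H r (leqnn r) => {H}.
have : (2 * (r ^ 2 * n.+1 ^ r) <= n.+1 ^ r * n.+1)%N.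
  by rewrite mulnA mulnC leq_mul2l hr orbT.
move=> h1 h2; rewrite -(@leq_pmul2r n.+1)//; lia.
Qed.

Section SubsetDraws.
Variables (R : realFieldType) (T : finType).
Implicit Types (I J S U : {set T}).

(** The bijection sends [(S, t)] to [(U, t)] with [U] the set [S] without the entries of [t]: a set
    with an ordered sample of it is a remainder with a sample outside the remainder. *)
Lemma sum_subset_split r I (F : {set T} -> r.-tuple T -> R) :
  \sum_(S : {set T}) \sum_(t : r.-tuple T | uniq t && all (mem (S :&: I)) t) F (S :\: [set x in t]) t =
  \sum_(U : {set T}) \sum_(t : r.-tuple T | uniq t && all (mem (I :\: U)) t) F U t.
Proof.
rewrite (exchange_big_dep (fun t : r.-tuple T => uniq t && all (mem I) t))/=; last first.
  move=> S t _ /andP[-> /allP h]; apply/allP => x /h; by rewrite !inE => /andP[].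
rewrite [RHS](exchange_big_dep (fun t : r.-tuple T => uniq t && all (mem I) t))/=; last first.
  move=> S t _ /andP[-> /allP h]; apply/allP => x /h; by rewrite !inE => /andP[].
apply: eq_bigr => t /andP[ut /allP tI'].
have tI x : x \in (t : seq T) -> x \in I by move=> /tI'.
rewrite (reindex_onto (fun U => U :|: [set x in t]) (fun S => S :\: [set x in t])) /=; last first.
  move=> S /andP[_ /allP h]; apply/setP => x; rewrite !inE.
  case: (boolP (x \in (t : seq T))) => [/h|]; first by rewrite !inE => /andP[-> _]; rewrite orbT.
  by rewrite orbF.
apply: eq_big => [U|U].
  rewrite ut /=; apply/idP/idP => [/andP[_ /eqP h]|/allP h].
    by apply/allP => x xt; rewrite !inE tI// andbT -h !inE xt.
  apply/andP; split.
    by apply/allP => x xt; rewrite !inE xt orbT/=; exact: tI.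
  apply/eqP/setP => x; rewrite !inE.
  case: (boolP (x \in (t : seq T))) => [/h|]; last by rewrite orbF.
  by rewrite !inE => /andP[/negbTE ->].
by case/andP => _ /eqP ->.
Qed.

Lemma card_uniq_in (A : {set T}) r :
  \sum_(t : r.-tuple T | uniq t && all (mem A) t) 1 = (#|A| ^_ r)%:R :> R.
Proof.
rewrite -card_uniq_tuples -sum1_card natr_sum; apply: eq_bigl => t.
by rewrite inE andbC.
Qed.

Variable v : T -> R * R.

(** Draw [S], draw an ordered sample [t] of [r] distinct elements of [S :&: I], and condition on the
    remainder [U]. The weight [w] depends only on the size of [U :&: I], so [t] is uniform among the
    distinct tuples in [I :\: U]. This pool lies between [I :\: S] and [I], which is why [P] is
    required on that whole range. The factor 2 passes from distinct tuples to draws with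
    replacement. *)
Lemma card_subset_draws (a r : nat) I (P : pred {set T}) (l q : R) : 0 <= q ->
  (forall J, J \subset I -> P J ->
     (2 * r ^ 2 <= #|J|)%N /\ conc l q (pw (vals v J) r)) ->
  forall z, (#|[set S : {set T} | [&& #|S| == a, (r <= #|S :&: I|)%N,
      [forall (J : {set T} | (I :\: S \subset J) && (J \subset I)), P J] &
      close l z (\sum_(i in S) v i)]]|)%:R <= 2 * q * 'C(#|T|, a)%:R.
Proof.
move=> q0 hP z; set G := [set S | _].
pose w j : R := ((j ^_ r)%:R)^-1.
pose F U (t : r.-tuple T) : R :=
  if [&& (#|U| + r == a)%N, P (I :\: U) & close l (z - \sum_(i in U) v i) (\sum_(i <- t) v i)]
  then w (#|U :&: I| + r)%N else 0.
have w0 j : 0 <= w j by rewrite invr_ge0.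
have cardD S (t : r.-tuple T) : uniq t && all (mem (S :&: I)) t ->
    [/\ (#|S :\: [set x in t]| + r = #|S|)%N,
        (#|(S :\: [set x in t]) :&: I| + r = #|S :&: I|)%N &
        \sum_(i in S) v i = \sum_(i in S :\: [set x in t]) v i + \sum_(i <- t) v i].
  case/andP => ut /allP tSI.
  have ct : #|[set x in t]| = r by rewrite cardsE (card_uniqP ut) size_tuple.
  have tS : [set x in t] \subset S.
    by apply/subsetP => x; rewrite inE => /tSI; rewrite !inE => /andP[].
  have tI : [set x in t] \subset S :&: I.
    by apply/subsetP => x; rewrite inE => /tSI.
  split.
  - by rewrite cardsD (setIidPr tS) ct subnK// -ct subset_leq_card.
  - by rewrite setIDAC cardsD (setIidPr tI) ct subnK// -ct subset_leq_card.
  - rewrite (big_setID [set x in t]) /= addrC (setIidPr tS); congr (_ + _).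
    rewrite (big_uniq _ ut); apply: eq_bigl => x; by rewrite inE.
apply: (@le_trans _ _ (\sum_(S : {set T}) \sum_(t : r.-tuple T | uniq t && all (mem (S :&: I)) t)
    F (S :\: [set x in t]) t)).
  rewrite -sum1_card natr_sum big_mkcond; apply: ler_sum => S _.
  case: ifP => [|_]; last first.
    by rewrite sumr_ge0// => t _; rewrite /F; case: ifP.
  rewrite inE => /and4P[/eqP Sa rS /forallP hJ hc].
  apply: (@le_trans _ _ (\sum_(t : r.-tuple T | uniq t && all (mem (S :&: I)) t) w #|S :&: I|)).
    rewrite -[X in \sum_(_ | _) X]mulr1 -mulr_sumr card_uniq_in /w mulVf//.
    by rewrite pnatr_eq0 -lt0n ffact_gt0.
  apply: ler_sum => t ht; have [h1 h2 h3] := cardD _ _ ht.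
  rewrite /F h1 Sa eqxx h2 /= close_subl -h3 hc andbT ifT//.
  apply: (implyP (hJ _)); rewrite subsetDl andbT.
  by rewrite setDS// subsetDl.
rewrite sum_subset_split.
pose F' U (t : r.-tuple T) : R := if (#|U| + r == a)%N then w (#|U :&: I| + r)%N else 0.
apply: (@le_trans _ _ (2 * q * \sum_(U : {set T})
   \sum_(t : r.-tuple T | uniq t && all (mem (I :\: U)) t) F' U t)).
  rewrite mulr_sumr; apply: ler_sum => U _; rewrite /F /F'.
  case: (boolP (P (I :\: U))) => [PU|_]; last first.
    rewrite big1 => [|t _]; last by rewrite andbF.
    by rewrite !mulr_ge0// sumr_ge0// => t _; case: ifP.
  case: eqP => _ /=; last by rewrite !big1 ?mulr0.
  have [rJ cJ] := hP _ (subsetDl _ _) PU.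
  pose Fw (t : r.-tuple T) : R := w (#|U :&: I| + r)%N *
    (if close l (z - \sum_(i in U) v i) (\sum_(i <- t) v i) then 1 else 0).
  rewrite (eq_bigr Fw) => [|t _]; last by rewrite /Fw; case: ifP; rewrite (mulr0, mulr1).
  rewrite [X in _ <= _ * X](eq_bigr (fun=> w (#|U :&: I| + r)%N * 1)) => [|t _]; last by rewrite mulr1.
  rewrite -!mulr_sumr mulrCA ler_wpM2l// card_uniq_in.
  apply: (@le_trans _ _ (q * #|I :\: U|%:R ^+ r)).
    have /conc_draws /(_ (z - \sum_(i in U) v i)) := cJ; apply: le_trans.
    rewrite -sum1_card natr_sum [leRHS]big_mkcond [leLHS]big_mkcond; apply: ler_sum => t _.
    rewrite inE; case: (uniq t); case: (all _ _) => //=; case: (close _ _ _) => //=.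
  rewrite -mulrA mulrCA ler_wpM2l// -natrX -natrM ler_nat.
  exact: expn_le_ffact.
rewrite ler_wpM2l ?mulr_ge0// -sum_subset_split.
rewrite -card_draws -sum1_card natr_sum [leRHS]big_mkcond; apply: ler_sum => S _.
rewrite inE; case: ifP => [/eqP Sa|/eqP Sa]; last first.
  rewrite big1// => t ht; have [h1 h2 h3] := cardD _ _ ht.
  by rewrite /F' h1; case: eqP.
rewrite (eq_bigr (fun=> w #|S :&: I| * 1)) => [|t ht]; last first.
  by have [h1 h2 h3] := cardD _ _ ht; rewrite /F' h1 Sa eqxx h2 mulr1.
rewrite -mulr_sumr card_uniq_in /w.
by case: (#|_| ^_ r)%N => [|k]; rewrite ?mulr0// mulVf ?pnatr_eq0.
Qed.

End SubsetDraws.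

(** * Lower tail of the hypergeometric distribution *)

Section HypergeometricTail.
Local Open Scope nat_scope.
Variables (T : finType) (W : {set T}).
Implicit Types (S : {set T}).

Definition hyper a j := #|[set S : {set T} | (#|S| == a) && (#|S :&: W| == j)]|.

Lemma hyperE a j : j <= a -> hyper a j = 'C(#|W|, j) * 'C(#|T| - #|W|, a - j).
Proof.
move=> ja; have -> : #|T| - #|W| = #|~: W| by rewrite [RHS]cardsCs setCK.
rewrite -!cards_draws -cardsX /hyper.
rewrite -(card_in_imset (f := fun p : {set T} * {set T} => p.1 :|: p.2)).
  congr #|pred_of_set _|; apply/setP => S; rewrite inE; apply/idP/imsetP => [/andP[/eqP Sa /eqP Sj]|].
    exists (S :&: W, S :&: ~: W); last by rewrite /= -setIUr setUCr setIT.
    rewrite !inE /= !subsetIr Sj eqxx /= -setDE -Sa -Sj -(cardsID W S) addnC.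
    by rewrite addnK.
  case=> -[A B]; rewrite !inE /= => /andP[/andP[AW /eqP Aj] /andP[BW /eqP Ba]] ->.
  have BW0 : B :&: W = set0.
    by apply/setP => x; rewrite !inE andbC; apply/negP => /andP[xW /(subsetP BW)]; rewrite inE xW.
  have AB : A :&: B = set0.
    apply/setP => x; rewrite !inE; apply/negP => /andP[/(subsetP AW) xW xB].
    by have := subsetP BW _ xB; rewrite inE xW.
  by rewrite cardsU AB cards0 subn0 Ba Aj setIUl BW0 setU0 (setIidPl AW) Aj subnKC// !eqxx.
move=> -[A B] [C D]; rewrite !inE /= => /andP[/andP[AW _] /andP[BW _]] /andP[/andP[CW _] /andP[DW _]] e.
have sub0 (E : {set T}) : E \subset ~: W -> E :&: W = set0.
  by move=> h; apply/setP => x; rewrite !inE andbC; apply/negP => /andP[xW /(subsetP h)]; rewrite inE xW.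
have sub1 (E : {set T}) : E \subset W -> E :&: ~: W = set0.
  by move=> h; apply/setP => x; rewrite !inE; apply/negP => /andP[/(subsetP h) ->].
congr (_, _).
  have : (A :|: B) :&: W = (C :|: D) :&: W by rewrite e.
  by rewrite !setIUl (sub0 B)// (sub0 D)// !setU0 (setIidPl AW) (setIidPl CW).
have : (A :|: B) :&: ~: W = (C :|: D) :&: ~: W by rewrite e.
by rewrite !setIUl (sub1 A)// (sub1 C)// !set0U (setIidPl BW) (setIidPl DW).
Qed.

(** The ratio of consecutive terms is [(#|W| - j) * (a - j)] over
    [(j + 1) * (#|T| - #|W| - a + j + 1)]; the product hypothesis keeps it at least 2 below
    [2 * b]. *)
Lemma hyper_double a b j : 2 * b <= #|W| -> 2 * b <= a -> 0 < b ->
  2 * (2 * b) * #|T| <= (#|W| - 2 * b) * (a - 2 * b) -> 0 < #|T| ->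
  j < 2 * b -> 2 * hyper a j <= hyper a j.+1.
Proof.
move=> bW ba b0 h T0 jb.
rewrite !hyperE//; [|lia|lia].
have e1 := mul_bin_left #|W| j.
have e2 := mul_bin_left (#|T| - #|W|) (a - j.+1).
have -> : a - j = (a - j.+1).+1 by lia.
set A := 'C(#|W|, j) in e1 *; set A' := 'C(#|W|, j.+1) in e1 *.
set B := 'C(_, _.+1) in e2 *; set B' := 'C(_, a - j.+1) in e2 *.
clearbody A A' B B'.
have h1 : (#|W| - 2 * b) * (a - 2 * b) <= (#|W| - j) * (a - j.+1).+1 by apply: leq_mul; lia.
have h2 : A * B * ((#|W| - j) * (a - j.+1).+1) <= A' * B' * (2 * b * #|T|).
  rewrite (_ : A * B * _ = (j.+1 * A') * ((#|T| - #|W| - (a - j.+1)) * B')); last first.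
    by rewrite e1 -e2 [RHS]mulnACA mulnC.
  rewrite mulnACA mulnC.
  by rewrite leq_mul2l leq_mul ?orbT//; lia.
have h3 : A * B * (2 * (2 * b) * #|T|) <= A' * B' * (2 * b * #|T|).
  by apply: leq_trans h2; rewrite leq_mul2l (leq_trans h h1) orbT.
rewrite -(@leq_pmul2r (2 * b * #|T|)) ?muln_gt0 ?b0 ?T0//.
by apply: leq_trans h3; rewrite leq_eqVlt; apply/orP; left; apply/eqP; move: #|T| => *; ring.
Qed.

(** The terms at least double below [2 * b], so shifting the index by [b] maps the tail into the
    terms between [b] and [2 * b], each at least [2 ^ b] times larger. *)
Lemma hyper_tail a b : 2 * b <= #|W| -> 2 * b <= a ->
  2 * (2 * b) * #|T| <= (#|W| - 2 * b) * (a - 2 * b) ->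
  2 ^ b * #|[set S : {set T} | (#|S| == a) && (#|S :&: W| < b)]| <= 'C(#|T|, a).
Proof.
move=> bW ba h; have [->|b0] := posnP b.
  rewrite mul1n -card_draws; apply: subset_leq_card; apply/subsetP => S.
  by rewrite !inE andbF.
have T0 : 0 < #|T|.
  have : #|W| <= #|T| by exact: max_card.
  lia.
have D := hyper_double bW ba b0 h T0.
have Dk j k : j + k <= 2 * b -> 2 ^ k * hyper a j <= hyper a (j + k).
  elim: k => [_|k IH hk]; first by rewrite mul1n addn0.
  rewrite expnS -mulnA addnS; apply: leq_trans (D _ _); last by lia.
  by rewrite leq_mul2l IH; lia.
have sumE (c d : nat) : \sum_(c <= j < d) hyper a j =
    #|[set S : {set T} | (#|S| == a) && (c <= #|S :&: W| < d)]|.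
  rewrite -sum1_card [RHS]big_mkcond /= (eq_bigr (fun j => \sum_(S : {set T}) (((#|S| == a) && (#|S :&: W| == j)) : nat))); last first.
    by move=> j _; rewrite /hyper -sum1_card big_mkcond; apply: eq_bigr => S _; rewrite inE; case: ifP.
  rewrite exchange_big /=; apply: eq_bigr => S _; rewrite inE; case: (#|S| == a) => /=; last by rewrite big1.
  rewrite (eq_bigr (fun j => if j == #|S :&: W| then 1 else 0)) => [|j _]; last by rewrite eq_sym; case: eqP.
  by rewrite -big_mkcond big_nat1_eq.
have := sumE 0 b => /= <-.
rewrite big_distrr /=.
apply: (@leq_trans (\sum_(0 <= j < b) hyper a (j + b))).
  rewrite big_nat [leqRHS]big_nat; apply: leq_sum => j /andP[_ jb]; apply: Dk; lia.
rewrite -[X in \sum_(0 <= _ < X) _](addnK b b) -(big_addn 0 (b + b) b xpredT) sumE -card_draws.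
by apply: subset_leq_card; apply/subsetP => S; rewrite !inE => /andP[].
Qed.

End HypergeometricTail.

(** The hypotheses of [hyper_tail]: [b] is at most about a quarter of the mean intersection
    [w * a / n]. *)
Definition tail_ok (n w a b : nat) :=
  [&& 2 * b <= w, 2 * b <= a & 2 * (2 * b) * n <= (w - 2 * b) * (a - 2 * b)]%N.

Lemma tail_okS n w a b : tail_ok n w a b -> tail_ok n w a.+1 b.
Proof.
move=> /and3P[h1 h2 h3]; rewrite /tail_ok h1 /= (leqW h2) (leq_trans h3)//.
by rewrite leq_mul2l; apply/orP; right; lia.
Qed.

(** * Subset sums over two consecutive levels *)

Section Slices.
Variables (R : archiRealFieldType) (T : finType).
Implicit Types (S I J W : {set T}).

Definition slice a : {set {set T}} := [set S : {set T} | (#|S| == a) || (#|S| == a.+1)].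

Definition slice_conc (v : T -> R * R) (a : nat) (l q : R) := forall z,
  (#|[set S in slice a | close l z (\sum_(i in S) v i)]|)%:R <= q * #|slice a|%:R.

Lemma sliceE a : slice a = [set S : {set T} | #|S| == a] :|: [set S : {set T} | #|S| == a.+1].
Proof. by apply/setP => S; rewrite !inE. Qed.

Lemma card_slice a : #|slice a| = ('C(#|T|, a) + 'C(#|T|, a.+1))%N.
Proof.
rewrite sliceE cardsU -!card_draws [X in (_ - X)%N](_ : _ = 0%N) ?subn0//.
by apply/eqP; rewrite cards_eq0; apply/eqP/setP => S; rewrite !inE; apply/negP => /andP[/eqP ->]; rewrite ltn_eqF.
Qed.

Lemma le_card_slice (E : pred {set T}) a (c : R) :
  (#|[set S : {set T} | (#|S| == a) && E S]|)%:R <= c * 'C(#|T|, a)%:R ->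
  (#|[set S : {set T} | (#|S| == a.+1) && E S]|)%:R <= c * 'C(#|T|, a.+1)%:R ->
  (#|[set S in slice a | E S]|)%:R <= c * #|slice a|%:R.
Proof.
move=> h1 h2; rewrite card_slice natrD mulrDr; apply: le_trans (lerD h1 h2).
rewrite -natrD ler_nat; apply: leq_trans (leq_card_setU _ _).
by apply: subset_leq_card; apply/subsetP => S; rewrite !inE => /andP[/orP[]-> ->]; rewrite ?orbT.
Qed.

Lemma hyper_tail_prob W a b : tail_ok #|T| #|W| a b ->
  (#|[set S : {set T} | (#|S| == a) && (#|S :&: W| < b)%N]|)%:R <= (2 ^+ b)^-1 * 'C(#|T|, a)%:R :> R.
Proof.
move=> /and3P[h1 h2 h3]; rewrite mulrC ler_pdivlMr ?exprn_gt0//.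
by rewrite mulrC -natrX -natrM ler_nat; exact: hyper_tail.
Qed.

Lemma hyper_tailC_prob W a b : (a <= #|T|)%N -> tail_ok #|T| #|W| (#|T| - a) b ->
  (#|[set S : {set T} | (#|S| == a) && (#|W :\: S| < b)%N]|)%:R <= (2 ^+ b)^-1 * 'C(#|T|, a)%:R :> R.
Proof.
move=> aT /hyper_tail_prob; rewrite bin_sub//; apply: le_trans; rewrite ler_nat.
rewrite -(card_imset _ (inv_inj (@setCK T))); apply: subset_leq_card.
apply/subsetP => S /imsetP[S']; rewrite !inE => /andP[/eqP <- h] ->.
by rewrite cardsCs setCK eqxx /= setIC -setDE.
Qed.

Lemma level_conc (v : T -> R * R) (a r : nat) I (P : pred {set T}) (l q e : R) : 0 <= q ->
  (forall J, J \subset I -> P J -> (2 * r ^ 2 <= #|J|)%N /\ conc l q (pw (vals v J) r)) ->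
  (#|[set S : {set T} | (#|S| == a) &&
     ((#|S :&: I| < r)%N || [exists (J : {set T} | (I :\: S \subset J) && (J \subset I)), ~~ P J])]|)%:R
    <= e * 'C(#|T|, a)%:R ->
  forall z, (#|[set S : {set T} | (#|S| == a) && close l z (\sum_(i in S) v i)]|)%:R
    <= (2 * q + e) * 'C(#|T|, a)%:R.
Proof.
move=> q0 hP he z; rewrite mulrDl.
apply: le_trans (lerD (card_subset_draws (P := P) (r := r) a q0 hP z) he).
rewrite -natrD ler_nat; apply: leq_trans (leq_card_setU _ _).
apply: subset_leq_card; apply/subsetP => S; rewrite !inE => /andP[-> ->] /=; rewrite andbT.
have -> : [forall (J : {set T} | (I :\: S \subset J) && (J \subset I)), P J] =
    ~~ [exists (J : {set T} | (I :\: S \subset J) && (J \subset I)), ~~ P J].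
  by rewrite negb_exists; apply: eq_forallb => J; rewrite negb_and negbK implybE.
rewrite ltnNge; set ex := [exists (J : {set T} | _), ~~ P J].
by case: (r <= _)%N; case: ex.
Qed.

(** Outside a proportion [2 * 2 ^ -b] of each level, [S] contains at least [b] elements of [I] and
    omits at least [b] of them. The contained ones supply the [r] samples; the omitted ones make
    every possible pool [J] large. *)
Lemma slice_conc_subset (v : T -> R * R) (a b r : nat) I (l q : R) : 0 <= q -> (a < #|T|)%N ->
  (r <= b)%N -> tail_ok #|T| #|I| a b -> tail_ok #|T| #|I| (#|T| - a.+1) b ->
  (forall J, J \subset I -> (b <= #|J|)%N ->
     (2 * r ^ 2 <= #|J|)%N /\ conc l q (pw (vals v J) r)) ->
  slice_conc v a l (2 * q + 2 * (2 ^+ b)^-1).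
Proof.
move=> q0 aT rb t1 t2 hJ z.
have H a' : (a' <= #|T|)%N -> tail_ok #|T| #|I| a' b -> tail_ok #|T| #|I| (#|T| - a') b ->
   (#|[set S : {set T} | (#|S| == a') &&
     ((#|S :&: I| < r)%N || [exists (J : {set T} | (I :\: S \subset J) && (J \subset I)), ~~ (b <= #|J|)%N])]|)%:R
    <= (2 * (2 ^+ b)^-1) * 'C(#|T|, a')%:R :> R.
  move=> aT' u1 u2; rewrite mulr_natl mulr2n mulrDl.
  apply: le_trans (lerD (hyper_tail_prob u1) (hyper_tailC_prob aT' u2)).
  rewrite -natrD ler_nat; apply: leq_trans (leq_card_setU _ _).
  apply: subset_leq_card; apply/subsetP => S; rewrite !inE => /andP[-> /orP[h|]] /=.
    by rewrite (leq_trans h rb).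
  case/existsP => J /andP[/andP[/subset_leq_card h1 _]]; rewrite -ltnNge => h2.
  by rewrite (leq_ltn_trans h1 h2) orbT.
apply: le_card_slice.
  apply: (level_conc (P := fun J : {set T} => (b <= #|J|)%N) (I := I) q0 hJ); apply: H => //; first exact: ltnW.
  have -> : (#|T| - a = (#|T| - a.+1).+1)%N by rewrite subnSK.
  exact: tail_okS.
by apply: (level_conc (P := fun J : {set T} => (b <= #|J|)%N) (I := I) q0 hJ); apply: H => //; apply: tail_okS.
Qed.

(** The pool must keep [b] elements of every [W i] simultaneously; the union bound over [i] costs
    the factor [#|T|]. *)
Lemma slice_conc_spread (v : T -> R * R) (W : T -> {set T}) (a b r : nat) (l q : R) :
  0 <= q -> (a < #|T|)%N -> (r <= a)%N ->
  (forall i, tail_ok #|T| #|W i| (#|T| - a.+1) b) ->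
  (forall J, (forall i, b <= #|W i :&: J|)%N ->
     (2 * r ^ 2 <= #|J|)%N /\ conc l q (pw (vals v J) r)) ->
  slice_conc v a l (2 * q + #|T|%:R * (2 ^+ b)^-1).
Proof.
move=> q0 aT ra t2 hJ z.
pose P J := [forall i, (b <= #|W i :&: J|)%N].
have hP J : J \subset setT -> P J -> (2 * r ^ 2 <= #|J|)%N /\ conc l q (pw (vals v J) r).
  by move=> _ /forallP; exact: hJ.
have H a' : (a' <= #|T|)%N -> (r <= a')%N -> (forall i, tail_ok #|T| #|W i| (#|T| - a') b) ->
   (#|[set S : {set T} | (#|S| == a') &&
     ((#|S :&: setT| < r)%N || [exists (J : {set T} | (setT :\: S \subset J) && (J \subset setT)), ~~ P J])]|)%:R
    <= (#|T|%:R * (2 ^+ b)^-1) * 'C(#|T|, a')%:R :> R.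
  move=> aT' ra' u2.
  apply: (@le_trans _ _ (\sum_(i : T)
     #|[set S : {set T} | (#|S| == a') && (#|W i :\: S| < b)%N]|)%:R).
    rewrite ler_nat -sum1_card.
    have -> : (\sum_(i : T) #|[set S : {set T} | (#|S| == a') && (#|W i :\: S| < b)%N]| =
       \sum_(S : {set T}) \sum_(i : T) ((#|S| == a') && (#|W i :\: S| < b)%N))%N.
      rewrite exchange_big /=; apply: eq_bigr => i _.
      by rewrite -sum1_card big_mkcond; apply: eq_bigr => S _; rewrite inE; case: ifP.
    rewrite big_mkcond; apply: leq_sum => S _; rewrite inE setIT.
    case: ifP => // /andP[/eqP Sa]; rewrite Sa ltnNge ra' /= => /existsP[J /andP[/andP[SJ _]]].
    case/forallPn => i; rewrite -ltnNge => h.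
    rewrite (bigD1 i)//= eqxx /= (_ : (_ < b)%N = true) ?leq_addr//.
    apply: leq_ltn_trans h; apply: subset_leq_card; rewrite setDE setIS//.
    by rewrite setTD in SJ.
  rewrite natr_sum; apply: (@le_trans _ _ (\sum_(i : T) (2 ^+ b)^-1 * 'C(#|T|, a')%:R)).
    by apply: ler_sum => i _; exact: hyper_tailC_prob.
  by rewrite sumr_const -[leLHS]mulr_natl mulrA lexx.
apply: le_card_slice.
  apply: (level_conc (P := P) (I := setT) q0 hP); apply: H => //; first exact: ltnW.
  have -> : (#|T| - a = (#|T| - a.+1).+1)%N by rewrite subnSK.
  by move=> i; apply: tail_okS.
by apply: (level_conc (P := P) (I := setT) q0 hP); apply: H => //; rewrite leqW.
Qed.

Definition collisions (v : T -> R * R) k I l : {set k.-tuple T * k.-tuple T} :=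
  [set p : k.-tuple T * k.-tuple T | [&& all (mem I) p.1, all (mem I) p.2 &
     close l (\sum_(i <- p.1) v i) (\sum_(i <- p.2) v i)]].

(** By contraposition: few collisions bound the concentration of [2 * k] draws at scale
    [2 ^+ m * l], and [m] triplings carry this down to [l] with factor [g]. The 64 is 16 from the
    grid cells, times 2 for draws with replacement, times 2 because half of [rho] is kept for the
    exceptional sets. *)
Lemma many_collisions (v : T -> R * R) (a b k m : nat) I (l rho : R) : 0 < l ->
  (a < #|T|)%N -> (0 < k)%N -> (2 * (2 * k * 3 ^ m) ^ 2 <= b)%N ->
  tail_ok #|T| #|I| a b -> tail_ok #|T| #|I| (#|T| - a.+1) b ->
  4 * (2 ^+ b)^-1 <= rho -> rho <= (1 - 10 ^- 6) ^+ m ->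
  ~ slice_conc v a l rho ->
  rho / 64 * ((1 - 10 ^- 6) ^+ m)^-1 * b%:R ^+ (2 * k) <=
    #|collisions v k I (2 ^+ m * l)|%:R.
Proof.
move=> l0 aT k0 rb t1 t2 hb hm hn.
rewrite leNgt; apply/negP => hlt; apply: hn => z.
set g : R := (1 - 10 ^- 6) ^+ m in hm hlt *.
have g0 : 0 < g by rewrite exprn_gt0//; lra.
have rho0 : 0 <= rho by apply: le_trans hb; rewrite mulr_ge0// invr_ge0 exprn_ge0.
pose q := rho / 4 / g.
have hq : 2 * (rho / 4) + 2 * (2 ^+ b)^-1 <= rho by lra.
apply: (@le_trans _ _ ((2 * (rho / 4) + 2 * (2 ^+ b)^-1) * #|slice a|%:R)); last first.
  by rewrite ler_wpM2r.
move: z; apply: (@slice_conc_subset v a b (2 * k * 3 ^ m) I) => //; first by rewrite divr_ge0.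
  by apply: leq_trans rb; nia.
move=> J JI bJ; split; first exact: leq_trans bJ.
apply: conc_pw_tower.
have L0 : (0 < size (pw (vals v J) (2 * k)))%N.
  rewrite size_pw size_vals expn_gt0 (leq_trans _ bJ)// (leq_trans _ rb)//.
  by rewrite muln_gt0 expn_gt0 !muln_gt0 k0 expn_gt0.
rewrite (_ : rho / 4 = g * q); last by rewrite /q mulrCA divff ?mulr1// gt_eqF.
apply: conc_tower => //; first exact: ltW.
  rewrite /q ler_pdivrMr//; lra.
move=> z.
have l20 : 0 < 2 ^+ m * l by rewrite mulr_gt0// exprn_gt0.
have cE : (count (close (2 ^+ m * l) z) (pw (vals v J) (2 * k)))%:R =
    (count (close (2 ^+ m * l) z) (conv (pw (vals v J) k) (pw (vals v J) k)))%:R :> R.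
  by rewrite !sumr_count sum_conv mul2n -addnn sum_pw_add.
rewrite cE; apply: le_trans (count_sum_le_collisions _ _ l20) _.
have -> : \sum_(x <- pw (vals v J) k) (count (close (2 ^+ m * l) x) (pw (vals v J) k))%:R =
    #|collisions v k J (2 ^+ m * l)|%:R :> R.
  rewrite sum_pw_vals -sum1_card natr_sum.
  rewrite (eq_bigr (fun t : k.-tuple T => \sum_(t' : k.-tuple T | all (mem J) t')
      (close (2 ^+ m * l) (\sum_(i <- t) v i) (\sum_(i <- t') v i))%:R)); last first.
    by move=> t _; rewrite sumr_count sum_pw_vals.
  rewrite pair_big_dep /= [LHS]big_mkcond [RHS]big_mkcond; apply: eq_bigr => -[t t'] _ /=.
  by rewrite inE /=; case: (all _ t); case: (all _ t') => //=; case: (close _ _ _).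
apply: (@le_trans _ _ (16 * (rho / 64 * g^-1 * b%:R ^+ (2 * k)))).
  rewrite ler_pM2l// ltW// (le_lt_trans _ hlt)// ler_nat; apply: subset_leq_card.
  apply/subsetP => -[t t']; rewrite !inE /= => /and3P[/allP h1 /allP h2 ->]; rewrite andbT.
  by apply/andP; split; apply/allP => x; [move=> /h1|move=> /h2]; exact: (subsetP JI).
rewrite size_pw size_vals /q natrX.
have : b%:R ^+ (2 * k) <= #|J|%:R ^+ (2 * k) :> R by rewrite lerXn2r ?nnegrE// ler_nat.
have : 0 <= rho / g by rewrite divr_ge0// ltW.
nra.
Qed.

End Slices.

(** * Initial concentration when every coordinate is far from many others *)

Section Spread.
Variables (R : archiRealFieldType) (T : finType).
Implicit Types (S I J W : {set T}).

Definition far (v : T -> R * R) l i : {set T} := [set j | ~~ close l (v i) (v j)].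

(** A ball of radius [l] containing [v i] misses, by the triangle inequality, every element of [J]
    farther than [2 * l] from [v i], hence at least [b] of them. *)
Lemma conc_vals_far (v : T -> R * R) l b J : (forall i, b <= #|far v (2 * l) i :&: J|)%N ->
  (0 < #|T|)%N -> conc l (1 - b%:R / #|T|%:R) (vals v J).
Proof.
move=> hb T0 z.
have n0 : 0 < #|T|%:R :> R by rewrite ltr0n.
have JT : #|J|%:R <= #|T|%:R :> R by rewrite ler_nat max_card.
have J0 : 0 <= b%:R / #|T|%:R :> R by rewrite divr_ge0.
have bJ : #|J|%:R * (b%:R / #|T|%:R) <= b%:R :> R.
  by rewrite mulrA ler_pdivrMr// mulrC ler_wpM2l.
rewrite size_vals.
have -> : count (close l z) (vals v J) = #|[set j in J | close l z (v j)]|.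
  by rewrite count_map -sum1_count big_enum_cond sum1dep_card.
case: (set_0Vmem [set j in J | close l z (v j)]) => [->|]; last case=> i.
  have /card_gt0P[i0 _] := T0.
  rewrite cards0; have := hb i0; have : (#|far v (2 * l) i0 :&: J| <= #|J|)%N.
    by apply: subset_leq_card; rewrite subsetIr.
  by move=> h1 h2; have := leq_trans h2 h1; rewrite -(ler_nat R); nra.
rewrite inE => /andP[iJ ci].
have : (#|[set j in J | close l z (v j)]| + #|far v (2 * l) i :&: J| <= #|J|)%N.
  rewrite -cardsUI [X in (_ + X)%N](_ : _ = 0%N) ?addn0.
    by apply: subset_leq_card; apply/subsetP => j; rewrite !inE => /orP[]/andP[].
  apply/eqP; rewrite cards_eq0; apply/eqP/setP => j; rewrite !inE; apply/negP.
  case/andP => /andP[_ cj] /andP[/negP nc _]; apply: nc.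
  by rewrite close_sym in ci; have := close_trans ci cj; rewrite mulr_natl mulr2n.
have := hb i; rewrite -(ler_nat R) => h1; rewrite -(ler_nat R) natrD; nra.
Qed.

(** The [9 ^ m] draws form [m + m] triplings: [m] of them lift the missing mass from [b / #|T|] to
    1/4, and [m] more gain [g]. Each halves the scale, hence [4 ^+ m]; the constant is
    [3 / 2 = 2 * (3 / 4)]. *)
Lemma slice_conc_far (v : T -> R * R) (a b m : nat) (l : R) : 0 <= l ->
  (a < #|T|)%N -> (9 ^ m <= a)%N -> (2 * 81 ^ m <= b)%N ->
  (forall i, tail_ok #|T| #|far v (2 * 4 ^+ m * l) i| (#|T| - a.+1) b) ->
  #|T|%:R / 4 <= (5 / 4) ^+ m * b%:R :> R ->
  slice_conc v a l (3 / 2 * (1 - 10 ^- 6) ^+ m + #|T|%:R * (2 ^+ b)^-1).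
Proof.
move=> l0 aT ma mb ht hb.
set g : R := (1 - 10 ^- 6) ^+ m.
have g0 : 0 <= g by rewrite exprn_ge0//; lra.
rewrite (_ : 3 / 2 * g = 2 * (g * (3 / 4))); last by field.
apply: (slice_conc_spread (r := 9 ^ m) _ _ _ ht) => //.
  by rewrite mulr_ge0//; lra.
move=> J hJ.
have T0 : (0 < #|T|)%N by apply: leq_ltn_trans aT.
have bJ : (b <= #|J|)%N.
  have /card_gt0P[i0 _] := T0.
  by apply: leq_trans (hJ i0) _; apply: subset_leq_card; rewrite subsetIr.
have J0 : (0 < #|J|)%N.
  by apply: leq_trans bJ; apply: leq_trans mb; rewrite muln_gt0 expn_gt0.
split; first by apply: leq_trans bJ; rewrite expnAC.
rewrite (_ : 9 ^ m = 1 * 3 ^ (m + m))%N; last by rewrite mul1n addnn -mul2n expnM.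
apply: conc_pw_tower.
have h1 : conc (4 ^+ m * l) (1 - b%:R / #|T|%:R) (pw (vals v J) 1).
  apply: (eq_sum_conc (L := vals v J)).
    by move=> f; rewrite sum_conv; apply: eq_bigr => x _; rewrite big_seq1 addr0.
  by apply: conc_vals_far => // i; rewrite mulrA; exact: hJ.
have L0 : (0 < size (pw (vals v J) 1))%N by rewrite size_pw size_vals expn1.
rewrite /tower iterD -!/(tower _ _).
apply: conc_tower => //; first exact: size_tower_gt0.
apply: (conc_tower_spread (p := b%:R / #|T|%:R)) => //.
- by rewrite mulr_ge0// exprn_ge0.
- by rewrite mulrA ler_pdivlMr ?ltr0n// mulrC mulrA mulr1.
- by rewrite mulrA -exprMn -natrM.
Qed.

End Spread.

(** * Counting structured vectors on a grid *)

Lemma card_le_fibers (A B : finType) (D : {set A}) (E : {set B}) (h : A -> B) (K : nat) :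
  {in D, forall x, h x \in E} ->
  (forall y, (#|[set x in D | h x == y]| <= K)%N) -> (#|D| <= K * #|E|)%N.
Proof.
move=> hDE hK; rewrite -sum1_card (partition_big h (mem E))/=; last exact: hDE.
rewrite mulnC -sum_nat_const; apply: leq_sum => y _; apply: leq_trans (hK y).
by rewrite -sum1_card big_mkcond [leqRHS]big_mkcond; apply: leq_sum => x _; rewrite inE.
Qed.

Section CountStructured.
Variables (R : realFieldType) (T V P : finType) (d : V).
Variables (supp : P -> {set T}) (piv : P -> T) (sol : P -> {ffun T -> V} -> bool).
Variables (pats : {set P}) (w : nat -> R) (K s : nat) (q : R).
Implicit Types (a b : {ffun T -> V}) (I J : {set T}).

Definition upd a (i : T) (x : V) : {ffun T -> V} := [ffun j => if j == i then x else a j].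

Hypothesis pivP : forall p, p \in pats -> piv p \in supp p.
Hypothesis sol_ext : forall p a b, {in supp p, a =1 b} -> sol p a = sol p b.
Hypothesis sol_le : forall p a, p \in pats -> (#|[set x | sol p (upd a (piv p) x)]| <= K)%N.
Hypothesis w_gt0 : forall j, (s < j)%N -> 0 < w j.
Hypothesis card_pats : forall J, (s <= #|J|)%N -> #|[set p in pats | supp p \subset J]|%:R <= w #|J|.
Hypothesis q_gt0 : 0 < q.

(** Quantifying over all large [J] makes the property survive the removal of a coordinate, which
    drives the induction on [I]. *)
Definition structured a I := [forall (J : {set T} | (J \subset I) && (s <= #|J|)%N),
  q * w #|J| <= #|[set p in pats | (supp p \subset J) && sol p a]|%:R].

Definition structured_on I : {set {ffun T -> V}} :=
  [set a in pffun_on d I predT | structured a I].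

(* Each step removes the pivot of a solved pattern: there are at most
   [w #|I|] patterns on [I], at least [q * w #|I|] of them are solved, and a
   solved pattern leaves at most [K] values for its pivot. *)
Lemma card_structured_on I : (s <= #|I|)%N ->
  #|structured_on I|%:R <= #|V|%:R ^+ s * (K%:R / q) ^+ (#|I| - s) :> R.
Proof.
move: {-2}(#|I| - s)%N (erefl (#|I| - s)%N) => r; elim: r I => [|r IH] I hr sI.
  rewrite mulr1 -natrX ler_nat; have -> : s = #|I| by lia.
  have <- : #|(predT : pred V)| = #|V| by [].
  rewrite -(card_pffun_on d (mem I) predT).
  apply: subset_leq_card; apply/subsetP => a; rewrite inE => /andP[/pffun_onP[h _] _].
  by apply/pffun_onP; split.
set A := structured_on I.
have sI' : (s < #|I|)%N by lia.
pose B := [set p in pats | supp p \subset I].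
have h1 : q * w #|I| * #|A|%:R <= \sum_(a in A) (\sum_(p in B) (sol p a)%:R).
  rewrite [leLHS]mulr_natr -sumr_const; apply: ler_sum => a.
  rewrite inE => /andP[_ /forallP/(_ I)]; rewrite subxx sI /= => h; apply: le_trans h _.
  rewrite -sum1_card natr_sum big_mkcond [leRHS]big_mkcond; apply: ler_sum => p _.
  by rewrite !inE; case: (p \in pats); case: (supp p \subset I); case: (sol p a).
set M := #|V|%:R ^+ s * (K%:R / q) ^+ r : R.
have h2 p : p \in B -> \sum_(a in A) (sol p a)%:R <= K%:R * M.
  rewrite inE => /andP[pP pI].
  have piI : piv p \in I by apply: (subsetP pI); exact: pivP.
  have cI : #|I :\ piv p|.+1 = #|I| by rewrite (cardsD1 (piv p) I) piI.
  pose D := [set a in A | sol p a].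
  have -> : \sum_(a in A) (sol p a)%:R = #|D|%:R :> R.
    rewrite -sum1_card natr_sum [LHS]big_mkcond [RHS]big_mkcond; apply: eq_bigr => a _.
    by rewrite [a \in D]in_set; case: (a \in A) => //=; case: (sol p a).
  apply: (@le_trans _ _ (K%:R * #|structured_on (I :\ piv p)|%:R)).
    (* Overwriting the pivot by [d] forgets one coordinate; the result is structured on the smaller
       set because patterns inside that set do not see the pivot. *)
    rewrite -natrM ler_nat; apply: (card_le_fibers (h := fun a => upd a (piv p) d)).
      move=> a; rewrite !inE => /andP[/andP[/pffun_onP[sa _] /forallP st] _].
      apply/andP; split.
        apply/pffun_onP; split=> //; apply/subsetP => x; rewrite !inE ffunE.
        by case: (x =P piv p) => [_|_ /= xa]; [rewrite eqxx|exact: (subsetP sa)].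
      apply/forallP => J; apply/implyP => /andP[JI sJ].
      have := st J; rewrite sJ (subset_trans JI (subsetDl _ _)) /= => h; apply: le_trans h _.
      rewrite ler_nat; apply: subset_leq_card; apply/subsetP => p'; rewrite !inE.
      move=> /and3P[-> h2 h3]; rewrite h2 /= -(sol_ext (a := a))// => x xp.
      have := subsetP JI _ (subsetP h2 _ xp); rewrite !inE ffunE => /andP[/negbTE -> _]; by [].
    move=> a'; apply: leq_trans (sol_le a' pP).
    rewrite -(card_in_imset (f := fun a : {ffun T -> V} => a (piv p))).
      apply: subset_leq_card; apply/subsetP => x /imsetP[a]; rewrite !inE.
      move=> /andP[/andP[_ sa] /eqP <-] ->.
      rewrite (_ : upd _ _ _ = a)//; apply/ffunP => j; rewrite !ffunE.
      by case: (j =P piv p) => [->|].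
    move=> a b; rewrite !inE => /andP[_ /eqP ea] /andP[_ /eqP eb] eab.
    apply/ffunP => j; have := congr1 (fun f : {ffun T -> V} => f j) (etrans ea (esym eb)).
    by rewrite !ffunE; case: (j =P piv p) => [->|].
  rewrite ler_wpM2l// /M.
  by have := IH (I :\ piv p); rewrite /= (_ : #|I :\ piv p| - s = r)%N; [apply; lia|lia].
have h3 : q * w #|I| * #|A|%:R <= w #|I| * (K%:R * M).
  apply: le_trans h1 _; rewrite exchange_big /=; apply: le_trans (ler_sum _ h2) _.
  rewrite sumr_const -[leLHS]mulr_natl ler_wpM2r ?card_pats//.
  by rewrite mulr_ge0// /M mulr_ge0// exprn_ge0// divr_ge0// ltW.
have w0 := w_gt0 sI'.
rewrite exprS mulrCA -/M mulrAC ler_pdivlMr//.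
rewrite -(ler_pM2l w0); apply: le_trans h3; rewrite le_eqVlt; apply/orP; left; apply/eqP; ring.
Qed.

End CountStructured.

(** * Rounding to a grid and coincidence patterns *)

Section Grid.
Variables (R : archiRealFieldType) (T : finType) (M : nat).
Hypothesis M0 : (0 < M)%N.

Definition grid : finType := ('I_(2 * M).+1 * 'I_(2 * M).+1)%type.

Definition gval (b : grid) : R * R := (b.1%:R / M%:R - 1, b.2%:R / M%:R - 1).

Definition ground (x : R * R) : grid :=
  (inord (Num.trunc ((x.1 + 1) * M%:R)), inord (Num.trunc ((x.2 + 1) * M%:R))).

Lemma ground_close1 (x : R) : `|x| <= 1 ->
  `|x - ((inord (Num.trunc ((x + 1) * M%:R)) : 'I_(2 * M).+1)%:R / M%:R - 1)| <= M%:R^-1.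
Proof.
rewrite ler_norml => /andP[x1 x2].
have M0' : 0 < M%:R :> R by rewrite ltr0n.
have h0 : 0 <= (x + 1) * M%:R by rewrite mulr_ge0//; lra.
have /andP[h1 h2] := truncn_itv h0.
set t := Num.trunc _ in h1 h2 *.
have tM : (t < (2 * M).+1)%N.
  by rewrite -(ltr_nat R) -natr1 natrM; nra.
rewrite inordK//.
have -> : x - (t%:R / M%:R - 1) = ((x + 1) * M%:R - t%:R) / M%:R.
  by field; rewrite gt_eqF.
rewrite -natr1 in h2.
rewrite normrM normfV (gtr0_norm M0') ler_pdivrMr// mulVf ?gt_eqF//.
by rewrite ger0_norm; lra.
Qed.

Lemma ground_close (x : R * R) : close 1 0 x -> close M%:R^-1 x (gval (ground x)).
Proof.
rewrite /close /= !sub0r !normrN => /andP[h1 h2].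
by rewrite !ground_close1.
Qed.

Lemma card_ord_window N (A : {set 'I_N}) (D : nat) :
  (forall i j, i \in A -> j \in A -> i <= j + D)%N -> (#|A| <= D.+1)%N.
Proof.
move=> hA; case: (set_0Vmem A) => [->|[i0 i0A]]; first by rewrite cards0.
pose i1 := [arg min_(i < i0 in A) (i : nat)].
have [i1A hmin] : i1 \in A /\ forall j, j \in A -> (i1 <= j)%N.
  by rewrite /i1; case: arg_minnP.
rewrite -[X in (_ <= X)%N]card_ord.
rewrite -(card_in_imset (f := fun i : 'I_N => inord (i - i1) : 'I_D.+1)) ?max_card//.
move=> i j iA jA /(congr1 val) /=.
have := hA _ _ iA i1A; have := hA _ _ jA i1A; have := hmin _ iA; have := hmin _ jA.
move=> h1 h2 h3 h4; rewrite !inordK ?ltnS ?leq_subLR// => e.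
by apply: val_inj => /=; lia.
Qed.

Lemma sum_pair1 (s : seq T) (f : T -> R * R) : (\sum_(i <- s) f i).1 = \sum_(i <- s) (f i).1.
Proof. by elim: s => [|i s IH]; rewrite ?big_nil// !big_cons /= IH. Qed.

Lemma sum_pair2 (s : seq T) (f : T -> R * R) : (\sum_(i <- s) f i).2 = \sum_(i <- s) (f i).2.
Proof. by elim: s => [|i s IH]; rewrite ?big_nil// !big_cons /= IH. Qed.

Lemma sum_upd (s : seq T) (a : {ffun T -> grid}) i x (f : grid -> R) :
  \sum_(j <- s) f (upd a i x j) =
  (count_mem i s)%:R * f x + \sum_(j <- s | j != i) f (a j).
Proof.
elim: s => [|j s IH]; first by rewrite !big_nil mul0r addr0.
rewrite !big_cons /= ffunE IH natrD; case: (j =P i) => [_|_] /=; ring.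
Qed.

Variable k : nat.

Definition pattern := (k.-tuple T * k.-tuple T)%type.

Definition psupp (p : pattern) : {set T} := [set i | (i \in p.1 : bool) || (i \in p.2)].

(** The tolerance allows one mesh width [1 / M] for each of the [2 * k] roundings and one for the
    coincidence itself. *)
Definition psol (p : pattern) (a : {ffun T -> grid}) :=
  close ((2 * k + 1)%:R / M%:R) (\sum_(i <- p.1) gval (a i)) (\sum_(i <- p.2) gval (a i)).

Definition nontrivial : {set pattern} := [set p : pattern | ~~ perm_eq p.1 p.2].

(** A coordinate with different multiplicities on the two sides, on which the near equation
    genuinely depends; [i0] is only a default for trivial patterns. *)
Definition pivot (i0 : T) (p : pattern) : T :=
  odflt i0 [pick i | count_mem i p.1 != count_mem i p.2].

Lemma pivot_count i0 p : p \in nontrivial ->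
  count_mem (pivot i0 p) p.1 != count_mem (pivot i0 p) p.2.
Proof.
rewrite inE /perm_eq /pivot -has_predC => /hasP[i _ /= hi].
by case: pickP => [//|/(_ i)]; rewrite hi.
Qed.

Lemma pivot_supp i0 p : p \in nontrivial -> pivot i0 p \in psupp p.
Proof.
move=> /(pivot_count i0); rewrite inE; apply: contraR.
by rewrite negb_or => /andP[/count_memPn -> /count_memPn ->].
Qed.

Lemma psol_ext p (a b : {ffun T -> grid}) : {in psupp p, a =1 b} -> psol p a = psol p b.
Proof.
move=> h; congr (close _ _ _).
  by rewrite big_seq [RHS]big_seq; apply: eq_bigr => i ip; rewrite h// inE ip.
by rewrite big_seq [RHS]big_seq; apply: eq_bigr => i ip; rewrite h// inE ip orbT.
Qed.

(** The integers [c1] and [c2] differ by at least 1, so subtracting the two near equations bounds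
    [u1 - u2] by twice the tolerance, in units of the mesh. *)
Lemma psol_window (c1 c2 u1 u2 : nat) (e1 e2 : R) : c1 <> c2 ->
  `|c1%:R * (u1%:R / M%:R - 1) + e1 - (c2%:R * (u1%:R / M%:R - 1) + e2)| <= (2 * k + 1)%:R / M%:R ->
  `|c1%:R * (u2%:R / M%:R - 1) + e1 - (c2%:R * (u2%:R / M%:R - 1) + e2)| <= (2 * k + 1)%:R / M%:R ->
  (u1 <= u2 + (4 * k + 2))%N.
Proof.
move=> hc h1 h2; have M0' : 0 < M%:R :> R by rewrite ltr0n.
have h : `|(c1%:R - c2%:R) * (u1%:R - u2%:R)| <= (4 * k + 2)%:R :> R.
  rewrite -(ler_pM2r (_ : 0 < M%:R^-1)) ?invr_gt0//.
  rewrite -[X in _ * X <= _]ger0_norm ?invr_ge0// -normrM.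
  have -> : (4 * k + 2)%:R * M%:R^-1 = (2 * k + 1)%:R / M%:R + (2 * k + 1)%:R / M%:R :> R.
    rewrite -mulrDl -natrD; congr (_%:R * _); lia.
  apply: le_trans (lerD h1 h2); apply: le_trans (ler_normB _ _).
  by rewrite le_eqVlt; apply/orP; left; apply/eqP; congr `|_|; ring.
rewrite normrM in h; rewrite -(ler_nat R) natrD.
have hc1 : 1 <= `|c1%:R - c2%:R| :> R.
  have [lt|gt|//] := ltngtP c1 c2.
    rewrite distrC -natrB ?(ltnW lt)// normr_nat ler1n; lia.
  rewrite -natrB ?(ltnW gt)// normr_nat ler1n; lia.
have : `|u1%:R - u2%:R| <= (4 * k + 2)%:R :> R.
  by apply: le_trans h; rewrite ler_peMl.
by rewrite ler_norml; lra.
Qed.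

Lemma psol_le i0 p (a : {ffun T -> grid}) : p \in nontrivial ->
  (#|[set x | psol p (upd a (pivot i0 p) x)]| <= (4 * k + 3) ^ 2)%N.
Proof.
move=> /(pivot_count i0)/eqP hc; set A := [set x | _].
have hA x : x \in A -> psol p (upd a (pivot i0 p) x) by rewrite inE.
have E (P : grid -> R) x : \sum_(i <- p.1) P (upd a (pivot i0 p) x i) - \sum_(i <- p.2) P (upd a (pivot i0 p) x i) =
   (count_mem (pivot i0 p) p.1)%:R * P x + \sum_(j <- p.1 | j != pivot i0 p) P (a j) -
   ((count_mem (pivot i0 p) p.2)%:R * P x + \sum_(j <- p.2 | j != pivot i0 p) P (a j)).
  by rewrite !sum_upd.
have sA : A \subset setX [set x.1 | x in A] [set x.2 | x in A].
  by apply/subsetP => -[x y] xA; rewrite inE /=; apply/andP; split; apply/imsetP; exists (x, y).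
apply: leq_trans (subset_leq_card sA) _; rewrite cardsX -mulnn; apply: leq_mul.
  rewrite addnS; apply: card_ord_window => _ _ /imsetP[x /hA/andP[hx _] ->] /imsetP[y /hA/andP[hy _] ->].
  rewrite !sum_pair1 (E (fun b => (gval b).1)) in hx; rewrite !sum_pair1 (E (fun b => (gval b).1)) in hy.
  exact: psol_window hc hx hy.
rewrite addnS; apply: card_ord_window => _ _ /imsetP[x /hA/andP[_ hx] ->] /imsetP[y /hA/andP[_ hy] ->].
rewrite !sum_pair2 (E (fun b => (gval b).2)) in hx; rewrite !sum_pair2 (E (fun b => (gval b).2)) in hy.
exact: psol_window hc hx hy.
Qed.

Lemma card_tuples_in (I : {set T}) r : #|[set t : r.-tuple T | all (mem I) t]| = (#|I| ^ r)%N.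
Proof.
apply/eqP; rewrite -(eqr_nat R) -sum1_card natr_sum -(size_vals (fun=> 0 : R * R)).
rewrite -size_pw -count_predT sumr_count (sum_pw_vals _ _ _ (fun=> 1)).
by apply/eqP; apply: eq_bigl => t; rewrite inE.
Qed.

Lemma card_pattern_in (I : {set T}) :
  #|[set p : pattern | psupp p \subset I]| = (#|I| ^ (2 * k))%N.
Proof.
rewrite mul2n -addnn expnD -!card_tuples_in -cardsX; congr #|pred_of_set _|.
apply/setP => -[t t']; rewrite !inE /=; apply/subsetP/andP => [h|[/allP h1 /allP h2] x].
  by split; apply/allP => x xt; apply: h; rewrite inE /= xt ?orbT.
by rewrite inE /= => /orP[/h1|/h2].
Qed.

(** The second tuple is a word of length [k] in the at most [k] letters of the first. *)
Lemma card_trivial (I : {set T}) :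
  (#|[set p : pattern | (psupp p \subset I) && perm_eq p.1 p.2]| <= k ^ k * #|I| ^ k)%N.
Proof.
have fib (t : k.-tuple T) : (#|[set p in [set p : pattern |
    (psupp p \subset I) && perm_eq p.1 p.2] | p.1 == t]| <= k ^ k)%N.
  have tk : (#|[set x in t]| <= k)%N.
    by rewrite cardsE -[leqRHS](size_tuple t); exact: card_size.
  apply: (@leq_trans (#|[set x in t]| ^ k)); last first.
    by move: (#|_|) tk; case: (k) => // k' c tk; rewrite leq_exp2r.
  rewrite -card_tuples_in -(card_in_imset (f := fun p : pattern => p.2)).
    apply: subset_leq_card; apply/subsetP => _ /imsetP[[u u'] + ->]; rewrite !inE /=.
    case/andP => /andP[_ /perm_mem pu] /eqP <-; apply/allP => x xu.
    by rewrite /= inE pu.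
  by move=> [u u'] [w w']; rewrite !inE /= => /andP[_ /eqP ->] /andP[_ /eqP ->] ->.
rewrite -[X in (_ * X)%N]card_tuples_in.
apply: (card_le_fibers (h := fun p : pattern => p.1)) => [[t t']|t]; last exact: fib.
rewrite !inE /= => /andP[/subsetP h _]; apply/allP => x xt; apply: h.
by rewrite inE /= xt.
Qed.

Definition grid_structured (s : nat) (q : R) : {set {ffun T -> grid}} :=
  [set a | structured psupp psol nontrivial (fun j => j%:R ^+ (2 * k)) s q a setT].

Lemma card_grid_structured (i0 : T) (s : nat) (q : R) : 0 < q -> (s <= #|T|)%N ->
  #|grid_structured s q|%:R <=
    ((2 * M).+1 ^ 2)%:R ^+ s * (((4 * k + 3) ^ 2)%:R / q) ^+ (#|T| - s) :> R.
Proof.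
move=> q0 sT; rewrite -cardsT in sT *.
have := @card_structured_on R T grid pattern (ord0, ord0) psupp (pivot i0) psol nontrivial
  (fun j => j%:R ^+ (2 * k)) ((4 * k + 3) ^ 2) s q (@pivot_supp i0) psol_ext (@psol_le i0).
rewrite card_prod card_ord mulnn => H.
apply: le_trans (H _ _ q0 setT sT).
- rewrite ler_nat; apply: subset_leq_card; apply/subsetP => a.
  rewrite !inE => ->; rewrite andbT; apply/pffun_onP.
  by split=> //; apply/subsetP => x _; rewrite in_setT.
- by move=> j sj; rewrite exprn_gt0// ltr0n; apply: leq_ltn_trans sj.
- move=> J _; rewrite -natrX ler_nat -card_pattern_in; apply: subset_leq_card.
  by apply/subsetP => p; rewrite !inE => /andP[_ ->].
Qed.

(** Coincidences survive rounding within the tolerance of [psol]. Pairs of rearranged tuples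
    coincide for every vector and carry no information, so the hypothesis demands a surplus covering
    them. *)
Lemma ground_structured (v : T -> R * R) (s : nat) (q l : R) :
  (forall i, close 1 0 (v i)) -> l <= M%:R^-1 ->
  (forall J : {set T}, (s <= #|J|)%N -> q * #|J|%:R ^+ (2 * k) + (k ^ k * #|J| ^ k)%:R <= #|collisions v k J l|%:R) ->
  [ffun i => ground (v i)] \in grid_structured s q.
Proof.
move=> v1 lM hJ; rewrite inE; apply/forallP => J; apply/implyP => /andP[_ sJ].
rewrite -(lerD2r (k ^ k * #|J| ^ k)%:R); apply: le_trans (hJ J sJ) _.
rewrite -natrD ler_nat; apply: leq_trans (leq_add (leqnn _) (card_trivial J)).
apply: leq_trans (leq_card_setU _ _); apply: subset_leq_card.
apply/subsetP => -[t t']; rewrite !inE /= => /and3P[/allP h1 /allP h2 hc].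
have hs : psupp (t, t') \subset J.
  by apply/subsetP => x; rewrite inE /= => /orP[/h1|/h2].
rewrite hs /= orbC; case: (boolP (perm_eq _ _)) => //= _.
have sc0 (u : seq T) : close ((size u)%:R / M%:R) (\sum_(i <- u) v i)
    (\sum_(i <- u) gval ([ffun i => ground (v i)] i)).
  elim: u => [|i r IH].
    by rewrite !big_nil mul0r closexx.
  rewrite !big_cons ffunE /= -natr1 mulrDl mul1r addrC.
  apply: (@close_trans _ _ _ _ (gval (ground (v i)) + \sum_(j <- r) v j)).
    by rewrite ![_ + \sum_(j <- r) v j]addrC close_addl ground_close.
  by rewrite close_addl.
have sc (u : k.-tuple T) : close (k%:R / M%:R) (\sum_(i <- u) v i)
    (\sum_(i <- u) gval ([ffun i => ground (v i)] i)).
  by have := sc0 u; rewrite size_tuple.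
rewrite /psol /=.
apply: (@closeW _ (k%:R / M%:R + (l + k%:R / M%:R))).
  have -> : (2 * k + 1)%:R / M%:R = k%:R / M%:R + (M%:R^-1 + k%:R / M%:R) :> R.
    by rewrite natrD natrM; ring.
  by rewrite lerD2l lerD2r.
have := sc t; rewrite close_sym => st.
exact: close_trans st (close_trans hc (sc t')).
Qed.

End Grid.

(** * Reduction to normal vectors *)

Section LinearAlgebra.
Variable R : realType.
Local Notation nc := (@Normc.normc R).

Lemma nc_ge0 (z : R[i]) : 0 <= nc z.
Proof. by case: z => a b; exact: sqrtr_ge0. Qed.

Lemma nc_gt0 (z : R[i]) : z != 0 -> 0 < nc z.
Proof.
move=> z0; rewrite lt_def nc_ge0 andbT; apply: contra z0 => /eqP h.
by rewrite (Normc.eq0_normc h).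
Qed.

Lemma nc_sum (I : Type) (r : seq I) (P : pred I) (f : I -> R[i]) :
  nc (\sum_(i <- r | P i) f i) <= \sum_(i <- r | P i) nc (f i).
Proof.
elim/big_rec2: _ => [|i y x _ h]; first by rewrite Normc.normc0.
by apply: le_trans (le_normcD _ _) _; rewrite lerD2l.
Qed.

Lemma cvnorm_ge n (x : 'cV[R[i]]_n) i : nc (x i 0) <= cvnorm x.
Proof.
rewrite -[leLHS]ger0_norm ?nc_ge0// -sqrtr_sqr ler_wsqrtr// (bigD1 i)//= lerDl.
by rewrite sumr_ge0// => j _; rewrite sqr_ge0.
Qed.

Lemma cvnorm1_large n (x : 'cV[R[i]]_n) : cvnorm x = 1 -> exists i, n%:R^-1 <= nc (x i 0).
Proof.
move=> x1.
have s1 : \sum_(i < n) (nc (x i 0)) ^+ 2 = 1.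
  have h0 : 0 <= \sum_(i < n) (nc (x i 0)) ^+ 2 by rewrite sumr_ge0// => i _; rewrite sqr_ge0.
  by rewrite -(sqr_sqrtr h0) -/(cvnorm x) x1 expr1n.
have [/existsP[i hi]|/existsPn hn] := boolP [exists i, n%:R^-1 <= nc (x i 0)]; first by exists i.
have n0 : (0 < n)%N.
  by move: x1 s1 {hn}; case: n x => // x _; rewrite big_ord0 => /eqP; rewrite eq_sym oner_eq0.
have n0' : 0 < n%:R :> R by rewrite ltr0n.
suff : \sum_(i < n) (nc (x i 0)) ^+ 2 < 1 by rewrite s1 ltxx.
apply: (@lt_le_trans _ _ (\sum_(i < n) n%:R^-1)).
  apply: ltr_sum => [|i _]; first by apply/hasP; exists (Ordinal n0); rewrite ?mem_index_enum.
  have := hn i; rewrite -ltNge => h.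
  have n1 : n%:R^-1 <= 1 :> R by rewrite invf_le1// ler1n.
  have h1 := le_trans (ltW h) n1.
  by rewrite expr2; apply: le_lt_trans h; rewrite ler_piMl ?nc_ge0.
by rewrite sumr_const card_ord -[leLHS]mulr_natl mulfV// gt_eqF.
Qed.

(** For invertible [M], a unit [x] with short image has an entry [x i] of modulus at least [1 / n],
    which forces an entry [N i l] of the inverse of modulus at least [1 / (n ^ 2 * t)]; and
    [w i = N i l * (M w) l] when the other entries of [M w] vanish. For singular [M], a left kernel
    vector with nonzero entry [l] forces [(M w) l = 0]. *)
Lemma sigma_min_small n (M : 'M[R[i]]_n) (t : R) : (0 < n)%N -> sigma_min M < t ->
  exists l i : 'I_n, forall w : 'cV[R[i]]_n, (forall j, j != l -> (M *m w) j 0 = 0) ->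
    nc ((M *m w) l 0) <= n%:R ^+ 2 * t * nc (w i 0).
Proof.
move=> n0 /inf_lt[].
  pose e : 'cV[R[i]]_n := delta_mx (Ordinal n0) 0.
  exists (cvnorm (M *m e)); exists e => //=.
  rewrite /cvnorm (bigD1 (Ordinal n0))//= big1 => [|j jn].
    by rewrite mxE !eqxx Normc.normc1 expr1n addr0 sqrtr1.
  by rewrite mxE (negbTE jn) Normc.normc0 expr0n.
move=> _ [x /= x1 <-] xt.
have t0 : 0 < t by apply: le_lt_trans xt; exact: sqrtr_ge0.
have n0' : 0 < n%:R :> R by rewrite ltr0n.
have [Mu|Mu] := boolP (M \in unitmx); last first.
  have : kermx M != 0 by rewrite kermx_eq0 row_free_unit.
  case/rowV0Pn => y /sub_kermxP yM y0.
  have [l yl] : exists l, y 0 l != 0.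
    apply/existsP; apply: contraR y0 => /existsPn h; apply/eqP/rowP => l.
    by rewrite mxE; apply/eqP; have := h l; rewrite negbK.
  exists l, l => w hw.
  have : (y *m (M *m w)) 0 0 = 0 by rewrite mulmxA yM mul0mx mxE.
  rewrite mxE (bigD1 l)//= big1 ?addr0 => [|j jl]; last by rewrite hw// mulr0.
  move/eqP; rewrite mulf_eq0 (negbTE yl) /= => /eqP ->.
  by rewrite Normc.normc0 !mulr_ge0 ?nc_ge0// ltW.
have [i hi] := cvnorm1_large x1.
pose N := invmx M.
have hx : x i 0 = \sum_l N i l * (M *m x) l 0.
  have -> : x i 0 = (N *m (M *m x)) i 0 by rewrite mulmxA mulVmx// mul1mx.
  by rewrite mxE.
have [/existsP[l hl]|/existsPn hn] := boolP [exists l, (n%:R ^+ 2 * t)^-1 <= nc (N i l)].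
  exists l, i => w hw.
  have hwi : w i 0 = N i l * (M *m w) l 0.
    have -> : w i 0 = (N *m (M *m w)) i 0 by rewrite mulmxA mulVmx// mul1mx.
    by rewrite mxE (bigD1 l)//= big1 ?addr0// => j jl; rewrite hw// mulr0.
  rewrite hwi Normc.normcM mulrA ler_peMl ?nc_ge0//.
  by rewrite mulrC -ler_pdivrMr ?mul1r// mulr_gt0// exprn_gt0.
exfalso; suff : nc (x i 0) < n%:R^-1 by rewrite ltNge hi.
rewrite hx; apply: le_lt_trans (nc_sum _ _ _) _.
apply: (@lt_le_trans _ _ (\sum_(l < n) (n%:R ^+ 2)^-1)); last first.
  rewrite sumr_const card_ord -[leLHS]mulr_natl expr2 invfM mulrA divff ?mul1r//.
  by rewrite gt_eqF.
apply: ltr_sum => [|l _]; first by apply/hasP; exists (Ordinal n0); rewrite ?mem_index_enum.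
rewrite Normc.normcM.
have h1 := hn l; rewrite -ltNge in h1.
have h2 : nc ((M *m x) l 0) < t by apply: le_lt_trans (cvnorm_ge _ _) xt.
apply: (@le_lt_trans _ _ (nc (N i l) * t)); first by rewrite ler_wpM2l ?nc_ge0// ltW.
by rewrite -ltr_pdivlMr// -invfM.
Qed.

(** The other [n - 1] rows have a common kernel vector, scaled by its entry of largest modulus.
    Orthogonality is bilinear here, without conjugation. *)
Lemma normal_vector n (M : 'M[R[i]]_n) (l : 'I_n) : exists w : 'cV[R[i]]_n,
  [/\ forall j, j != l -> (M *m w) j 0 = 0, forall j, nc (w j 0) <= 1 & exists j, w j 0 = 1].
Proof.
have n0 : (0 < n)%N by apply: leq_ltn_trans (ltn_ord l).
have : kermx (row' l M)^T != 0.
  rewrite kermx_eq0 /row_free; apply/negP => /eqP h.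
  by have := rank_leq_col (row' l M)^T; rewrite h; lia.
case/rowV0Pn => y /sub_kermxP yM y0.
have [k yk] : exists k, y 0 k != 0.
  apply/existsP; apply: contraR y0 => /existsPn h; apply/eqP/rowP => k.
  by rewrite mxE; apply/eqP; have := h k; rewrite negbK.
have hy j : j != l -> (M *m y^T) j 0 = 0.
  move=> jl; have [j' ->] : exists j', j = lift l j'.
    have lj : l != j by rewrite eq_sym.
    by have [j' -> _] := unlift_some lj; exists j'.
  have := congr1 (fun A : 'rV_(n.-1) => A 0 j') yM; rewrite !mxE => h.
  by rewrite -[RHS]h; apply: eq_bigr => k' _; rewrite !mxE mulrC.
pose k0 := [arg max_(k' > k) nc (y 0 k')]%O.
have hk0 j : nc (y 0 j) <= nc (y 0 k0) by rewrite /k0; case: arg_maxP => // i _; exact.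
have nk0 : 0 < nc (y 0 k0) by apply: lt_le_trans (hk0 k); exact: nc_gt0.
have yk0 : y 0 k0 != 0 by apply: contraTneq nk0 => ->; rewrite Normc.normc0 ltxx.
exists ((y 0 k0)^-1 *: y^T); split.
- by move=> j jl; rewrite -scalemxAr mxE hy// mulr0.
- move=> j; rewrite !mxE Normc.normcM Normc.normcV mulrC ler_pdivrMr// mul1r.
  exact: hk0.
- by exists k0; rewrite !mxE mulVf.
Qed.

End LinearAlgebra.

(** * Independent rows *)

Section RowProbability.
Variables (R : realType) (n : nat) (s : int).

Definition prow (P : pred 'rV[bool]_n) : R := \sum_(x | P x) rowprob R s x.

Lemma rowprob_ge0 (x : 'rV[bool]_n) : 0 <= rowprob R s x.
Proof. by rewrite /rowprob; case: ifP; rewrite // invr_ge0. Qed.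

Lemma prow_total : (0 < #|Sset n s|)%N -> prow predT = 1.
Proof.
move=> S0; rewrite /prow /rowprob -big_mkcond sumr_const -[LHS]mulr_natl mulfV//.
by rewrite pnatr_eq0 -lt0n.
Qed.

Lemma le_prow (P Q : pred 'rV[bool]_n) : subpred P Q -> prow P <= prow Q.
Proof.
move=> PQ; rewrite /prow [leLHS]big_mkcond [leRHS]big_mkcond; apply: ler_sum => x _.
by case: ifP => [/PQ ->//|_]; case: ifP => // _; exact: rowprob_ge0.
Qed.

Definition rowset (x : 'rV[bool]_n) : {set 'I_n} := [set j | x 0 j].

Definition setrow (S : {set 'I_n}) : 'rV[bool]_n := \row_j (j \in S).

Lemma rowsetK : cancel rowset setrow.
Proof. by move=> x; apply/rowP => j; rewrite mxE inE. Qed.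

Lemma setrowK : cancel setrow rowset.
Proof. by move=> x; apply/setP => j; rewrite inE mxE. Qed.

Lemma rowsumE (x : 'rV[bool]_n) : rowsum x = 2 * (#|rowset x|%:Z) - n%:Z.
Proof.
rewrite /rowsum (eq_bigr (fun j => 2 * (x 0 j)%:R - 1)) => [|j _]; last by case: (x 0 j).
rewrite sumrB -mulr_sumr sumr_const card_ord -natr_sum.
rewrite -sum1_card [in RHS]big_mkcond /= -!natz; congr (2 * _%:R - _).
by apply: eq_bigr => j _; rewrite inE; case: (x 0 j).
Qed.

(** A row with [j] entries equal to 1 has sum [2 * j - n], so the sums [s - 1] and [s + 1] are two
    consecutive levels. Nonemptiness fixes the parity of [n + s], and [- n < s] rules out a lower
    level of -1. *)
Lemma Sset_level : (0 < #|Sset n s|)%N -> - n%:Z < s ->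
  exists a : nat, (2 * a + 1)%N%:Z = n%:Z + s /\
    forall x, (x \in Sset n s) = (rowset x \in @slice 'I_n a).
Proof.
move=> /card_gt0P[x0]; rewrite inE rowsumE => h sn.
have [a ha] : exists a : nat, (2 * a + 1)%N%:Z = n%:Z + s.
  case/orP: h => /eqP h; first by exists #|rowset x0|; lia.
  by exists (#|rowset x0|.-1); lia.
exists a; split=> // x; rewrite !inE rowsumE.
apply/orP/orP => -[/eqP h'|/eqP h']; [left|right|left|right]; apply/eqP; lia.
Qed.

Lemma prow_slice (a : nat) (E : pred {set 'I_n}) :
  (forall x, (x \in Sset n s) = (rowset x \in @slice 'I_n a)) ->
  prow (fun x => E (rowset x)) = #|[set S in @slice 'I_n a | E S]|%:R / #|@slice 'I_n a|%:R.
Proof.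
move=> hS.
have cS : #|Sset n s| = #|@slice 'I_n a|.
  rewrite -(card_imset _ (can_inj rowsetK)); congr #|pred_of_set _|.
  apply/setP => S; apply/imsetP/idP => [[x xS ->]|Sa]; first by rewrite -hS.
  by exists (setrow S); rewrite ?hS setrowK.
rewrite /prow /rowprob -big_mkcondr /= sumr_const -[LHS]mulr_natl cS; congr (_%:R / _).
rewrite -[LHS](card_imset _ (can_inj rowsetK)); apply: eq_card => S.
rewrite inE; apply/imsetP/andP => [[x]|[Sa ES]].
  by rewrite unfold_in => /andP[Ex xS] ->; rewrite -hS.
by exists (setrow S); rewrite ?setrowK// unfold_in hS !setrowK ES.
Qed.

Lemma prow_slice_conc (a : nat) (v : 'I_n -> R * R) (l q : R) z :
  (forall x, (x \in Sset n s) = (rowset x \in @slice 'I_n a)) -> (a <= n)%N ->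
  slice_conc v a l q -> prow (fun x => close l z (\sum_(i in rowset x) v i)) <= q.
Proof.
move=> hS an /(_ z) h; rewrite (prow_slice (fun S => close l z (\sum_(i in S) v i)) hS).
rewrite ler_pdivrMr// ltr0n card_slice card_ord addn_gt0 bin_gt0 an.
by [].
Qed.

End RowProbability.

Section MatrixProbability.
Variables (R : realType) (n : nat) (s : int).
Hypothesis S0 : (0 < #|Sset n s|)%N.
Local Notation probX := (@probX R n s).
Local Notation prow := (@prow R n s).
Local Notation rp := (@rowprob R n s).

Definition weight (X : 'M[bool]_n) : R := \prod_(i < n) rp (row i X).

Lemma weight_ge0 X : 0 <= weight X.
Proof. by apply: prodr_ge0 => i _; exact: rowprob_ge0. Qed.

Lemma sum_matrix_rows (g : 'I_n -> 'rV[bool]_n -> R) :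
  \sum_(X : 'M[bool]_n) \prod_i g i (row i X) = \prod_i \sum_x g i x.
Proof.
rewrite bigA_distr_bigA /=.
rewrite (reindex (fun f : {ffun 'I_n -> 'rV[bool]_n} => \matrix_(i, j) f i 0 j)) /=.
  apply: eq_bigr => f _; apply: eq_bigr => i _; congr (g i _).
  by apply/rowP => j; rewrite !mxE.
exists (fun X => [ffun i => row i X]) => [f _|X _].
  by apply/ffunP => i; rewrite ffunE; apply/rowP => j; rewrite !mxE.
by apply/matrixP => i j; rewrite mxE ffunE mxE.
Qed.

Lemma sum_weight : \sum_X weight X = 1.
Proof.
rewrite (sum_matrix_rows (fun _ x => rp x)) big1// => i _.
by rewrite -/(prow predT) prow_total.
Qed.

Lemma probX_le1 (E : pred 'M[bool]_n) : probX E <= 1.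
Proof.
rewrite -sum_weight /probX big_mkcond; apply: ler_sum => X _.
by case: ifP => // _; exact: weight_ge0.
Qed.

Lemma probX_union (I : finType) (E : pred 'M[bool]_n) (Ei : I -> pred 'M[bool]_n) :
  (forall X, E X -> exists i, Ei i X) -> probX E <= \sum_i probX (Ei i).
Proof.
move=> h; rewrite /probX.
rewrite (exchange_big_dep predT)//= big_mkcond; apply: ler_sum => X _.
case: ifP => [/h[i Ei_]|_]; last by rewrite sumr_ge0// => i _; exact: weight_ge0.
by rewrite (bigD1 i)//= lerDl sumr_ge0// => j _; exact: weight_ge0.
Qed.

Lemma le_probX (E E' : pred 'M[bool]_n) : subpred E E' -> probX E <= probX E'.
Proof.
move=> h; rewrite /probX [leLHS]big_mkcond [leRHS]big_mkcond; apply: ler_sum => X _.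
by case: ifP => [/h ->//|_]; case: ifP => // _; exact: weight_ge0.
Qed.

Lemma probX_rows_le (l : 'I_n) (P : 'I_n -> pred 'rV[bool]_n) (p : R) :
  (forall j, prow (P j) <= p) ->
  probX (fun X => [forall j, (j != l) ==> P j (row j X)]) <= p ^+ n.-1.
Proof.
move=> hp.
pose g j x := if (j == l) || P j x then rp x else 0.
apply: (@le_trans _ _ (\sum_(X : 'M[bool]_n) \prod_i g i (row i X))).
  rewrite /probX big_mkcond; apply: ler_sum => X _; case: ifP => [/forallP h|_]; last first.
    by apply: prodr_ge0 => i _; rewrite /g; case: ifP => // _; exact: rowprob_ge0.
  rewrite le_eqVlt; apply/orP; left; apply/eqP; apply: eq_bigr => j _; rewrite /g.
  by case: eqVneq => //= jl; have := h j; rewrite jl /= => ->.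
rewrite sum_matrix_rows (bigD1 l)//= /g eqxx /= -/(prow predT) prow_total// mul1r.
apply: (@le_trans _ _ (\prod_(i < n | i != l) p)).
  apply: ler_prod => i il; rewrite (negbTE il) /= -big_mkcond hp andbT.
  by apply: sumr_ge0 => x _; exact: rowprob_ge0.
by rewrite prodr_const cardC1 card_ord.
Qed.

Definition setrowmx (X : 'M[bool]_n) (l : 'I_n) (y : 'rV[bool]_n) : 'M[bool]_n :=
  \matrix_(i, j) (if i == l then y 0 j else X i j).

Lemma row_setrowmx X l y i : row i (setrowmx X l y) = if i == l then y else row i X.
Proof. by apply/rowP => j; rewrite !mxE; case: eqP => // _; rewrite mxE. Qed.

(* Exchanging row [l] with an independent copy [y] preserves the law of [X, y]. *)
Lemma probX_resample (l : 'I_n) (E : pred 'M[bool]_n) (rho : R) :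
  (forall X, prow (fun y => E (setrowmx X l y)) <= rho) -> probX E <= rho.
Proof.
move=> hE.
have -> : probX E = \sum_(X : 'M[bool]_n) weight X * prow (fun y => E (setrowmx X l y)).
  transitivity (\sum_(p : 'M[bool]_n * 'rV[bool]_n | E p.1) weight p.1 * rp p.2).
    rewrite [RHS](eq_bigl (fun p => E p.1 && predT p.2)); last by move=> p; rewrite andbT.
    rewrite -(pair_big E predT (fun X y => weight X * rp y)) /=; apply: eq_bigr => X _.
    by rewrite -mulr_sumr -/(prow predT) prow_total// mulr1.
  have hK : involutive (fun p : 'M[bool]_n * 'rV[bool]_n => (setrowmx p.1 l p.2, row l p.1)).
    move=> [X y] /=; congr (_, _); last by rewrite row_setrowmx eqxx.
    by apply/matrixP => i j; rewrite !mxE; case: eqP => // ->.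
  rewrite (reindex_inj (inv_inj hK)) /=.
  transitivity (\sum_(p : 'M[bool]_n * 'rV[bool]_n | E (setrowmx p.1 l p.2)) weight p.1 * rp p.2).
    apply: eq_bigr => -[X y] _ /=; rewrite /weight (bigD1 l)//= [in RHS](bigD1 l)//=.
    rewrite row_setrowmx eqxx (eq_bigr (fun i => rp (row i X))) => [|i il]; last first.
      by rewrite row_setrowmx (negbTE il).
    by rewrite mulrAC [RHS]mulrAC [rp y * _]mulrC.
  rewrite -(pair_big_dep predT (fun X y => E (setrowmx X l y)) (fun X y => weight X * rp y)) /=.
  by apply: eq_bigr => X _; rewrite -mulr_sumr.
apply: (@le_trans _ _ (\sum_X weight X * rho)); last by rewrite -mulr_suml sum_weight mul1r.
by apply: ler_sum => X _; rewrite ler_wpM2l// weight_ge0.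
Qed.

End MatrixProbability.

Section Rows.
Variables (R : realType) (n : nat) (F : 'M[R[i]]_n) (Phi : R).
Local Notation nc := (@Normc.normc R).
Hypothesis F_le : forall i j, nc (F i j) <= Phi.

Definition cplx (p : R * R) : R[i] := Complex p.1 p.2.

Definition uncplx (z : R[i]) : R * R := (complex.Re z, complex.Im z).

Definition coords (v : 'cV[R[i]]_n) (i : 'I_n) : R * R := uncplx (v i 0).

Definition rowform (x : 'rV[bool]_n) (j : 'I_n) (u : 'I_n -> R * R) : R[i] :=
  \sum_k ((if x 0 k then 1 else -1) + F j k) * cplx (u k).

Lemma rowformE X v j : ((signmx R X + F) *m v) j 0 = rowform (row j X) j (coords v).
Proof.
rewrite mxE; apply: eq_bigr => k _; rewrite !mxE; congr (_ * _).
by rewrite /cplx /coords /uncplx; case: (v k 0).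
Qed.

Lemma nc_le_sum (z : R[i]) : nc z <= `|complex.Re z| + `|complex.Im z|.
Proof.
case: z => x y /=; rewrite -[leRHS]ger0_norm ?addr_ge0// -sqrtr_sqr ler_wsqrtr//.
rewrite sqrrD !real_normK ?num_real// -addrA lerD2l addrC lerDl.
by rewrite mulrn_wge0// mulr_ge0.
Qed.

Lemma Re_le_nc (z : R[i]) : `|complex.Re z| <= nc z.
Proof. by case: z => x y /=; rewrite -sqrtr_sqr ler_wsqrtr// lerDl sqr_ge0. Qed.

Lemma Im_le_nc (z : R[i]) : `|complex.Im z| <= nc z.
Proof. by case: z => x y /=; rewrite -sqrtr_sqr ler_wsqrtr// lerDr sqr_ge0. Qed.

Lemma nc_cplx_sub d p p' : close d p p' -> nc (cplx p - cplx p') <= 2 * d.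
Proof.
move=> /andP[h1 h2]; apply: le_trans (nc_le_sum _) _.
by move: h1 h2; case: p p' => [x y] [x' y'] /=; lra.
Qed.

Lemma nc_sign (b : bool) : nc (if b then 1 else -1) = 1.
Proof. by case: b; rewrite ?normcN Normc.normc1. Qed.

Lemma nc2 : nc 2 = 2.
Proof. by have := normcMn (1 : R[i]) 2; rewrite Normc.normc1. Qed.

Lemma rowform_lip x j (u u' : 'I_n -> R * R) d : (forall k, close d (u k) (u' k)) ->
  nc (rowform x j u - rowform x j u') <= n%:R * (1 + Phi) * (2 * d).
Proof.
move=> h; rewrite -sumrB; apply: le_trans (nc_sum _ _ _) _.
rewrite -mulrA mulr_natl -[X in _ *+ X](card_ord n) -sumr_const; apply: ler_sum => k _.
rewrite -mulrBr Normc.normcM; apply: ler_pM; rewrite ?nc_ge0//; last exact: nc_cplx_sub.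
by apply: le_trans (le_normcD _ _) _; rewrite nc_sign lerD2l.
Qed.

Lemma cplxD p p' : cplx (p + p') = cplx p + cplx p'.
Proof. by case: p p' => [x y] [x' y']. Qed.

Lemma cplx_sum (I : Type) (r : seq I) (P : pred I) (f : I -> R * R) :
  cplx (\sum_(i <- r | P i) f i) = \sum_(i <- r | P i) cplx (f i).
Proof. exact: (big_morph _ cplxD). Qed.

(** A sign vector is twice an indicator minus 1, so the form is twice the subset sum minus a
    quantity independent of [x]. *)
Lemma rowform_close x j (u : 'I_n -> R * R) e : nc (rowform x j u) <= e ->
  close (e / 2) (uncplx ((\sum_k cplx (u k) - \sum_k F j k * cplx (u k)) / 2))
    (\sum_(i in rowset x) u i).
Proof.
move=> h.
have E : rowform x j u = 2 * cplx (\sum_(i in rowset x) u i) -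
    (\sum_k cplx (u k) - \sum_k F j k * cplx (u k)).
  rewrite cplx_sum /rowform opprB addrA mulr_sumr [in RHS]big_mkcond -[in RHS]big_split -sumrB.
  apply: eq_bigr => k _; rewrite mulrDl inE.
  by case: (x 0 k) => /=; ring.
set A := (\sum_(i in _) _) in E *; set B := \sum_k _ - _ in E *; clearbody A B.
have {}h : nc (B / 2 - cplx A) <= e / 2.
  have -> : B / 2 - cplx A = - (rowform x j u / 2).
    by rewrite E mulrBl [2 * cplx A]mulrC mulfK ?opprB// pnatr_eq0.
  rewrite normcN Normc.normcM Normc.normcV.
  rewrite nc2.
  by rewrite ler_wpM2r// invr_ge0.
have h1 := le_trans (Re_le_nc _) h; have h2 := le_trans (Im_le_nc _) h.
by rewrite /close /uncplx; move: h1 h2; case: (B / 2) => p q; case: A {E h} => p' q' /= -> ->.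
Qed.

Lemma prow_rowform_le (s : int) (a : nat) j (u u' : 'I_n -> R * R) (l q d e : R) :
  (forall x, (x \in Sset n s) = (rowset x \in @slice 'I_n a)) -> (a <= n)%N ->
  (forall k, close d (u' k) (u k)) -> (e + n%:R * (1 + Phi) * (2 * d)) / 2 <= l ->
  slice_conc u' a l q -> prow R s (fun x => nc (rowform x j u) <= e) <= q.
Proof.
move=> hS an hu hl hc.
pose z := uncplx ((\sum_k cplx (u' k) - \sum_k F j k * cplx (u' k)) / 2).
apply: le_trans (prow_slice_conc z hS an hc); apply: le_prow => x hx.
apply: (closeW hl); apply: rowform_close.
have -> : rowform x j u' = rowform x j u + (rowform x j u' - rowform x j u) by ring.
by apply: le_trans (le_normcD _ _) _; rewrite lerD// rowform_lip.
Qed.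

(** For each [S] of size [a] avoiding [i0], one of [S] and [i0 |: S] violates [E], and different [S]
    give different violators. *)
Lemma card_slice_flip (a : nat) (i0 : 'I_n) (E : pred {set 'I_n}) : (a < n)%N ->
  (forall S : {set 'I_n}, i0 \notin S -> E S -> E (i0 |: S) -> False) ->
  (#|[set S in @slice 'I_n a | E S]| + 'C(n.-1, a) <= #|@slice 'I_n a|)%N.
Proof.
move=> an hE.
have -> : 'C(n.-1, a) = #|[set S : {set 'I_n} | S \subset [set~ i0] & #|S| == a]|.
  by rewrite cards_draws cardsC1 card_ord.
pose h (S : {set 'I_n}) := if E S then i0 |: S else S.
rewrite -(card_in_imset (f := h)); last first.
  move=> S S'; rewrite !inE => /andP[/subsetP hS _] /andP[/subsetP hS' _].
  have nS : i0 \notin S by apply/negP => /hS; rewrite !inE eqxx.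
  have nS' : i0 \notin S' by apply/negP => /hS'; rewrite !inE eqxx.
  rewrite /h; case: ifP => _; case: ifP => _ //.
  - by move=> /(congr1 (fun A => A :\ i0)); rewrite !setU1K.
  - by move=> e; move: nS'; rewrite -e setU11.
  - by move=> e; move: nS; rewrite e setU11.
rewrite -cardsUI [X in (_ + X)%N](_ : _ = 0%N) ?addn0; last first.
  apply/eqP; rewrite cards_eq0; apply/eqP/setP => S; rewrite !inE; apply/negP.
  case/andP => /andP[_ ES] /imsetP[S']; rewrite inE => /andP[/subsetP hS' _].
  have nS' : i0 \notin S' by apply/negP => /hS'; rewrite !inE eqxx.
  rewrite /h; case: ifP => ES' e; last by rewrite e ES' in ES.
  by apply: (hE S') => //; rewrite -e.
apply: subset_leq_card; apply/subsetP => S; rewrite inE => /orP[|/imsetP[S']].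
  by rewrite inE => /andP[].
rewrite inE => /andP[/subsetP hS' /eqP cS'] ->.
have nS' : i0 \notin S' by apply/negP => /hS'; rewrite !inE eqxx.
by rewrite /h; case: ifP => _; rewrite inE ?cardsU1 ?nS' cS' ?eqxx ?orbT.
Qed.

(** Adding [i0] to the set moves the form by [2 * u i0], of modulus above [2 * e], so both values
    cannot be small. The proportion ['C(n.-1, a) / 'C(n.+1, a.+1)] equals
    [(a + 1) * (n - a) / ((n + 1) * n)], whence the condition on [kap]. *)
Lemma prow_flip (s : int) (a : nat) j (u : 'I_n -> R * R) (i0 : 'I_n) (e kap : R) :
  (forall x, (x \in Sset n s) = (rowset x \in @slice 'I_n a)) -> (a < n)%N ->
  e < nc (cplx (u i0)) -> kap * (n%:R + 1) * n%:R <= (a%:R + 1) * (n%:R - a%:R) ->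
  prow R s (fun x => nc (rowform x j u) <= e) <= 1 - kap.
Proof.
move=> hS an hu hk.
pose E (S : {set 'I_n}) := nc (rowform (setrow S) j u) <= e.
have := prow_slice R E hS.
have -> : prow R s (fun x => E (rowset x)) = prow R s (fun x => nc (rowform x j u) <= e).
  by apply: eq_bigl => x; rewrite /E rowsetK.
move=> ->.
have hE (S : {set 'I_n}) : i0 \notin S -> E S -> E (i0 |: S) -> False.
  rewrite /E => nS h1 h2.
  have e1 : rowform (setrow (i0 |: S)) j u - rowform (setrow S) j u = 2 * cplx (u i0).
    rewrite -sumrB (bigD1 i0)//= big1 ?addr0 => [|k ki0].
      by rewrite !mxE setU11 (negbTE nS); ring.
    by rewrite !mxE !inE (negbTE ki0) /= subrr.
  have : nc (2 * cplx (u i0)) <= e + e.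
    by rewrite -e1; apply: le_trans (le_normcD _ _) _; rewrite normcN lerD.
  rewrite Normc.normcM nc2.
  by rewrite mulr2n; lra.
have := card_slice_flip an hE; rewrite -(ler_nat R) natrD => h1.
have n0 : (0 < n)%N by apply: leq_ltn_trans an.
have sE : ((n.+1 * n) * 'C(n.-1, a) = (a.+1 * (n - a)) * #|@slice 'I_n a|)%N.
  rewrite card_slice card_ord addnC -binS.
  rewrite -mulnA mul_bin_down mulnCA mul_bin_diag; ring.
have s0 : 0 < #|@slice 'I_n a|%:R :> R.
  by rewrite ltr0n card_slice card_ord addn_gt0 bin_gt0 ltnW.
rewrite ler_pdivrMr//.
have n0' : 0 < n%:R :> R by rewrite ltr0n.
have : kap * #|@slice 'I_n a|%:R <= 'C(n.-1, a)%:R :> R.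
  move/(congr1 (fun x => x%:R : R)): sE; rewrite !natrM -!natr1 natrB ?(ltnW an)// => sE.
  have nn0 : 0 < (n%:R + 1) * n%:R :> R by rewrite mulr_gt0// ltr_wpDl.
  rewrite -(ler_pM2l nn0) sE mulrCA mulrA ler_wpM2r ?(ltW s0)// mulrC.
  by rewrite mulrC mulrA.
by rewrite mulrBl mul1r; lra.
Qed.

End Rows.

(** * Compressible and structured normal vectors *)

Section Events.
Variables (R : realType) (n : nat) (s : int) (F : 'M[R[i]]_n) (Phi : R) (a : nat).
Local Notation nc := (@Normc.normc R).
Hypothesis F_le : forall i j, nc (F i j) <= Phi.
Hypothesis S0 : (0 < #|Sset n s|)%N.
Hypothesis hS : forall x, (x \in Sset n s) = (rowset x \in @slice 'I_n a).
Hypothesis an : (a < n)%N.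
Local Notation probX := (@probX R n s).
Local Notation prow := (@prow R n s).

Definition normal (X : 'M[bool]_n) (l : 'I_n) (v : 'cV[R[i]]_n) : Prop :=
  [/\ forall j, j != l -> ((signmx R X + F) *m v) j 0 = 0,
      forall j, nc (v j 0) <= 1 & exists j, v j 0 = 1].

Lemma coords_le1 (v : 'cV[R[i]]_n) i : nc (v i 0) <= 1 -> close 1 0 (coords v i).
Proof.
move=> h; rewrite /close !sub0r !normrN.
by rewrite !(le_trans _ h) ?Re_le_nc ?Im_le_nc.
Qed.

(** A normal vector is annihilated exactly by the rows other than [l], so a net point within [d] of
    it nearly is. A union bound over the net and independence of these [n - 1] rows finish. *)
Lemma probX_net (l : 'I_n) (Bad : 'cV[R[i]]_n -> Prop) (A : finType)
    (asg : A -> 'I_n -> R * R) (N : {set A}) (d p : R) : 0 <= p ->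
  (forall X v, normal X l v -> Bad v ->
     exists2 g, g \in N & forall k, close d (coords v k) (asg g k)) ->
  (forall g, g \in N -> forall j,
     prow (fun x => nc (rowform F x j (asg g)) <= n%:R * (1 + Phi) * (2 * d)) <= p) ->
  probX (fun X => `[< exists2 v, normal X l v & Bad v >]) <= #|N|%:R * p ^+ n.-1.
Proof.
move=> p0 hB hN; pose eta := n%:R * (1 + Phi) * (2 * d).
pose Eg g X := (g \in N) && [forall j, (j != l) ==> (nc (rowform F (row j X) j (asg g)) <= eta)].
have hU X : `[< exists2 v, normal X l v & Bad v >] -> exists g, Eg g X.
  move=> /asboolP[v nv bv]; have [g gN hg] := hB X v nv bv.
  exists g; rewrite /Eg gN; apply/forallP => j; apply/implyP => jl.
  have [h _ _] := nv; have := h j jl; rewrite rowformE => h0.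
  rewrite -[rowform _ _ _ _]subr0 -h0; apply: (rowform_lip F_le) => k.
  by rewrite close_sym.
apply: le_trans (probX_union R s (Ei := Eg) hU) _.
rewrite mulr_natl -sumr_const [leRHS]big_mkcond /=; apply: ler_sum => g _.
case: ifP => gN; last by rewrite /probX big_pred0// => X; rewrite /Eg gN.
apply: le_trans (probX_rows_le S0 l (P := fun j x => nc (rowform F x j (asg g)) <= eta) (hN g gN)).
by apply: le_probX => X /andP[].
Qed.

Definition almost_constant (M s1 : nat) (v : 'cV[R[i]]_n) : Prop :=
  exists i, (#|far (coords v) M%:R^-1 i| < s1)%N.

(** Listed positions carry listed grid values; all others get the common value [p.2], as the default
    of [nth] when [index] runs past the end. *)
Definition patch (M s1 : nat) (p : s1.-tuple 'I_n * s1.-tuple (grid M) * grid M) (k : 'I_n) : R * R :=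
  gval R (nth p.2 p.1.2 (index k p.1.1)).

Lemma almost_constant_patch (M s1 : nat) (v : 'cV[R[i]]_n) : (0 < M)%N ->
  (forall j, nc (v j 0) <= 1) -> almost_constant M s1 v ->
  exists p, forall k, close (2 / M%:R) (coords v k) (@patch M s1 p k).
Proof.
move=> M0 v1 [i hi].
have g1 k : close M%:R^-1 (coords v k) (gval R (ground M (coords v k))).
  by apply: ground_close => //; exact: coords_le1.
(* Copies of [i] pad the list of far coordinates to length exactly [s1]; they carry the correct
   value of coordinate [i]. *)
pose t := enum (far (coords v) M%:R^-1 i) ++ nseq (s1 - #|far (coords v) M%:R^-1 i|) i.
have ht : size t == s1 by rewrite size_cat -cardE size_nseq subnKC// ltnW.
pose T := Tuple ht.
exists ((T, [tuple of map (fun k => ground M (coords v k)) T]), ground M (coords v i)) => k.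
have M0' : 0 <= M%:R^-1 :> R by rewrite invr_ge0.
rewrite /patch /=; case: (boolP (k \in t)) => kt.
  rewrite (nth_map k) ?index_mem// nth_index//.
  by apply: closeW (g1 k); lra.
rewrite nth_default ?size_map ?memNindex//.
have : k \notin far (coords v) M%:R^-1 i by move: kt; rewrite mem_cat mem_enum negb_or => /andP[].
rewrite inE negbK close_sym => h; rewrite mulr_natl mulr2n.
exact: close_trans h (g1 i).
Qed.

(** The coordinate equal to 1 stays above the allowed error after rounding, so flipping it applies
    to every net point used. The exponent [s1.+1] counts [s1] exceptional values and the common
    one. *)
Lemma probX_almost_constant (l : 'I_n) (M s1 : nat) (kap : R) : (0 < M)%N -> kap <= 1 ->
  n%:R * (1 + Phi) * (2 * (2 / M%:R)) + 2 / M%:R < 1 ->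
  kap * (n%:R + 1) * n%:R <= (a%:R + 1) * (n%:R - a%:R) ->
  probX (fun X => `[< exists2 v, normal X l v & almost_constant M s1 v >]) <=
    (n ^ s1 * ((2 * M).+1 ^ 2) ^ s1.+1)%:R * (1 - kap) ^+ n.-1.
Proof.
move=> M0 k1 hM hk; set d := 2 / M%:R in hM.
pose N := [set p | [forall j, prow (fun x => nc (rowform F x j (@patch M s1 p)) <=
  n%:R * (1 + Phi) * (2 * d)) <= 1 - kap]].
apply: le_trans (@probX_net l _ _ (@patch M s1) N d (1 - kap) _ _ _) _.
- by rewrite subr_ge0.
- move=> X v [nv v1 [i0 vi0]] bv.
  have [p hp] := almost_constant_patch M0 v1 bv.
  exists p => //; rewrite inE; apply/forallP => j.
  apply: (prow_flip F (i0 := i0) j hS an _ hk).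
  apply: lt_le_trans (Re_le_nc _).
  have /andP[h _] := hp i0; move: h; rewrite {1}/coords vi0 /=.
  rewrite ler_norml => /andP[_ h]; apply: lt_le_trans (ler_norm _).
  by rewrite -/d in h; lra.
- by move=> g; rewrite inE => /forallP.
rewrite ler_wpM2r ?exprn_ge0 ?subr_ge0// ler_nat (leq_trans (max_card _))//.
by rewrite !card_prod !card_tuple !card_prod !card_ord mulnn -mulnA -expnSr.
Qed.

(** The mesh [1 / M] lies between the two scales: coarse enough for collisions at scale
    [2 ^+ m * llo] to survive rounding, fine enough that near orthogonality to a grid point is still
    governed by the concentration at scale [lhi]. *)
Lemma probX_structured (l : 'I_n) (M s0 b k m : nat) (lhi llo rhi rlo q : R) :
  (0 < M)%N -> (0 < k)%N -> (s0 <= n)%N -> 0 < q -> 0 < llo -> 0 <= rhi ->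
  (2 * (2 * k * 3 ^ m) ^ 2 <= b)%N ->
  (forall w, (s0 <= w <= n)%N -> tail_ok n w a b && tail_ok n w (n - a.+1) b) ->
  4 * (2 ^+ b)^-1 <= rlo -> rlo <= (1 - 10 ^- 6) ^+ m ->
  (forall j, (s0 <= j <= n)%N ->
    q * j%:R ^+ (2 * k) + (k ^ k * j ^ k)%:R <=
    rlo / 64 * ((1 - 10 ^- 6) ^+ m)^-1 * b%:R ^+ (2 * k)) ->
  2 ^+ m * llo <= M%:R^-1 -> n%:R * (1 + Phi) * (2 / M%:R) <= lhi ->
  probX (fun X => `[< exists2 v, normal X l v & slice_conc (coords v) a lhi rhi /\
      ~ slice_conc (coords v) a llo rlo >]) <=
    ((2 * M).+1 ^ 2)%:R ^+ s0 * (((4 * k + 3) ^ 2)%:R / q) ^+ (n - s0) * rhi ^+ n.-1.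
Proof.
move=> M0 k0 sn q0 llo0 rhi0 hb ht hlo hm hq hlM hhi.
pose asg (g : {ffun 'I_n -> grid M}) i := gval R (g i).
(* The per-row bound is built into the net; rounded vectors satisfy it because they inherit it from
   the concentration of the original at [lhi]. *)
pose N := [set g in @grid_structured R 'I_n M k s0 q |
  [forall j, prow (fun x => nc (rowform F x j (asg g)) <= n%:R * (1 + Phi) * (2 * M%:R^-1)) <= rhi]].
apply: le_trans (@probX_net l _ _ asg N M%:R^-1 rhi rhi0 _ _) _.
- move=> X v [nv v1 _] [chi clo].
  have hc i : close M%:R^-1 (coords v i) (asg [ffun i => ground M (coords v i)] i).
    by rewrite /asg ffunE; apply: ground_close => //; exact: coords_le1.
  exists [ffun i => ground M (coords v i)] => //.
  rewrite inE; apply/andP; split.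
    apply: (@ground_structured R 'I_n M M0 k (coords v) s0 q (2 ^+ m * llo)) => //.
      by move=> i; exact: coords_le1.
    move=> J sJ; have Jn : (#|J| <= n)%N by rewrite -[leqRHS](card_ord n) max_card.
    have /andP[t1 t2] : tail_ok n #|J| a b && tail_ok n #|J| (n - a.+1) b by rewrite ht ?sJ.
    apply: le_trans (hq _ _) _; first by rewrite sJ.
    by apply: many_collisions clo; rewrite ?card_ord.
  apply/forallP => j.
  apply: (prow_rowform_le F_le (u' := coords v) j hS (ltnW an) hc _ chi).
  by apply: le_trans hhi; rewrite le_eqVlt; apply/orP; left; apply/eqP; field; rewrite pnatr_eq0 -lt0n.
- by move=> g; rewrite inE => /andP[_ /forallP].
rewrite ler_wpM2r ?exprn_ge0//.
have := @card_grid_structured R 'I_n M M0 k l s0 q q0; rewrite card_ord => /(_ sn).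
apply: le_trans; rewrite ler_nat; apply: subset_leq_card.
by apply/subsetP => g; rewrite inE => /andP[].
Qed.

(** A normal vector found for [X] remains normal when row [l] is resampled, so its concentration can
    be applied to an independent row. *)
Lemma probX_last_row (l : 'I_n) (lam rho t : R) : 0 <= rho -> n%:R ^+ 2 * t / 2 <= lam -> 0 <= t ->
  probX (fun X => `[< (exists i, forall w : 'cV[R[i]]_n,
      (forall j, j != l -> ((signmx R X + F) *m w) j 0 = 0) ->
      nc (((signmx R X + F) *m w) l 0) <= n%:R ^+ 2 * t * nc (w i 0)) /\
    (forall v, normal X l v -> slice_conc (coords v) a lam rho) >]) <= rho.
Proof.
move=> rho0 hl t0; apply: (probX_resample S0 (l := l)) => X.
have [v nv] : exists v, normal X l v := normal_vector (signmx R X + F) l.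
have nvy y : normal (setrowmx X l y) l v.
  have [h1 h2 h3] := nv; split=> // j jl.
  by have := h1 j jl; rewrite !rowformE row_setrowmx (negbTE jl).
have [hc|hc] := pselect (slice_conc (coords v) a lam rho); last first.
  rewrite /prow big_pred0// => y; apply/asboolP => -[_ h]; exact: hc (h v (nvy y)).
apply: le_trans (prow_rowform_le F_le (u' := coords v) (u := coords v) (d := 0)
  (e := n%:R ^+ 2 * t) l hS (ltnW an) _ _ hc).
- apply: le_prow => y /asboolP[[i hi] _].
  have [h1 h2 h3] := nvy y.
  have := hi v h1; rewrite rowformE row_setrowmx eqxx => h.
  apply: le_trans h _; rewrite ler_piMr//.
  by rewrite mulr_ge0// exprn_ge0.
- by move=> k; exact: closexx.
- by rewrite !mulr0 addr0.
Qed.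

(** If no normal vector for row [l] is almost constant or stagnates at one of the [J] steps, the
    concentration descends from [lam 0] to [lam J] and the resampled row settles the matter. The
    factor [n] is the union over [l]. *)
Lemma probX_sigma_min (lam rho : nat -> R) (J : nat) (M1 s1 : nat) (t e1 e2 : R) :
  0 < t -> 0 <= rho J -> n%:R ^+ 2 * t / 2 <= lam J ->
  (forall v : 'cV[R[i]]_n, ~ almost_constant M1 s1 v -> slice_conc (coords v) a (lam 0%N) (rho 0%N)) ->
  (forall l, probX (fun X => `[< exists2 v, normal X l v & almost_constant M1 s1 v >]) <= e1) ->
  (forall l j, (j < J)%N -> probX (fun X => `[< exists2 v, normal X l v &
     slice_conc (coords v) a (lam j) (rho j) /\ ~ slice_conc (coords v) a (lam j.+1) (rho j.+1) >]) <= e2) ->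
  probX (fun X => sigma_min (signmx R X + F) < t) <= n%:R * (e1 + (J%:R * e2 + rho J)).
Proof.
move=> t0 rJ hl h0 h1 h2.
have n0 : (0 < n)%N by apply: leq_ltn_trans an.
pose B1 l X := `[< exists2 v, normal X l v & almost_constant M1 s1 v >].
pose B2 l j X := `[< exists2 v, normal X l v &
     slice_conc (coords v) a (lam j) (rho j) /\ ~ slice_conc (coords v) a (lam j.+1) (rho j.+1) >].
pose G l X := `[< (exists i, forall w : 'cV[R[i]]_n,
      (forall j, j != l -> ((signmx R X + F) *m w) j 0 = 0) ->
      nc (((signmx R X + F) *m w) l 0) <= n%:R ^+ 2 * t * nc (w i 0)) /\
    (forall v, normal X l v -> slice_conc (coords v) a (lam J) (rho J)) >].
pose E (c : 'I_n * ('I_J + bool)) : pred 'M[bool]_n := match c.2 with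
  | inl j => B2 c.1 j | inr true => B1 c.1 | inr false => G c.1 end.
have hU X : sigma_min (signmx R X + F) < t -> exists c, E c X.
  move=> /(sigma_min_small n0)[l [i hi]].
  have [b1|nb1] := boolP (B1 l X); first by exists (l, inr true).
  have [/existsP[j bj]|/existsPn nb2] := boolP [exists j : 'I_J, B2 l j X].
    by exists (l, inl j).
  exists (l, inr false); apply/asboolP; split; first by exists i.
  move=> v nv.
  suff : forall j, (j <= J)%N -> slice_conc (coords v) a (lam j) (rho j) by apply.
  elim=> [_|j IH jJ].
    by apply: h0 => bv; move/asboolP: nb1; apply; exists v.
  have [//|nc'] := pselect (slice_conc (coords v) a (lam j.+1) (rho j.+1)).
  exfalso; have := nb2 (Ordinal jJ); move/asboolP; apply; exists v => //.
  by split=> //; apply: IH; exact: ltnW.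
apply: le_trans (probX_union R s (Ei := E) hU) _.
rewrite -(pair_big predT predT (fun l o => probX (E (l, o)))) /=.
rewrite mulr_natl -[X in _ *+ X](card_ord n) -sumr_const; apply: ler_sum => l _.
rewrite big_sumType big_bool /= addrCA lerD//; first exact: h1.
rewrite lerD//; last by apply: probX_last_row => //; exact: ltW.
rewrite mulr_natl -[X in _ *+ X](card_ord J) -sumr_const; apply: ler_sum => j _.
exact: h2.
Qed.

End Events.

(** * Choice of parameters *)

Section Growth.
Variable R : realType.

Definition ev (P : nat -> Prop) := exists m0, forall m, (m0 <= m)%N -> P m.

Lemma ev_and (P Q : nat -> Prop) : ev P -> ev Q -> ev (fun m => P m /\ Q m).
Proof.
move=> [p hp] [q hq]; exists (maxn p q) => m; rewrite geq_max => /andP[pm qm].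
by split; [exact: hp|exact: hq].
Qed.

Lemma ev_ge (k : nat) : ev (fun m => (k <= m)%N).
Proof. by exists k. Qed.

Lemma ev_imp (P Q : nat -> Prop) : (forall m, P m -> Q m) -> ev P -> ev Q.
Proof. by move=> h [p hp]; exists p => m /hp /h. Qed.

Lemma bernoulli (w : R) m : 1 <= w -> 1 + m%:R * (w - 1) <= w ^+ m.
Proof.
move=> w1; elim: m => [|m IH]; first by rewrite mul0r addr0.
rewrite exprS -natr1; have m0 : 0 <= m%:R :> R by [].
have : 0 <= m%:R * (w - 1) ^+ 2 by rewrite mulr_ge0// sqr_ge0.
nra.
Qed.

(** With [y / x = w ^ 2], Bernoulli makes [w ^+ m] grow at least linearly; its square then exceeds
    [m + 1] by a further linear factor that absorbs [K]. *)
Lemma ev_exp (K x y : R) : 0 <= K -> 0 < x -> x < y ->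
  ev (fun m => K * m.+1%:R * x ^+ m <= y ^+ m).
Proof.
move=> K0 x0 xy; pose z := y / x.
have z1 : 1 < z by rewrite ltr_pdivlMr// mul1r.
pose w := Num.sqrt z.
have w2 : w ^+ 2 = z by rewrite sqr_sqrtr//; apply: ltW; apply: lt_trans z1.
have w0 : 0 <= w := sqrtr_ge0 z.
have w1 : 1 < w by rewrite ltNge; apply/negP => h; nra.
pose c := Num.min 1 (w - 1).
have c0 : 0 < c by rewrite lt_min ltr01 subr_gt0.
have [p hp] : exists p : nat, K / c ^+ 2 <= p%:R.
  exists (Num.trunc (K / c ^+ 2)).+1; exact: ltW (truncnS_gt _).
exists p => m pm.
have -> : y ^+ m = z ^+ m * x ^+ m by rewrite -exprMn /z divfK// gt_eqF.
rewrite ler_wpM2r ?exprn_ge0 ?(ltW x0)//.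
have hb : c * m.+1%:R <= w ^+ m.
  apply: le_trans (bernoulli m (ltW w1)).
  have h1 : c <= 1 by rewrite ge_min lexx.
  have h2 : c <= w - 1 by rewrite ge_min lexx orbT.
  rewrite -natr1; have m0 : 0 <= m%:R :> R by [].
  nra.
have : (c * m.+1%:R) ^+ 2 <= z ^+ m.
  by rewrite -w2 -!exprM mulnC exprM lerXn2r ?nnegrE// ?mulr_ge0 ?exprn_ge0// ltW.
move=> hz; apply: le_trans hz; rewrite exprMn [m.+1%:R ^+ 2]expr2 mulrA ler_wpM2r//.
rewrite mulrC -ler_pdivrMr ?exprn_gt0//; apply: le_trans hp _.
by rewrite ler_nat leqW.
Qed.

Lemma ev_exp_const (K x y : R) : 0 <= K -> 0 < x -> x < y -> ev (fun m => K * x ^+ m <= y ^+ m).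
Proof.
move=> K0 x0 xy; apply: ev_imp (ev_exp K0 x0 xy) => m; apply: le_trans.
by rewrite ler_wpM2r ?exprn_ge0 ?(ltW x0)// ler_peMr// ler1n.
Qed.

Lemma ev_exp_poly (K x : R) (c : nat) : 0 <= K -> 0 < x -> x < 1 ->
  ev (fun n => K * n%:R ^+ c * x ^+ n <= 1).
Proof.
move=> K0; elim: c x => [|c IH] x x0 x1.
  by apply: ev_imp (ev_exp_const K0 x0 x1) => m; rewrite mulr1 expr1n.
pose y := (x + 1) / 2.
have xy : x < y by rewrite /y; lra.
have y0 : 0 < y := lt_trans x0 xy.
have y1 : y < 1 by rewrite /y; lra.
apply: ev_imp (ev_and (IH y y0 y1) (ev_exp ler01 x0 xy)) => n [h1 h2].
apply: le_trans h1; rewrite exprSr -!mulrA ler_wpM2l// ler_wpM2l ?exprn_ge0//.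
by apply: le_trans h2; rewrite mul1r ler_wpM2r ?exprn_ge0 ?(ltW x0)// ler_nat.
Qed.

Lemma exists_pow_le (x c : R) : 0 < x -> x < 1 -> 0 < c -> exists j : nat, x ^+ j <= c.
Proof.
move=> x0 x1 c0; have Kc : 0 <= c^-1 by rewrite invr_ge0 ltW.
have [j hj] := ev_exp_const Kc x0 x1.
exists j; have := hj j (leqnn j); rewrite expr1n.
by rewrite mulrC ler_pdivrMr// mul1r.
Qed.

Lemma exists_nat_ge (x : R) : exists j : nat, x <= j%:R.
Proof. by exists (Num.trunc x).+1; exact: ltW (truncnS_gt _). Qed.

End Growth.

Lemma tail_okP n w a b e : (0 < e)%N -> (n <= e * a)%N -> (16 * b * e <= w)%N -> (4 * b <= a)%N ->
  tail_ok n w a b.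
Proof.
move=> e0 na bw ba; rewrite /tail_ok.
have h1 : (4 * b <= w)%N by nia.
apply/and3P; split; [lia|lia|].
have h2 : (w <= 2 * (w - 2 * b))%N by lia.
have h3 : (a <= 2 * (a - 2 * b))%N by lia.
have h4 : (w * a <= 4 * ((w - 2 * b) * (a - 2 * b)))%N.
  by rewrite (_ : 4 * _ = (2 * (w - 2 * b)) * (2 * (a - 2 * b)))%N ?leq_mul//; ring.
have h5 : (16 * b * e * a <= w * a)%N by rewrite leq_mul2r bw orbT.
have h6 : (16 * b * n <= 16 * b * (e * a))%N by rewrite leq_mul2l na orbT.
move: h4 h5 h6; rewrite -!mulnA; move: (_ * (_ - _))%N (w * a)%N (b * n)%N (b * (e * a))%N; lia.
Qed.

(** * Structured normal vectors: the numerical comparison *)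

Section StructuredBound.
Variables (R : realType) (n : nat) (s : int) (F : 'M[R[i]]_n) (Phi : R) (a : nat).
Hypothesis F_le : forall i j, Normc.normc (F i j) <= Phi.
Hypothesis S0 : (0 < #|Sset n s|)%N.
Hypothesis hS : forall x, (x \in Sset n s) = (rowset x \in @slice 'I_n a).
Hypothesis an : (a < n)%N.

Definition gain : R := 1 - 10 ^- 6.
(** The improvement per tripling demanded before a vector counts as stagnant. The margin
    [gain <= loss ^+ 3] leaves two spare factors [loss ^+ m], one for constants and one for the free
    coordinates. *)
Definition loss : R := 1 - 2 * 10 ^- 7.

Lemma gain_gt0 : 0 < gain. Proof. by rewrite /gain; lra. Qed.
Lemma loss_gt0 : 0 < loss. Proof. by rewrite /loss; lra. Qed.
Lemma loss_lt1 : loss < 1. Proof. by rewrite /loss; lra. Qed.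
Lemma gain_le_loss : gain <= loss ^+ 3.
Proof. by rewrite /gain /loss; lra. Qed.

(** A solved coordinate has at most [K / q] values and a row contributes [rhi]; their product is a
    constant times [(gain / loss) ^+ m <= loss ^+ (2 * m)]. One [loss ^+ m] brings the constant down
    to 1/2. The other, collected over at least [D * s0] coordinates, pays for the [s0] free ones at
    [Y ^+ m] values each. *)
Lemma structured_bound (l : 'I_n) (M s0 b k m D Q : nat) (lhi llo rhi Y : R) :
  (0 < M)%N -> (0 < k)%N -> (0 < s0)%N -> (0 < Q)%N -> (s0 * D.+1 <= n)%N -> 0 < llo ->
  0 < rhi -> rhi <= 1 -> (n <= 2 * Q * b)%N ->
  (2 * (2 * k * 3 ^ m) ^ 2 <= b)%N ->
  (forall w, (s0 <= w <= n)%N -> tail_ok n w a b && tail_ok n w (n - a.+1) b) ->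
  4 * (2 ^+ b)^-1 <= rhi * loss ^+ m -> rhi * loss ^+ m <= gain ^+ m ->
  (k ^ k * n ^ k)%:R <= rhi * loss ^+ m / 128 * (gain ^+ m)^-1 * b%:R ^+ (2 * k) ->
  2 ^+ m * llo <= M%:R^-1 -> n%:R * (1 + Phi) * (2 / M%:R) <= lhi ->
  ((2 * M).+1 ^ 2)%:R <= Y ^+ m -> 0 <= Y -> Y * loss ^+ D <= 1 ->
  ((4 * k + 3) ^ 2)%:R * 128 * (2 * Q)%:R ^+ (2 * k) * loss ^+ m <= 1 / 2 ->
  probX R s (fun X => `[< exists2 v, normal F X l v & slice_conc (coords v) a lhi rhi /\
      ~ slice_conc (coords v) a llo (rhi * loss ^+ m) >]) <= (1 / 2) ^+ (n - s0).
Proof.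
move=> M0 k0 s00 Q0 sD llo0 rhi0 rhi1 nQ hb ht hlo hm hk hlM hhi hY Y0 hYD hC.
set rlo := rhi * loss ^+ m in hlo hm hk *.
have g0 : 0 < gain ^+ m by rewrite exprn_gt0// gain_gt0.
have lm0 : 0 < loss ^+ m by rewrite exprn_gt0// loss_gt0.
have rlo0 : 0 < rlo by rewrite mulr_gt0.
have Q0' : 0 < (2 * Q)%:R ^+ (2 * k) :> R by rewrite exprn_gt0// ltr0n muln_gt0.
(* Half of the guaranteed [rlo / 64] is reserved for trivial patterns, and [(2 * Q) ^ (2 * k)]
   converts powers of [b] into powers of [n <= 2 * Q * b]. *)
pose q := rlo / 128 * (gain ^+ m)^-1 / (2 * Q)%:R ^+ (2 * k).
have q0 : 0 < q by rewrite !(divr_gt0, mulr_gt0)// invr_gt0.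
have sn : (s0 <= n)%N by apply: leq_trans sD; rewrite leq_pmulr.
apply: le_trans (probX_structured F_le S0 hS an l M0 k0 sn q0 llo0 (ltW rhi0) hb ht hlo hm _ hlM hhi) _.
  move=> j /andP[_ jn].
  have -> : rlo / 64 / gain ^+ m * b%:R ^+ (2 * k) =
    rlo / 128 * (gain ^+ m)^-1 * b%:R ^+ (2 * k) + rlo / 128 * (gain ^+ m)^-1 * b%:R ^+ (2 * k).
    by field; rewrite gt_eqF.
  apply: lerD; last by apply: le_trans hk; rewrite ler_nat leq_mul2l leq_exp2r// jn orbT.
  rewrite /q; set c := rlo / 128 * (gain ^+ m)^-1.
  have c0 : 0 < c by rewrite mulr_gt0 ?divr_gt0// invr_gt0.
  rewrite mulrAC -mulrA ler_wpM2l ?(ltW c0)//.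
  rewrite ler_pdivrMr// -exprMn -natrM lerXn2r ?nnegrE// ler_nat mulnC.
  exact: leq_trans nQ.
set K : R := ((4 * k + 3) ^ 2)%:R in hC *.
have hr : rhi ^+ n.-1 <= rhi ^+ (n - s0).
  by apply: (ler_wiXn2l (ltW rhi0) rhi1); rewrite -subn1 leq_sub2l.
have V0 : 0 <= ((2 * M).+1 ^ 2)%:R ^+ s0 :> R by rewrite exprn_ge0.
have Kq0 : 0 <= K / q by rewrite divr_ge0// ltW.
apply: (@le_trans _ _ ((Y ^+ m) ^+ s0 * (K / q * rhi) ^+ (n - s0))).
  rewrite [(K / q * rhi) ^+ _]exprMn mulrA; apply: ler_pM => //.
  - by rewrite mulr_ge0// exprn_ge0.
  - by rewrite exprn_ge0// ltW.
  - by rewrite ler_wpM2r ?exprn_ge0// lerXn2r ?nnegrE ?exprn_ge0.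
have hKq : K / q * rhi <= loss ^+ m * (1 / 2).
  have -> : K / q * rhi = K * 128 * (2 * Q)%:R ^+ (2 * k) * (gain ^+ m / loss ^+ m).
    by rewrite /q /rlo; field; rewrite !gt_eqF.
  have hgl : gain ^+ m / loss ^+ m <= loss ^+ m * loss ^+ m.
    rewrite ler_pdivrMr// -!exprMn; apply: lerXn2r; rewrite ?nnegrE.
    - exact: ltW gain_gt0.
    - by rewrite !mulr_ge0// ltW// loss_gt0.
    - by have := gain_le_loss; rewrite !exprS expr0 mulr1 mulrA.
  apply: (@le_trans _ _ (K * 128 * (2 * Q)%:R ^+ (2 * k) * (loss ^+ m * loss ^+ m))).
    by rewrite ler_wpM2l// !mulr_ge0// ltW.
  by rewrite mulrA mulrC ler_wpM2l// ltW.
apply: (@le_trans _ _ ((Y ^+ m) ^+ s0 * (loss ^+ m * (1 / 2)) ^+ (n - s0))).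
  rewrite ler_wpM2l ?exprn_ge0//; apply: lerXn2r => //; rewrite nnegrE.
    by rewrite mulr_ge0// ltW.
  by rewrite mulr_ge0 ?divr_ge0// ltW.
rewrite exprMn mulrA ler_piMl ?exprn_ge0//.
apply: (@le_trans _ _ ((Y ^+ m) ^+ s0 * (loss ^+ m) ^+ (D * s0))).
  rewrite ler_wpM2l ?exprn_ge0//; apply: (ler_wiXn2l (ltW lm0)).
    by apply: exprn_ile1; apply: ltW; [exact: loss_gt0|exact: loss_lt1].
  by rewrite leq_subRL// mulnC -mulnS.
have -> : (Y ^+ m) ^+ s0 * (loss ^+ m) ^+ (D * s0) = ((Y * loss ^+ D) ^+ m) ^+ s0.
  by rewrite exprM -exprMn -!exprM mulnC !exprM -exprMn -!exprM mulnC.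
have YD0 : 0 <= Y * loss ^+ D by rewrite mulr_ge0// exprn_ge0// ltW// loss_gt0.
by rewrite exprn_ile1// ?exprn_ge0// exprn_ile1.
Qed.

End StructuredBound.

(** * Almost constant normal vectors: the numerical comparison *)

Section CompressibleBounds.
Variables (R : realType) (n : nat) (s : int) (F : 'M[R[i]]_n) (Phi : R) (a e0 : nat).
Hypothesis F_le : forall i j, Normc.normc (F i j) <= Phi.
Hypothesis S0 : (0 < #|Sset n s|)%N.
Hypothesis hS : forall x, (x \in Sset n s) = (rowset x \in @slice 'I_n a).
Hypothesis an : (a < n)%N.
Hypothesis e0_gt0 : (0 < e0)%N.
Hypothesis n_le_a : (n <= e0 * (2 * a + 1))%N.
Hypothesis n_le_na : (n <= e0 * (2 * (n - a.+1) + 1))%N.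

(** The [kap] of [prow_flip]: both [a + 1] and [n - a] are at least [n / (2 * e0)], and
    [n + 1 <= 2 * n]. *)
Definition flip_prob : R := 1 / (8 * e0%:R ^+ 2).

Lemma flip_prob_gt0 : 0 < flip_prob.
Proof. by rewrite divr_gt0// mulr_gt0// exprn_gt0// ltr0n. Qed.

Lemma flip_prob_lt1 : flip_prob < 1.
Proof.
have e1 : 1 <= e0%:R ^+ 2 :> R by rewrite exprn_ege1// ler1n.
rewrite /flip_prob ltr_pdivrMr; lra.
Qed.

Lemma flip_prob_le : flip_prob * (n%:R + 1) * n%:R <= (a%:R + 1) * (n%:R - a%:R) :> R.
Proof.
have e0' : 0 < e0%:R :> R by rewrite ltr0n.
have n1 : 1 <= n%:R :> R by rewrite ler1n; apply: leq_ltn_trans an.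
have h1 : n%:R <= e0%:R * (2 * (a%:R + 1)) :> R.
  by rewrite natr1 -!natrM ler_nat (leq_trans n_le_a)// leq_mul2l; apply/orP; right; lia.
have h2 : n%:R <= e0%:R * (2 * (n%:R - a%:R)) :> R.
  rewrite -natrB 1?ltnW// -!natrM ler_nat (leq_trans n_le_na)// leq_mul2l; apply/orP; right.
  by move: an; lia.
have h3 : n%:R * n%:R <= e0%:R * (2 * (a%:R + 1)) * (e0%:R * (2 * (n%:R - a%:R))) :> R.
  by apply: ler_pM.
rewrite /flip_prob -mulrA mulrAC ler_pdivrMr ?mulr_gt0 ?exprn_gt0// mul1r.
have h4 : (n%:R + 1) * n%:R <= 2 * (n%:R * n%:R) :> R by nra.
apply: le_trans h4 _; rewrite -(ler_pM2l (ltr0n R 2)) in h3; move: h3.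
set p := (a%:R + 1); set r := (n%:R - a%:R); lra.
Qed.

(** [U] rows outweigh one factor [Y], so at most [n / 4] rows pay for the net of size at most
    [Y ^+ (m * s1.+1)], leaving at least [n %/ 2] rows. *)
Lemma almost_constant_bound (l : 'I_n) (M s1 m U : nat) (Y : R) : (0 < M)%N -> (4 <= n)%N ->
  n%:R * (1 + Phi) * (2 * (2 / M%:R)) + 2 / M%:R < 1 ->
  (n * (2 * M).+1 ^ 2)%:R <= Y ^+ m -> 0 <= Y -> (1 - flip_prob) ^+ U * Y <= 1 ->
  (4 * (U * (m * s1.+1)) <= n)%N ->
  probX R s (fun X => `[< exists2 v, normal F X l v & almost_constant M s1 v >]) <=
    (1 - flip_prob) ^+ (n %/ 2).
Proof.
move=> M0 n4 hM hY Y0 hU hn.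
have k1 : 0 < 1 - flip_prob by rewrite subr_gt0 flip_prob_lt1.
have k2 : 1 - flip_prob <= 1 by rewrite gerBl ltW// flip_prob_gt0.
apply: le_trans (probX_almost_constant F_le S0 hS an l (kap := flip_prob) s1 M0 _ hM flip_prob_le) _.
  exact: ltW flip_prob_lt1.
set x := 1 - flip_prob in hU k1 k2 *.
have h1 : (n ^ s1 * ((2 * M).+1 ^ 2) ^ s1.+1)%:R <= Y ^+ (m * s1.+1) :> R.
  apply: (@le_trans _ _ ((n * (2 * M).+1 ^ 2)%:R ^+ s1.+1)).
    by rewrite -natrX ler_nat expnMn leq_mul2r leq_exp2l ?leqnSn ?orbT//; apply: leq_trans n4.
  by rewrite exprM lerXn2r ?nnegrE ?exprn_ge0.
have h2 : x ^+ n.-1 <= x ^+ (U * (m * s1.+1) + n %/ 2).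
  apply: (ler_wiXn2l (ltW k1) k2).
  move: hn; move: (U * _)%N => w hw.
  have := leq_divM n 2; move: (n %/ 2)%N => z; move: n4 hw; clear; lia.
apply: (@le_trans _ _ (Y ^+ (m * s1.+1) * x ^+ (U * (m * s1.+1) + n %/ 2))).
  by apply: ler_pM => //; rewrite exprn_ge0// ltW.
rewrite exprD [x ^+ (U * _)]exprM mulrA -exprMn ler_piMl ?exprn_ge0 ?(ltW k1)//.
by apply: exprn_ile1; rewrite ?[Y * _]mulrC// mulr_ge0// exprn_ge0// ltW.
Qed.

(** The scale is such that [2 * 4 ^ m] times it is the radius [1 / M] of [almost_constant]; the
    exceptional sets add at most half of [gain ^+ m] to the [3 / 2 * gain ^+ m] of
    [slice_conc_far]. *)
Lemma not_almost_constant_conc (v : 'cV[R[i]]_n) (M m b : nat) : (0 < M)%N -> (0 < b)%N ->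
  (1 <= a)%N -> (1 <= n - a.+1)%N -> (9 ^ m <= a)%N -> (2 * 81 ^ m <= b)%N ->
  (16 * e0 * b <= n)%N ->
  (4 ^ m * n <= 5 ^ m * b)%N -> n%:R * (2 ^+ b)^-1 <= gain R ^+ m / 2 ->
  ~ almost_constant M (64 * e0 * b) v ->
  slice_conc (coords v) a (2 * 4 ^ m * M)%:R^-1 (2 * gain R ^+ m).
Proof.
move=> M0 b0 a1 na1 ma mb eb hn hg hv.
have M0' : 0 < M%:R :> R by rewrite ltr0n.
have m0' : 0 < 4 ^+ m :> R by rewrite exprn_gt0.
have E : 2 * 4 ^+ m * (2 * 4 ^ m * M)%:R^-1 = M%:R^-1 :> R.
  by rewrite !natrM natrX; field; rewrite !gt_eqF.
have hb : (4 * b <= n - a.+1)%N.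
  have h : (16 * e0 * b <= e0 * (4 * (n - a.+1)))%N.
    by apply: leq_trans eb (leq_trans n_le_na _); rewrite leq_mul2l; apply/orP; right; lia.
  rewrite -(@leq_pmul2l (4 * e0)) ?muln_gt0 ?e0_gt0//.
  by move: h; rewrite (_ : 4 * e0 * (4 * b) = 16 * e0 * b)%N 1?(_ : 4 * e0 * (n - a.+1) = e0 * (4 * (n - a.+1)))%N//; ring.
have [T1|] := pselect (forall i, (64 * e0 * b <= #|far (coords v) M%:R^-1 i|)%N); last first.
  move=> h; exfalso; apply: h => i; rewrite leqNgt; apply/negP => h; apply: hv; by exists i.
have := @slice_conc_far R 'I_n (coords v) a b m (2 * 4 ^ m * M)%:R^-1.
rewrite card_ord E => H.
have : slice_conc (coords v) a (2 * 4 ^ m * M)%:R^-1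
    (3 / 2 * (1 - 10 ^- 6) ^+ m + n%:R * (2 ^+ b)^-1).
  apply: H => //.
  - move=> i; apply: (@tail_okP _ _ _ _ (4 * e0)) => //.
    + by rewrite muln_gt0 e0_gt0.
    + by apply: leq_trans n_le_na _; rewrite -mulnA mulnCA leq_mul2l; apply/orP; right; lia.
    + apply: leq_trans (T1 i); rewrite leq_eqVlt; apply/orP; left; apply/eqP; ring.
  - rewrite -(ler_pM2r (_ : 0 < 4 ^+ m)) ?exprn_gt0// [leRHS]mulrAC -exprMn divfK//.
    have : (4 ^ m * n)%:R <= (5 ^ m * b)%:R :> R by rewrite ler_nat.
    rewrite !natrM !natrX; have : 0 <= 4 ^+ m * n%:R :> R by rewrite mulr_ge0// exprn_ge0.
    lra.
move=> h z; apply: le_trans (h z) _; rewrite ler_wpM2r// -/(gain R); lra.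
Qed.

End CompressibleBounds.

(** The scales are [1 / L j], with grid parameter [4 * n ^ G.+1 * L j] at level [j]. All are
    polynomial in [n], hence bounded by powers of [243 ^ m] with exponents depending only on [G] and
    [J], so that the cost per coordinate is an [m]-th power of a constant. *)
Lemma scale_bounds (n m G J : nat) : (0 < m)%N -> (0 < n)%N -> (n <= (243 ^ m) ^ 2)%N ->
  let E := (2 * G + 5)%N in
  let M1 := (16 * n ^ G.+1)%N in
  let L j := (2 * 4 ^ m * M1 * (2 ^ m * (4 * n ^ G.+1)) ^ j)%N in
  [/\ (n * (2 * M1).+1 ^ 2 <= (243 ^ (4 * G + 8)) ^ m)%N,
      (L J <= (243 ^ m) ^ (E * J.+1))%N &
      forall j, (j < J)%N -> ((2 * (4 * n ^ G.+1 * L j)).+1 ^ 2 <= (243 ^ (2 * (E * J.+1) + 1)) ^ m)%N].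
Proof.
move=> m0 n0; set N := (243 ^ m)%N => hn E M1 L.
have NE k : ((243 ^ k) ^ m = N ^ k)%N by rewrite /N expnAC.
have N0 : (0 < N)%N by rewrite expn_gt0.
have N243 : (243 <= N)%N by rewrite -[X in (X <= _)%N]expn1 leq_exp2l.
have nG : (n ^ G.+1 <= N ^ (2 * G + 2))%N.
  by apply: leq_trans (_ : (N ^ 2) ^ G.+1 <= _)%N; rewrite ?leq_exp2r// -expnM mulnS addnC mulnC.
have nG0 : (0 < n ^ G.+1)%N by rewrite expn_gt0 n0.
have p8 (c d : nat) : (c <= d ^ m -> d * 2 <= 243 -> c * 2 ^ m <= N)%N.
  move=> cd d2; apply: (@leq_trans ((d * 2) ^ m)); first by rewrite expnMn leq_mul2r cd orbT.
  by rewrite leq_exp2r.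
have p4 : (2 * 4 ^ m <= N)%N.
  have -> : (2 * 4 ^ m = (2 * 2 ^ m) * 2 ^ m)%N by rewrite (_ : 4 = 2 * 2)%N// expnMn mulnA.
  apply: (p8 _ 4)%N => //; rewrite (_ : 4 = 2 * 2)%N// expnMn leq_mul2r; apply/orP; right.
  by rewrite -[X in (X <= _)%N]expn1 leq_exp2l.
have p2 : (2 ^ m * 4 <= N)%N.
  by rewrite mulnC; apply: (p8 _ 4)%N => //; rewrite -[X in (X <= _)%N]expn1 leq_exp2l.
have hX : (2 ^ m * (4 * n ^ G.+1) <= N ^ E)%N.
  rewrite mulnA (leq_trans (leq_mul p2 nG))// -expnS leq_pexp2l// /E; lia.
have hM1 : (M1 <= N ^ (2 * G + 3))%N.
  have N16 : (16 <= N)%N by apply: leq_trans N243.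
  by apply: leq_trans (leq_mul N16 nG) _; rewrite -expnS leq_pexp2l//; lia.
have hL0 : (2 * 4 ^ m * M1 <= N ^ E)%N.
  by apply: leq_trans (leq_mul p4 hM1) _; rewrite -expnS leq_pexp2l// /E; lia.
have hL j : (L j <= N ^ (E * j.+1))%N.
  rewrite mulnS expnD leq_mul// expnM; case: j => // j; by rewrite leq_exp2r.
split => //.
- rewrite NE; apply: (@leq_trans (n * (3 * M1) ^ 2)).
    rewrite leq_mul2l leq_exp2r//; apply/orP; right.
    by have : (0 < M1)%N; [rewrite muln_gt0 nG0|lia].
  have -> : (n * (3 * M1) ^ 2 = 2304 * n * (n ^ G.+1) ^ 2)%N by rewrite /M1; ring.
  apply: (@leq_trans (N ^ 2 * N ^ 2 * (N ^ (2 * G + 2)) ^ 2)).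
    rewrite leq_mul ?leq_exp2r// leq_mul//.
    by apply: (@leq_trans (243 ^ 2)); rewrite ?leq_exp2r.
  by rewrite -expnM -!expnD leq_pexp2l//; lia.
- move=> j jJ; rewrite NE.
  have L0 : (0 < L j)%N by rewrite !muln_gt0 !expn_gt0 !muln_gt0 !expn_gt0 n0.
  set M := (4 * n ^ G.+1 * L j)%N.
  have M0 : (0 < M)%N by rewrite muln_gt0 L0 andbT muln_gt0 nG0.
  have hM : (M <= N ^ (E * J.+1))%N.
    apply: (@leq_trans (N ^ (2 * G + 3) * N ^ (E * j.+1))).
      rewrite leq_mul//; apply: (@leq_trans (N * N ^ (2 * G + 2))).
        by rewrite leq_mul// (leq_trans _ N243).
      by rewrite -expnS leq_pexp2l//; lia.
    rewrite -expnD leq_pexp2l//; apply: (@leq_trans (E * j.+2)); last by rewrite leq_mul2l ltnS jJ orbT.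
    by rewrite [(E * j.+2)%N]mulnS leq_add2r /E; lia.
  apply: (@leq_trans ((3 * M) ^ 2)); first by rewrite leq_exp2r//; lia.
  rewrite expnMn addnC expnD expn1 leq_mul//; first by apply: leq_trans N243.
  by rewrite mulnC expnM leq_exp2r.
Qed.

Lemma ev_nat (R : realType) (K x y : nat) : (0 < x)%N -> (x < y)%N ->
  ev (fun m => (K * m.+1 * x ^ m <= y ^ m)%N).
Proof.
move=> x0 xy; apply: ev_imp (@ev_exp R K%:R x%:R y%:R _ _ _) => [m| | |].
- by rewrite -!natrX -!natrM ler_nat.
- exact: ler0n.
- by rewrite ltr0n.
- by rewrite ltr_nat.
Qed.

(** Up to rounding, the smallest [b] with [n <= (5 / 4) ^ m * b]. As [m] is of order [log n], this
    is a smaller power of [n], so a net cost exponential in [m] per exceptional coordinate is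
    affordable. *)
Definition far_scale n m := ((4 ^ m * n) %/ 5 ^ m).+1.

Lemma far_scale_ge n m : (4 ^ m * n <= 5 ^ m * far_scale n m)%N.
Proof. by rewrite [(5 ^ m * _)%N]mulnC ltnW// /far_scale ltn_ceil// expn_gt0. Qed.

Lemma far_scale_le n m c : (243 ^ m <= n)%N -> (c * 2 * 4 ^ m <= 5 ^ m)%N ->
  (c * far_scale n m <= n)%N.
Proof.
move=> hn hc.
have h5 : (0 < 5 ^ m)%N by rewrite expn_gt0.
have h1 : (5 ^ m * far_scale n m <= 2 * (4 ^ m * n))%N.
  rewrite /far_scale mulnS mul2n -addnn leq_add//; last by rewrite mulnC leq_divM.
  apply: leq_trans (leq_pmull _ _); last by rewrite expn_gt0.
  by apply: leq_trans hn; case: (m) => // k; rewrite leq_exp2r.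
rewrite -(leq_pmul2l h5) mulnCA; apply: (@leq_trans (c * (2 * (4 ^ m * n)))).
  by rewrite leq_mul2l h1 orbT.
by rewrite !mulnA leq_mul2r hc orbT.
Qed.

(** The square of the [9 ^ m] draws must fit into [(4 / 5) ^ m * n], which needs a base above
    [81 * 5 / 4]; 243 is large enough, with [972 = 4 * 243] and [405 = 5 * 81]. *)
Lemma far_scale_large n m : (243 ^ m <= n)%N -> (2 * 405 ^ m <= 972 ^ m)%N ->
  (2 * 81 ^ m <= far_scale n m)%N.
Proof.
move=> hn h; have h5 : (0 < 5 ^ m)%N by rewrite expn_gt0.
rewrite -(leq_pmul2l h5); apply: leq_trans (far_scale_ge n m).
rewrite mulnCA -expnMn; apply: leq_trans h _.
by rewrite (_ : 972 = 4 * 243)%N// expnMn leq_mul2l hn orbT.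
Qed.

(** * Assembling the estimates for fixed [m] *)

Section Core.
Variable R : realType.

Lemma half_le_gain m : (1 / 2) ^+ m <= gain R ^+ m.
Proof.
by apply: lerXn2r; rewrite ?nnegrE ?divr_ge0// ?(ltW (gain_gt0 R))// /gain; lra.
Qed.

Lemma far_scale_tail n m b : (n <= (243 ^ m) ^ 2)%N -> (17 * m + 1 <= b)%N ->
  n%:R * (2 ^+ b)^-1 <= gain R ^+ m / 2.
Proof.
move=> hn hb.
have h2 (c : nat) : 0 < 2 ^+ c :> R by rewrite exprn_gt0.
rewrite ler_pdivrMr//; apply: (@le_trans _ _ ((1 / 2) ^+ m / 2 * 2 ^+ (17 * m + 1))); last first.
  apply: ler_pM; rewrite ?mulr_ge0 ?exprn_ge0 ?invr_ge0 ?divr_ge0//.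
    by rewrite ler_wpM2r ?invr_ge0//; exact: half_le_gain.
  by apply: ler_weXn2l => //; rewrite ler1n.
apply: (@le_trans _ _ (2 ^+ (16 * m))).
  rewrite -natrX ler_nat (leq_trans hn)//.
  have -> : (16 * m = 8 * m * 2)%N by rewrite mulnAC.
  rewrite expnM leq_exp2r// (expnM 2 8 m) (_ : 2 ^ 8 = 256)%N//.
  by case: (m) => // c; rewrite leq_exp2r.
rewrite exprD expr1 mulrA [_ / 2 * _]mulrAC -[leRHS]mulrA mulVf ?mulr1 ?pnatr_eq0//.
rewrite (_ : 17 * m = m + 16 * m)%N; last by rewrite -mulSn.
by rewrite exprD mulrA -exprMn divfK ?pnatr_eq0// expr1n mul1r.
Qed.

(** Trivial patterns number about [n ^ k] against [n ^ (2 * k)] times at least a constant times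
    [loss ^+ (m * J)]. The choice of [k] makes [243 ^ k * loss ^+ J >= 2], so the surplus is at
    least [2 ^ m] and absorbs the constants. *)
Lemma trivial_patterns_le (n m k Q b J j : nat) : (243 ^ m <= n)%N -> (n <= 2 * Q * b)%N ->
  (0 < Q)%N -> (j < J)%N ->
  (1 / 243) ^+ k <= loss R ^+ J / 2 ->
  (k ^ k)%:R * 64 * (2 * Q)%:R ^+ (2 * k) <= 2 ^+ m :> R ->
  (k ^ k * n ^ k)%:R <=
    (2 * gain R ^+ m * loss R ^+ (m * j)) * loss R ^+ m / 128 * (gain R ^+ m)^-1 * b%:R ^+ (2 * k).
Proof.
move=> hN hb Q0 jJ hk h5.
have g0 : 0 < gain R ^+ m by rewrite exprn_gt0// gain_gt0.
have l0 := loss_gt0 R; have l1 := ltW (loss_lt1 R).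
have Q0' : 0 < (2 * Q)%:R ^+ (2 * k) :> R by rewrite exprn_gt0// ltr0n muln_gt0.
rewrite (_ : _ * _ / 128 * _ = loss R ^+ (m * j.+1) / 64); last first.
  by rewrite mulnS exprD; field; rewrite gt_eqF.
have hl : loss R ^+ (m * J) <= loss R ^+ (m * j.+1).
  by apply: (ler_wiXn2l (ltW l0) l1); rewrite leq_mul2l jJ orbT.
apply: (@le_trans _ _ (loss R ^+ (m * J) / 64 * b%:R ^+ (2 * k))); last first.
  by rewrite ler_wpM2r ?exprn_ge0// ler_wpM2r// invr_ge0.
have hnb : n%:R ^+ k * n%:R ^+ k <= (2 * Q)%:R ^+ (2 * k) * b%:R ^+ (2 * k) :> R.
  rewrite -exprD addnn -mul2n -exprMn lerXn2r ?nnegrE// ?mulr_ge0//.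
  by rewrite -natrM ler_nat.
have hnk : 243%:R ^+ (m * k) <= n%:R ^+ k :> R.
  by rewrite exprM lerXn2r ?nnegrE ?exprn_ge0// -natrX ler_nat.
have h2 : 2 ^+ m <= loss R ^+ (m * J) * 243%:R ^+ (m * k).
  rewrite mulnC exprM [(m * k)%N]mulnC exprM -exprMn.
  apply: lerXn2r; rewrite ?nnegrE ?mulr_ge0 ?exprn_ge0 ?(ltW l0)//.
  have : 0 < 243%:R ^+ k :> R by rewrite exprn_gt0.
  move: hk; rewrite exprMn expr1n mul1r exprVn => hk h.
  by move: hk; rewrite -(ler_pM2r h) mulVf ?gt_eqF//; lra.
have n0 : 0 <= n%:R ^+ k :> R by rewrite exprn_ge0.
rewrite natrM [(n ^ k)%:R]natrX -(ler_pM2l Q0').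
have h3 : (k ^ k)%:R * 64 * (2 * Q)%:R ^+ (2 * k) <= loss R ^+ (m * J) * n%:R ^+ k.
  apply: le_trans h5 (le_trans h2 _); by rewrite ler_wpM2l// exprn_ge0// ltW.
have h4 := ler_wpM2r n0 h3.
have L0 : 0 <= loss R ^+ (m * J) by rewrite exprn_ge0// ltW.
have h6 := ler_wpM2l L0 hnb.
move: h4 h6; set q := (2 * Q)%:R ^+ (2 * k); set L := loss R ^+ (m * J).
set kk := (k ^ k)%:R : R; set nk := n%:R ^+ k; set bb := b%:R ^+ (2 * k) => h4 h6.
lra.
Qed.

Lemma tail_small (m U b : nat) (J j : nat) : (j < J)%N ->
  (1 / 2) ^+ U <= gain R * loss R ^+ J -> (U * m + 1 <= b)%N ->
  4 * (2 ^+ b)^-1 <= (2 * gain R ^+ m * loss R ^+ (m * j)) * loss R ^+ m.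
Proof.
move=> jJ hU hb.
have l0 := loss_gt0 R; have l1 := ltW (loss_lt1 R); have g0 := gain_gt0 R.
have hl : loss R ^+ (m * J) <= loss R ^+ (m * j) * loss R ^+ m.
  by rewrite -exprD -mulnSr; apply: (ler_wiXn2l (ltW l0) l1); rewrite leq_mul2l jJ orbT.
rewrite -mulrA; apply: (@le_trans _ _ (2 * gain R ^+ m * loss R ^+ (m * J))); last first.
  by rewrite ler_wpM2l// mulr_ge0// exprn_ge0// ltW.
have -> : 2 * gain R ^+ m * loss R ^+ (m * J) = 2 * (gain R * loss R ^+ J) ^+ m.
  by rewrite exprMn -exprM [(J * m)%N]mulnC mulrA.
rewrite -(exprVn 2) (_ : 4 = 2 * 2 :> R) -?mulrA ?ler_wpM2l//; last by ring.
apply: (@le_trans _ _ (((1 / 2) ^+ U) ^+ m)); last first.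
  by apply: lerXn2r; rewrite ?nnegrE ?mulr_ge0 ?exprn_ge0 ?divr_ge0 ?(ltW l0) ?(ltW g0).
apply: (@le_trans _ _ (2 * 2^-1 ^+ (U * m + 1))).
  by rewrite ler_wpM2l//; apply: ler_wiXn2l => //; lra.
by rewrite exprD expr1 mulrCA mulfV ?pnatr_eq0// mulr1 exprM mul1r.
Qed.

End Core.

Lemma quarter_level n e0 c : (0 < e0)%N -> (n <= e0 * (2 * c + 1))%N -> (e0 < n)%N ->
  (n <= 4 * e0 * c)%N /\ (1 <= c)%N.
Proof.
move=> e00 h en; case: c h => [|c] h; first by rewrite muln0 add0n muln1 leqNgt en in h.
split=> //; apply: leq_trans h _; rewrite [(4 * e0)%N]mulnC -mulnA leq_mul2l; apply/orP; right; lia.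
Qed.

Lemma level_gap n e0 D b c : (0 < e0)%N -> (b * (64 * e0 * D.+1) <= n)%N -> (n <= 4 * e0 * c)%N ->
  (4 * b <= c)%N.
Proof.
move=> e00 h1 h2; rewrite -(@leq_pmul2l (4 * e0)) ?muln_gt0//.
apply: leq_trans (leq_trans h1 h2).
have -> : (b * (64 * e0 * D.+1) = 4 * e0 * (4 * b) * (4 * D.+1))%N by ring.
by rewrite leq_pmulr.
Qed.

Lemma draws_le Q k m : (2 * (2 * k * 3 ^ m) ^ 2 * Q <= Q * (8 * k ^ 2) * m.+1 * 9 ^ m)%N.
Proof.
have -> : (2 * (2 * k * 3 ^ m) ^ 2 * Q = Q * (8 * k ^ 2) * 9 ^ m)%N.
  by rewrite (_ : 9 = 3 ^ 2)%N// -expnAC; ring.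
by rewrite [leqRHS]mulnAC leq_pmulr.
Qed.

Lemma succ_mul_le U m : (U * m + 1 <= U.+1 * m.+1)%N.
Proof. by rewrite mulSn mulnS; lia. Qed.

Lemma ceil_le_double n b Q : (n < b.+1 * Q)%N -> (0 < b)%N -> (n <= 2 * Q * b)%N.
Proof. by move=> h b0; apply: leq_trans (ltnW h) _; rewrite mulnAC leq_mul2r; apply/orP; right; lia. Qed.

Lemma patch_scale (R : realType) (x p : R) : x <= 2 * p -> 1 <= p ->
  x * (2 * (2 / (16 * p))) + 2 / (16 * p) < 1.
Proof.
move=> xp p1; have p0 : 0 < p by lra.
have q0 : 0 < p^-1 by rewrite invr_gt0.
have q1 : p * p^-1 = 1 by rewrite divff// gt_eqF.
have q2 : p^-1 <= 1 by rewrite invf_le1.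
have -> : x * (2 * (2 / (16 * p))) + 2 / (16 * p) = (x / 4 + 1 / 8) * p^-1.
  by field; rewrite gt_eqF.
have : (x / 4 + 1 / 8) * p^-1 <= (p / 2 + 1 / 8) * p^-1 by rewrite ler_wpM2r ?(ltW q0)//; lra.
nra.
Qed.

Lemma patch_size U m e0 b1 : (0 < e0)%N -> (0 < b1)%N ->
  (4 * (U * (m * (64 * e0 * b1).+1)) <= 260 * U * m * e0 * b1)%N.
Proof.
move=> h1 h2; have h : ((64 * e0 * b1).+1 <= 65 * (e0 * b1))%N.
  by have : (0 < e0 * b1)%N; [rewrite muln_gt0 h1|rewrite -mulnA; lia].
apply: (@leq_trans (4 * (U * (m * (65 * (e0 * b1)))))); first by rewrite !leq_mul.
by rewrite leq_eqVlt; apply/orP; left; apply/eqP; ring.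
Qed.

Lemma half_sub_le n D : (0 < D)%N -> (n %/ 2 <= n - n %/ D.+1)%N.
Proof.
move=> D0; have h : (n %/ D.+1 <= n %/ 2)%N by rewrite leq_div2l.
by have := leq_divM n 2; lia.
Qed.

Lemma grid_scale (R : realType) (x p L : R) : x <= 2 * p -> 0 < p -> 0 < L ->
  x * (2 / (4 * p * L)) <= L^-1.
Proof.
move=> xp p0 L0; have -> : x * (2 / (4 * p * L)) = (x / (2 * p)) * L^-1 by field; rewrite !gt_eqF.
by rewrite ler_piMl ?invr_ge0 ?(ltW L0)// ler_pdivrMr ?mulr_gt0// mul1r.
Qed.

Lemma level_product_le (R : realType) (g u v : R) : 0 <= g -> 0 <= u -> u <= 1 -> v <= 1 / 2 ->
  2 * g * u * v <= g.
Proof.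
move=> g0 u0 u1 v2; apply: (@le_trans _ _ (2 * g * u * (1 / 2))).
  by rewrite ler_wpM2l// !mulr_ge0.
have -> : 2 * g * u * (1 / 2) = g * u by field.
by rewrite ler_piMr.
Qed.

Lemma double_half_le (R : realType) (g : R) : g <= 1 / 2 -> 2 * g <= 1.
Proof. lra. Qed.

Lemma half_pow_antimono (R : realType) i j : (i <= j)%N -> (1 / 2) ^+ j <= (1 / 2) ^+ i :> R.
Proof. by move=> ij; apply: ler_wiXn2l => //; lra. Qed.

Lemma gain_le_loss1 (R : realType) : gain R <= loss R.
Proof. by rewrite /gain /loss; lra. Qed.

Lemma core_bound (R : realType) (G J k D e0 U U' n m : nat) (s : int)
    (F : 'M[R[i]]_n) (a : nat) :
  let E := (2 * G + 5)%N in
  let Y : R := (243 ^ (2 * (E * J.+1) + 1))%:R in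
  let Q := (64 * e0 * D.+1)%N in
  (0 < k)%N -> (0 < D)%N -> (0 < e0)%N ->
  (1 / 243) ^+ k <= loss R ^+ J / 2 ->
  Y * loss R ^+ D <= 1 ->
  (1 - flip_prob R e0) ^+ U * (243 ^ (4 * G + 8))%:R <= 1 ->
  (1 / 2) ^+ U' <= gain R * loss R ^+ J ->
  (1 <= m)%N -> (243 ^ m <= n)%N -> (n <= (243 ^ m) ^ 2)%N ->
  ((4 * k + 3) ^ 2)%:R * 128 * (2 * Q)%:R ^+ (2 * k) * loss R ^+ m <= 1 / 2 ->
  loss R ^+ m <= 1 / 2 ->
  (Q * (8 * k ^ 2) * m.+1 * 9 ^ m <= 243 ^ m)%N ->
  (Q * U'.+1 * m.+1 * 1 ^ m <= 243 ^ m)%N ->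
  (k ^ k)%:R * 64 * (2 * Q)%:R ^+ (2 * k) <= 2 ^+ m :> R ->
  (520 * U * e0 * m.+1 * 4 ^ m <= 5 ^ m)%N ->
  (32 * e0 * m.+1 * 4 ^ m <= 5 ^ m)%N ->
  (2 * m.+1 * 405 ^ m <= 972 ^ m)%N ->
  (18 * m.+1 * 1 ^ m <= 81 ^ m)%N ->
  (4 * e0 * m.+1 * 9 ^ m <= 243 ^ m)%N ->
  (0 < #|Sset n s|)%N ->
  (forall x, (x \in Sset n s) = (rowset x \in @slice 'I_n a)) ->
  (a < n)%N -> (n <= e0 * (2 * a + 1))%N -> (n <= e0 * (2 * (n - a.+1) + 1))%N ->
  (forall i j, Normc.normc (F i j) <= n%:R ^+ G) ->
  probX R s (fun X => sigma_min (signmx R X + F) < (n%:R ^+ (E * J.+1 + 2))^-1) <=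
    n%:R * ((1 - flip_prob R e0) ^+ (n %/ 2) + (J%:R * (1 / 2) ^+ (n %/ 2) +
      2 * gain R ^+ m * loss R ^+ (m * J))).
Proof.
move=> E Y Q k0 D0 e00 hk hYD hU hU' m0 hNn hnN f1 f2 f3 f4 f5 f7 f7' f8 f9 f11 S0 hS an ha hna hF.
have N243 : (243 <= 243 ^ m)%N by rewrite -[X in (X <= _)%N]expn1 leq_exp2l.
have n243 : (243 <= n)%N := leq_trans N243 hNn.
have n0 : (0 < n)%N by apply: leq_trans n243.
have n0' : 0 < n%:R :> R by rewrite ltr0n.
have Q0 : (0 < Q)%N by rewrite !muln_gt0 e00.
set N := (243 ^ m)%N in hNn hnN f3 f4 f11 N243.
(* Both are linear in [n]. The factor [64 * e0 * D.+1] in [Q] gives [64 * e0 * b <= s0], so every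
   set of size at least [s0] passes the tail condition. *)
pose b := (n %/ Q)%N; pose s0 := (n %/ D.+1)%N.
pose b1 := far_scale n m; pose s1 := (64 * e0 * b1)%N.
pose M1 := (16 * n ^ G.+1)%N.
pose L j := (2 * 4 ^ m * M1 * (2 ^ m * (4 * n ^ G.+1)) ^ j)%N.
pose M j := (4 * n ^ G.+1 * L j)%N.
have [B1 B2 B3] := scale_bounds (n := n) (m := m) G J m0 n0 hnN.
rewrite -/E -/M1 in B1 B2 B3.
have g0 := gain_gt0 R; have l0 := loss_gt0 R; have l1 := ltW (loss_lt1 R).
have gm0 : 0 < gain R ^+ m by rewrite exprn_gt0.
have gl : gain R ^+ m <= 1 / 2.
  apply: le_trans f2; apply: lerXn2r; rewrite ?nnegrE ?(ltW g0) ?(ltW l0)//.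
  exact: gain_le_loss1.
have nG0 : (0 < n ^ G.+1)%N by rewrite expn_gt0 n0.
have M10 : (0 < M1)%N by rewrite muln_gt0 nG0.
have L0 j : (0 < L j)%N by rewrite /L muln_gt0 (muln_gt0 (_ * _) M1) M10 !(muln_gt0, expn_gt0) n0 ?orbT.
have M0 j : (0 < M j)%N by rewrite /M muln_gt0 L0 andbT muln_gt0 nG0.
have nG1 : 1 <= n%:R ^+ G :> R by rewrite exprn_ege1// ler1n.
have nPhi : n%:R * (1 + n%:R ^+ G) <= 2 * (n ^ G.+1)%:R :> R.
  by rewrite natrX exprS mulrDr mulr1 [2 * _]mulr_natl mulr2n lerD2r ler_peMr// ltW.
have bQ c : (c * Q <= n)%N -> (c <= b)%N by move=> h; rewrite /b leq_divRL.
have e0n : (e0 < n)%N.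
  apply: leq_trans hNn; apply: leq_trans f11.
  apply: (@leq_trans (4 * e0)); last by rewrite -mulnA leq_pmulr// muln_gt0 expn_gt0.
  by rewrite ltn_Pmull.
have [ha' a1] := quarter_level e00 ha e0n.
have [hna' na1] := quarter_level e00 hna e0n.
have a9 : (9 ^ m <= a)%N.
  rewrite -(@leq_pmul2l (4 * e0)) ?muln_gt0//; apply: leq_trans (leq_trans hNn ha').
  by apply: leq_trans f11; rewrite [leqRHS]mulnAC leq_pmulr.
have hb1 : (U' * m + 1 <= b)%N.
  apply: bQ; apply: leq_trans hNn; apply: leq_trans f4.
  by rewrite exp1n muln1 mulnC -mulnA leq_mul2l succ_mul_le orbT.
have bpos : (0 < b)%N by apply: leq_trans hb1; rewrite addn1.
have hb2 : (2 * (2 * k * 3 ^ m) ^ 2 <= b)%N.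
  by apply: bQ; apply: leq_trans hNn; apply: leq_trans f3; exact: draws_le.
have hbn : (b * Q <= n)%N := leq_divM n Q.
have nQb : (n <= 2 * Q * b)%N.
  exact: ceil_le_double (ltn_ceil n Q0) bpos.
have s0D : (s0 * D.+1 <= n)%N := leq_divM n D.+1.
have s00 : (0 < s0)%N.
  rewrite divn_gt0//; apply: leq_trans hbn; rewrite -[X in (X <= _)%N]mul1n leq_mul//.
  by rewrite leq_pmull// muln_gt0.
have sb : (64 * e0 * b <= s0)%N.
  by rewrite /s0 leq_divRL//; apply: leq_trans hbn; rewrite /Q mulnA [(64 * e0 * b)%N]mulnC.
have b4 c : (n <= 4 * e0 * c)%N -> (4 * b <= c)%N by exact: level_gap hbn.
apply: le_trans (@probX_sigma_min R n s F (n%:R ^+ G) a hF S0 hS an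
  (fun j => (L j)%:R^-1) (fun j => 2 * gain R ^+ m * loss R ^+ (m * j)) J M1 s1
  _ ((1 - flip_prob R e0) ^+ (n %/ 2)) ((1 / 2) ^+ (n %/ 2)) _ _ _ _ _ _) _ => //.
- by rewrite invr_gt0 exprn_gt0.
- by rewrite !mulr_ge0// exprn_ge0// ltW.
- have hLJ : (L J)%:R <= n%:R ^+ (E * J.+1) :> R.
    by rewrite -natrX ler_nat (leq_trans B2)// leq_exp2r// muln_gt0 /E addnS.
  have LJ0 : 0 < (L J)%:R :> R by rewrite ltr0n.
  rewrite exprD invfM mulrCA divff ?mulr1 ?gt_eqF ?exprn_gt0//.
  apply: (@le_trans _ _ (n%:R ^+ (E * J.+1))^-1).
    by rewrite ler_piMr ?invr_ge0 ?exprn_ge0// invf_le1// ler1n.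
  by rewrite lef_pV2 ?posrE ?exprn_gt0.
- move=> v hv; rewrite muln0 expr0 mulr1 /L expn0 muln1.
  have b1l : (2 * 81 ^ m <= b1)%N.
    by apply: far_scale_large => //; apply: leq_trans f8; rewrite -mulnA mulnCA leq_pmull.
  apply: (not_almost_constant_conc S0 an e00 ha hna (b := b1) (M := M1)) => //.
  + apply: far_scale_le => //; apply: leq_trans f7'.
    rewrite leq_mul2r; apply/orP; right.
    by rewrite mulnAC (_ : 16 * 2 = 32)%N// leq_pmulr.
  + exact: far_scale_ge.
  + apply: far_scale_tail => //; apply: leq_trans b1l; apply: leq_trans (leq_pmull _ _) => //.
    by apply: leq_trans f9; rewrite exp1n muln1 mulnS addnC leq_add// leq_mul2r orbT.
- move=> l.
  apply: (almost_constant_bound hF S0 hS an e00 ha hna l (m := m) (U := U)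
    (Y := (243 ^ (4 * G + 8))%:R)) => //.
  + exact: leq_trans n243.
  + by rewrite /M1 natrM; apply: patch_scale => //; rewrite ler1n.
  + by rewrite -natrX ler_nat.
  + apply: leq_trans (patch_size U m e00 (ltn0Sn _)) _; apply: far_scale_le => //.
    apply: leq_trans f7; rewrite leq_mul2r; apply/orP; right.
    have -> : (260 * U * m * e0 * 2 = 520 * U * e0 * m)%N by ring.
    by rewrite leq_mul2l leqnSn orbT.
- move=> l j jJ; rewrite mulnSr exprD mulrA.
  apply: le_trans (structured_bound hF S0 hS an l (M := M j) (s0 := s0) (b := b) (k := k)
    (m := m) (D := D) (Q := Q) (lhi := (L j)%:R^-1) (llo := (L j.+1)%:R^-1)
    (rhi := 2 * gain R ^+ m * loss R ^+ (m * j)) (Y := Y) _ _ _ _ _ _ _ _ _ _ _ _ _ _ _ _ _ _ _ _) _ => //.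
  + by rewrite invr_gt0 ltr0n.
  + by rewrite !mulr_gt0// exprn_gt0.
  + apply: (@le_trans _ _ (2 * gain R ^+ m)); last exact: double_half_le.
    by rewrite ler_piMr ?exprn_ile1 ?mulr_ge0 ?(ltW l0) ?(ltW gm0).
  + move=> w /andP[sw _]; have bw : (16 * b * (4 * e0) <= w)%N.
      have -> : (16 * b * (4 * e0) = 64 * e0 * b)%N by ring.
      exact: leq_trans sb sw.
    by rewrite !(tail_okP (e := 4 * e0)) ?muln_gt0 ?e00 ?b4.
  + exact: tail_small hU' hb1.
  + by apply: (level_product_le (ltW gm0) _ _ f2); rewrite ?exprn_ge0 ?exprn_ile1 ?(ltW l0).
  + exact: trivial_patterns_le hNn nQb Q0 jJ hk f5.
  (* The scales are spaced so that collisions at [2 ^ m] times the next scale are exactly at the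
     mesh [1 / M j]. *)
  + have -> : L j.+1 = (2 ^ m * M j)%N by rewrite /M /L (expnSr (2 ^ m * _)) [LHS]mulnA [LHS]mulnC -[LHS]mulnA.
    by rewrite natrM natrX invfM mulrA divff ?mul1r// expf_neq0// pnatr_eq0.
  + have -> : (M j)%:R = 4 * (n ^ G.+1)%:R * (L j)%:R :> R by rewrite /M !natrM.
    by apply: grid_scale => //; rewrite ltr0n.
  + by rewrite -natrX ler_nat; exact: B3.
  exact: half_pow_antimono (half_sub_le n D0).
Qed.

Lemma ev_exp_half (R : realType) (x K : R) (c : nat) : 0 < x -> x < 1 -> 0 <= K ->
  ev (fun n => K * n%:R ^+ c * x ^+ (n %/ 2) <= 1).
Proof.
move=> x0 x1 K0; pose y := Num.sqrt x.
have y0 : 0 < y by rewrite sqrtr_gt0.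
have y2 : y ^+ 2 = x by rewrite sqr_sqrtr// ltW.
have y1 : y < 1 by rewrite -sqrtr1 ltr_sqrt.
have Ky : 0 <= K / y by rewrite divr_ge0// ltW.
apply: ev_imp (ev_exp_poly c Ky y0 y1) => n; apply: le_trans.
rewrite -y2 -exprM -!mulrA ler_wpM2l// [leRHS]mulrCA ler_wpM2l ?exprn_ge0//.
have h : (n <= (2 * (n %/ 2)).+1)%N by have := ltn_ceil n (isT : (0 < 2)%N); lia.
have := ler_wiXn2l (ltW y0) (ltW y1) h.
by rewrite exprS ler_pdivlMl.
Qed.

Lemma polynomial_estimate (R : realType) (y n m beta J : nat) (kap x g lam : R) :
  (0 < n)%N -> (n <= (y ^ m) ^ 2)%N -> 0 < x -> 0 <= kap -> kap <= x -> 1 / 2 <= x ->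
  0 <= g -> g <= 1 -> 0 <= lam ->
  (y%:R ^+ 2) ^+ beta.+1 * lam ^+ J <= 1 ->
  (J%:R + 1) * n%:R ^+ beta.+1 * x ^+ (n %/ 2) <= 1 ->
  n%:R * (kap ^+ (n %/ 2) + (J%:R * (1 / 2) ^+ (n %/ 2) + 2 * g ^+ m * lam ^+ (m * J))) <=
    3 * (n%:R ^+ beta)^-1.
Proof.
move=> n0 hn x0 k0 kx hx g0 g1 lam0 hl he.
have n0' : 0 < n%:R :> R by rewrite ltr0n.
have nb : 0 < n%:R ^+ beta :> R by rewrite exprn_gt0.
rewrite ler_pdivlMr//.
have e1 : kap ^+ (n %/ 2) <= x ^+ (n %/ 2) by apply: lerXn2r; rewrite ?nnegrE// ltW.
have e2 : (1 / 2) ^+ (n %/ 2) <= x ^+ (n %/ 2).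
  by apply: lerXn2r; rewrite ?nnegrE ?divr_ge0// ltW.
(* The power [lam ^+ (m * J)] cancels [n ^ beta.+1 <= (y ^ 2) ^ (beta.+1 * m)]; the extra power of
   [n] pays for the union over rows. *)
have e3 : n%:R ^+ beta.+1 * (2 * g ^+ m * lam ^+ (m * J)) <= 2.
  have h1 : g ^+ m <= 1 by apply: exprn_ile1.
  have h2 : n%:R ^+ beta.+1 <= ((y%:R ^+ 2) ^+ beta.+1) ^+ m :> R.
    rewrite exprAC lerXn2r ?nnegrE ?exprn_ge0//.
    by rewrite exprAC -!natrX ler_nat.
  have h3 : n%:R ^+ beta.+1 * lam ^+ (m * J) <= 1.
    apply: (@le_trans _ _ (((y%:R ^+ 2) ^+ beta.+1) ^+ m * lam ^+ (m * J))).
      by rewrite ler_wpM2r// exprn_ge0.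
    rewrite mulnC exprM -exprMn exprn_ile1// mulr_ge0// exprn_ge0//.
  rewrite -!mulrA mulrCA [_ * (g ^+ m * _)]mulrCA ger_pMr//.
  by rewrite mulr_ile1// ?exprn_ge0// mulr_ge0// exprn_ge0.
have J0 : 0 <= J%:R :> R by [].
have e4 : kap ^+ (n %/ 2) + J%:R * (1 / 2) ^+ (n %/ 2) <= (J%:R + 1) * x ^+ (n %/ 2).
  by have := ler_wpM2l J0 e2; rewrite mulrDl mul1r; lra.
have nb1 : 0 <= n%:R ^+ beta.+1 :> R by rewrite exprn_ge0.
have e5 := ler_wpM2l nb1 e4.
rewrite mulrAC -exprS addrA mulrDr.
move: e5 he e3; set P := n%:R ^+ beta.+1; lra.
Qed.

Lemma exists_pos_pow_le (R : realType) (x c : R) : 0 < x -> x < 1 -> 0 < c ->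
  exists j : nat, (0 < j)%N /\ x ^+ j <= c.
Proof.
move=> x0 x1 c0; have [j hj] := exists_pow_le x0 x1 c0.
by exists j.+1; split=> //; apply: le_trans hj; apply: ler_wiXn2l => //; exact: ltW.
Qed.

Lemma inv_lt1 (R : realType) k : 0 < 1 / k.+1%:R :> R /\ ((0 < k)%N -> 1 / k.+1%:R < 1 :> R).
Proof. by rewrite divr_gt0// ltr_pdivrMr// mul1r ltr1n ltnS. Qed.

Lemma gain_le1 (R : realType) : gain R <= 1.
Proof. by rewrite /gain; lra. Qed.

Lemma half_lt a n : (2 * a + 1 < 2 * n)%N -> (a < n)%N.
Proof. lia. Qed.

Lemma room_above (R : realType) (n s eps : R) : - ((1 - eps) * n) <= s -> eps * n <= n + s.
Proof. lra. Qed.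

Lemma room_below (R : realType) (n s a eps : R) :
  s <= (1 - eps) * n -> 2 * a + 1 = n + s -> eps * n <= 2 * (n - (a + 1)) + 1.
Proof. lra. Qed.

Lemma mul_le1_of_le_inv (R : realType) (c x : R) : 0 < c^-1 -> x <= c^-1 -> c * x <= 1.
Proof. by rewrite invr_gt0 => c0 h; rewrite mulrC -ler_pdivlMr// mul1r. Qed.

Lemma half_of_double (R : realType) (x : R) : 2 * x <= 1 -> x <= 1 / 2.
Proof. lra. Qed.

Theorem theorem2p6 (R : realType) (gamma B : R) :
  0 < B ->
  exists A : R, 0 < A /\
    forall eps : R, 0 < eps -> eps <= 1 ->
    exists C : R, 0 < C /\
      forall (n : nat) (s : int) (F : 'M[R[i]]_n),
        (0 < n)%N ->
        `|(s%:~R : R)| <= (1 - eps) * n%:R ->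
        (0 < #|Sset n s|)%N ->
        (forall i j, Normc.normc (F i j) <= n%:R `^ gamma) ->
        probX R s (fun X => sigma_min (signmx R X + F) < n%:R `^ (- A))
          <= C * n%:R `^ (- B).
Proof.
move=> B0.
have [beta hB] := exists_nat_ge B.
have [G hG] := exists_nat_ge gamma.
have l0 := loss_gt0 R; have l1 := loss_lt1 R; have g0 := gain_gt0 R.
have c243 : 0 < ((243%:R ^+ 2) ^+ beta.+1)^-1 :> R by rewrite invr_gt0; do 2 apply: exprn_gt0; rewrite ltr0n.
(* [J] makes [loss ^+ (m * J)] at most [n ^ -(beta + 1)]. It is fixed before [eps], as is the
   exponent [A], which may depend only on [B] and [gamma]. *)
have [J hJ] := exists_pow_le l0 l1 c243.
have lJ0 : 0 < loss R ^+ J by rewrite exprn_gt0.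
have [i243 /(_ isT) i243'] := inv_lt1 R 242; have [i2 /(_ isT) i2'] := inv_lt1 R 1.
have [k [k0 hk]] := exists_pos_pow_le i243 i243' (divr_gt0 lJ0 (ltr0n R 2)).
pose E := (2 * G + 5)%N.
pose Y : R := (243 ^ (2 * (E * J.+1) + 1))%:R.
have Y0 : 0 < Y^-1 by rewrite invr_gt0 ltr0n expn_gt0.
(* [D] solved coordinates will pay for one free coordinate. *)
have [D [D0 hD]] := exists_pos_pow_le l0 l1 Y0.
have {}hD := mul_le1_of_le_inv Y0 hD.
exists (E * J.+1 + 2)%:R; split; first by rewrite ltr0n addn2.
move=> eps eps0 eps1.
(* An integer form of [1 / eps]: both [n + s] and [n - s] are at least [n / e0]. *)
have [e0 he0] := exists_nat_ge eps^-1.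
have e00 : (0 < e0)%N by rewrite -(ltr_nat R); apply: lt_le_trans he0; rewrite invr_gt0.
have k1 : 0 < 1 - flip_prob R e0 by rewrite subr_gt0 flip_prob_lt1.
have k2 : 1 - flip_prob R e0 < 1 by rewrite gtrBl flip_prob_gt0.
have Y10 : 0 < ((243 ^ (4 * G + 8))%:R)^-1 :> R by rewrite invr_gt0 ltr0n expn_gt0.
have [U hU] := exists_pow_le k1 k2 Y10.
have [U' hU'] := exists_pow_le i2 i2' (mulr_gt0 g0 lJ0).
pose Q := (64 * e0 * D.+1)%N.
pose K1 : R := ((4 * k + 3) ^ 2)%:R * 128 * (2 * Q)%:R ^+ (2 * k).
pose K5 : R := (k ^ k)%:R * 64 * (2 * Q)%:R ^+ (2 * k).
have K10 : 0 <= 2 * K1 by rewrite !mulr_ge0// exprn_ge0.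
have K50 : 0 <= K5 by rewrite !mulr_ge0// exprn_ge0.
have [m0 hm0] := ev_and (ev_ge 1) (ev_and (ev_exp_const K10 l0 l1)
  (ev_and (ev_exp_const (ltW (ltr0n R 2)) l0 l1)
  (ev_and (ev_nat R (Q * (8 * k ^ 2)) (isT : (0 < 9)%N) (isT : (9 < 243)%N))
  (ev_and (ev_nat R (Q * U'.+1) (isT : (0 < 1)%N) (isT : (1 < 243)%N))
  (ev_and (ev_exp_const K50 (ltr01 : 0 < 1 :> R) (ltr1n R 2))
  (ev_and (ev_nat R (520 * U * e0) (isT : (0 < 4)%N) (isT : (4 < 5)%N))
  (ev_and (ev_nat R (32 * e0) (isT : (0 < 4)%N) (isT : (4 < 5)%N))
  (ev_and (ev_nat R 2 (isT : (0 < 405)%N) (isT : (405 < 972)%N))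
  (ev_and (ev_nat R 18 (isT : (0 < 1)%N) (isT : (1 < 81)%N))
  (ev_nat R (4 * e0) (isT : (0 < 9)%N) (isT : (9 < 243)%N))))))))))).
pose x := Num.max (1 - flip_prob R e0) (1 / 2).
have x0 : 0 < x by rewrite lt_max k1.
have x1 : x < 1 by rewrite gt_max k2.
have J1 : 0 <= J%:R + 1 :> R by rewrite addr_ge0.
have [n1 hn1] := ev_exp_half beta.+1 x0 x1 J1.
pose n0 := maxn (243 ^ m0) n1.
(* The summand [n0 ^ beta] makes the bound trivial for [n < n0]. *)
exists (3 + n0%:R ^+ beta); split; first by rewrite ltr_wpDr// exprn_ge0.
move=> n s F npos hs S0 hF.
have n0' : 0 < n%:R :> R by rewrite ltr0n.
have n1' : 1 <= n%:R :> R by rewrite ler1n.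
have nB : (n%:R ^+ beta)^-1 <= n%:R `^ (- B) :> R.
  rewrite powRN lef_pV2 ?posrE ?exprn_gt0 ?powR_gt0// -powR_mulrn ?(ltW n0')//.
  exact: ler_powR.
have nB0 : 0 <= n%:R `^ (- B) :> R := powR_ge0 _ _.
have [nn0|nn0] := ltnP n n0.
  apply: le_trans (@probX_le1 R n s S0 _) _.
  apply: (@le_trans _ _ (n0%:R ^+ beta * n%:R `^ (- B))); last first.
    by rewrite ler_wpM2r// lerDr.
  apply: (@le_trans _ _ (n0%:R ^+ beta * (n%:R ^+ beta)^-1)); last by rewrite ler_wpM2l// exprn_ge0.
  by rewrite ler_pdivlMr ?exprn_gt0// mul1r lerXn2r ?nnegrE// ler_nat ltnW.
apply: (@le_trans _ _ (3 * (n%:R ^+ beta)^-1)); last first.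
  apply: (@le_trans _ _ (3 * n%:R `^ (- B))); first by rewrite ler_wpM2l.
  by rewrite ler_wpM2r// lerDl exprn_ge0.
(* Since [n < 243 ^ m.+1] and [m >= 1], also [n <= (243 ^ m) ^ 2]. *)
pose m := trunc_log 243 n.
have hm : (m0 <= m)%N.
  by apply: trunc_log_max => //; apply: leq_trans nn0; rewrite leq_maxl.
have hNn : (243 ^ m <= n)%N := trunc_logP (isT : (1 < 243)%N) npos.
have [m1 [f1 [f2 [f3 [f4 [f5 [f7 [f7' [f8 [f9 f11]]]]]]]]]] := hm0 m hm.
have hnN : (n <= (243 ^ m) ^ 2)%N.
  apply: leq_trans (ltnW (trunc_log_ltn n (isT : (1 < 243)%N))) _.
  by rewrite -/m -mulnn expnS leq_mul2r; apply/orP; right; rewrite -[X in (X <= _)%N]expn1 leq_exp2l.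
have sn : `|s%:~R| < n%:R :> R.
  by apply: le_lt_trans hs _; rewrite -[ltRHS]mul1r ltr_pM2r// gtrBl.
have [a [ha hS]] : exists a : nat, (2 * a + 1)%N%:Z = n%:Z + s /\
    forall x, (x \in Sset n s) = (rowset x \in @slice 'I_n a).
  apply: Sset_level => //; rewrite -(ltr_int R) rmorphN /=.
  by move: sn; rewrite ltr_norml => /andP[].
have haR : (2 * a + 1)%:R = n%:R + s%:~R :> R.
  by have := congr1 (fun z : int => z%:~R : R) ha; rewrite intrD -!pmulrn.
have an : (a < n)%N.
  have : (2 * a + 1)%:R < (2 * n)%:R :> R.
    by rewrite haR [ltRHS]natrM mulr_natl mulr2n ltrD2l; case/ltr_normlP: sn.
  by rewrite ltr_nat; exact: half_lt.
have he : n%:R <= e0%:R * (eps * n%:R) :> R.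
  by rewrite mulrA ler_peMl ?(ltW n0')// -ler_pdivrMr// div1r.
have ha1 : (n <= e0 * (2 * a + 1))%N.
  rewrite -(ler_nat R) natrM haR; apply: le_trans he _; rewrite ler_wpM2l//.
  by move: hs; rewrite ler_norml => /andP[h1 _]; exact: room_above h1.
have ha2 : (n <= e0 * (2 * (n - a.+1) + 1))%N.
  rewrite -(ler_nat R) natrM natrD natrM natrB//; apply: le_trans he _; rewrite ler_wpM2l//.
  move: hs haR; rewrite ler_norml natrD natrM -[a.+1%:R]natr1 => /andP[_ h2] h3.
  exact: room_below h2 h3.
have hF' i j : Normc.normc (F i j) <= n%:R ^+ G.
  apply: le_trans (hF i j) _; rewrite -powR_mulrn ?(ltW n0')//; exact: ler_powR.
have -> : n%:R `^ (- (E * J.+1 + 2)%:R) = (n%:R ^+ (E * J.+1 + 2))^-1 :> R.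
  by rewrite powRN powR_mulrn// (ltW n0').
apply: le_trans (@core_bound R G J k D e0 U U' n m s F a k0 D0 e00 hk hD _ hU' m1 hNn hnN
   _ _ f3 f4 _ f7 f7' _ f9 f11 S0 hS an ha1 ha2 hF') _.
- by rewrite mulrC; exact: mul_le1_of_le_inv Y10 hU.
- by move: f1; rewrite expr1n -mulrA; exact: half_of_double.
- by move: f2; rewrite expr1n; exact: half_of_double.
- by move: f5; rewrite expr1n mulr1.
- exact: f8.
have [k1' k2'] := (ltW k1, ltW k2).
apply: (polynomial_estimate (x := x) npos hnN x0 k1').
- by rewrite /x le_max lexx.
- by rewrite /x le_max lexx orbT.
- exact: ltW g0.
- exact: gain_le1.
- exact: ltW l0.
- exact: mul_le1_of_le_inv c243 hJ.
- by apply: hn1; apply: leq_trans nn0; rewrite leq_maxr.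
Qed.
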